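(* There exists an absolute constant $C>0$ such that the following holds. Let $\{X_i\}_{i\in\mathcal{J}}$ be a finite family of real-valued random variables with $\mathbb{E}X_i=0$ for all $i\in\mathcal{J}$, satisfying (LD1) and (LD2) with sets $A_i\subset B_i\subset\mathcal{J}$ as in the context, and with $\sigma^2=\operatorname{Var}(S)>0$. With $W,\kappa,\beta_0,\beta_2,\beta_3,\theta$ as defined in the context, $$\sup_{z\in\mathbb{R}}\bigl|\mathbb{P}(W\le z)-\Phi(z)\bigr|\le C\bigl\{(1+\theta)\kappa^2\beta_3+\kappa\beta_2+\beta_0\bigr\}+C\kappa^{1/2}(\theta+1)|\mathcal{J}|^{-1/2},$$ where $\Phi$ is the standard normal distribution function.
   Context: $\mathcal{J}$ is a finite nonempty index set (no structure is assumed on it), $|A|$ denotes the cardinality of a set $A$, and $\mathrm{I}(\cdot)$ denotes an indicator. The $X_i$ are defined on a common probability space and have finite second moments. (LD1): for every $i\in\mathcal{J}$, $A_i\subset\mathcal{J}$ is such that $X_i$ is independent of $\{X_j: j\notin A_i\}$. (LD2): for every $i\in\mathcal{J}$, $B_i\subset\mathcal{J}$ is such that $B_i\supset A_i$ and $\{X_j: j\in A_i\}$ is independent of $\{X_j: j\notin B_i\}$. Define $S=\sum_{i\in\mathcal{J}}X_i$, $\sigma=(\operatorname{Var}(S))^{1/2}$, $Y_i=\sum_{j\in A_i}X_j$, $\bar X=\sum_{i\in\mathcal{J}}X_i/|\mathcal{J}|$, $\bar Y=\sum_{j\in\mathcal{J}}Y_j/|\mathcal{J}|$, $$V=\sqrt{\Bigl(\sum_{i\in\mathcal{J}}(X_iY_i-\bar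 X\bar Y)\Bigr)_+},\qquad W=S/V,$$ where $(x)_+=\max(x,0)$ (and $W:=0$ on the event $\{V=0\}$). $\kappa$ is any number with $\kappa\ge\max_{i\in\mathcal{J}}\max\bigl\{|\{j: B_i\cap A_j\ne\emptyset\}|,\ |\{j: i\in B_j\}|\bigr\}$, and $$\beta_0=\sum_{i\in\mathcal{J}}\mathbb{P}(|X_i|>\sigma/\kappa),\qquad \beta_2=\frac1{\sigma^2}\sum_{i\in\mathcal{J}}\mathbb{E}\{|X_i|^2\,\mathrm{I}(|X_i|>\sigma/\kappa)\},$$ $$\beta_3=\frac1{\sigma^3}\sum_{i\in\mathcal{J}}\mathbb{E}\{|X_i|^3\,\mathrm{I}(|X_i|\le\sigma/\kappa)\},\qquad \theta=\frac1{\sigma^2}\sum_{i\in\mathcal{J}}\sum_{j\in A_i}\mathbb{E}\bigl|X_iX_j\,\mathrm{I}(|X_i|\le\sigma/\kappa,\ |X_j|\le\sigma/\kappa)\bigr|.$$ *)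

(* Defs.v *)
From HB Require Import structures.
From mathcomp Require Import all_boot all_order all_algebra.
From mathcomp Require Import all_classical all_reals all_analysis.

Set Implicit Arguments.
Unset Strict Implicit.
Unset Printing Implicit Defensive.

Import Order.TTheory GRing.Theory Num.Theory.
Import numFieldNormedType.Exports.

Local Open Scope ring_scope.

Section LocalDependence.
Context {d : measure_display} {T : measurableType d} {R : realType}.
Context {P : probability T R} {J : finType}.
Implicit Types (X : J -> {RV P >-> R}) (A B : J -> {set J}) (D : {set J}).

Definition sigma_family X D : set (set T) :=
  <<s (\bigcup_(j in [set` D])
         preimage_set_system setT (X j) measurable)%classic >>.

Definition indep_families X D1 D2 : Prop :=
  forall E F : set T, sigma_family X D1 E -> sigma_family X D2 F ->
    P (E `&` F)%classic = (P E * P F)%E.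

Definition LD1 X A : Prop :=
  forall i : J, indep_families X (finset.set1 i) (~: A i).

Definition LD2 X A B : Prop :=
  forall i : J, A i \subset B i /\ indep_families X (A i) (~: B i).

Definition sumX X (w : T) : R := \sum_i X i w.

(* [fine] is harmless here and below: every expectation it is applied to is
   finite when the X i are square integrable. *)
Definition sigma X : R := Num.sqrt (fine 'V_P[sumX X]).

Definition Y X A (i : J) (w : T) : R := \sum_(j in A i) X j w.

Definition Xbar X (w : T) : R := (\sum_i X i w) / #|J|%:R.

Definition Ybar X A (w : T) : R := (\sum_j Y X A j w) / #|J|%:R.

Definition V X A (w : T) : R :=
  Num.sqrt (Num.max (\sum_i (X i w * Y X A i w - Xbar X w * Ybar X A w)) 0).

Definition W X A (w : T) : R :=
  if V X A w == 0 then 0 else sumX X w / V X A w.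

Definition max_degree A B : nat :=
  (\max_(i : J) maxn #|[pred j | B i :&: A j != finset.set0]|
                     #|[pred j | i \in B j]|)%N.

Definition beta0 X (kappa : R) : R :=
  \sum_i fine (P [set w | sigma X / kappa < `|X i w|]%classic).

Definition beta2 X (kappa : R) : R :=
  (sigma X ^+ 2)^-1 *
  \sum_i fine 'E_P[fun w =>
    `|X i w| ^+ 2 * \1_[set u | sigma X / kappa < `|X i u|]%classic w].

Definition beta3 X (kappa : R) : R :=
  (sigma X ^+ 3)^-1 *
  \sum_i fine 'E_P[fun w =>
    `|X i w| ^+ 3 * \1_[set u | `|X i u| <= sigma X / kappa]%classic w].

Definition theta X A (kappa : R) : R :=
  (sigma X ^+ 2)^-1 *
  \sum_i \sum_(j in A i) fine 'E_P[fun w =>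
    `|X i w * X j w *
      \1_[set u | `|X i u| <= sigma X / kappa /\
                  `|X j u| <= sigma X / kappa]%classic w| ].

End LocalDependence.

Definition Phi {R : realType} (z : R) : R :=
  fine (normal_prob 0 1 `]-oo, z]%classic).

(* Main.v *)
(* Truncate X_i at sigma/kappa, scale it by sigma and round it towards 0 to a
   grid of step h = 1/n.  The rounded variables take finitely many values, so
   their joint law lives on a finite space, where they are bounded by 1/kappa
   and still satisfy (LD1) and (LD2); write x_i for them, y_i for the sum of the
   x_j with j in A_i, and S, U, T for the sums of x_i, x_i y_i and y_i / kappa.
   Truncation costs beta0 in probability and kappa beta2 in the mean of U, and
   rounding can be made arbitrarily cheap.  Since
     V^2 / sigma^2 = (U - (kappa / |J|) S T)_+
   up to rounding, and S^2 |T| has mean O(1 + theta), W is within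
   rho = (kappa / |J|)^(1/2) of S / sqrt U with high probability, where U is
   clipped to [1/2, 2].

   Stein's method is applied directly to the self-normalized sum S g(U), with
   g(u) = 1 / sqrt (clip u), and not to S.  In E[x_j g(U) f((S - y_j) g(U))]
   the statistic U depends on X_j only through the products meeting A_j;
   replacing U by what remains costs O(kappa^2 beta3).  The concentration of
   S g(U) needed for the jump of the Stein solution is obtained in the same way
   from a bounded increasing test function f with f' = phi integrable and
   |phi'| <= 2 phi / a: the error terms of the Stein identity are then
   controlled by the very quantity E[phi(S g(U) - z)] being bounded, with a
   small factor, so the estimate improves itself and can be iterated. *)

Require Import Defs.
From HB Require Import structures.
From mathcomp Require Import all_boot all_order all_algebra ring lra.
Set Implicit Arguments.
Unset Strict Implicit.
Unset Printing Implicit Defensive.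
Import Order.TTheory GRing.Theory Num.Theory.
Local Open Scope ring_scope.

(** * Expectations on a finite space *)

(** The Taylor step of Stein's method leaves a jump term with weight |x_j y_j| and a window whose
    width grows with |y_j|; both depend on the block A_j. Concentration is therefore proved for a
    random weight w and a random width a, functions of a block D that is independent of everything
    outside N. Summing E[w a] over j gives a multiple of (1 + theta) b, the source of the product of
    theta and beta3 in the result. The weight cannot be decoupled from the indices j whose A_j meets
    N: there are at most kappa of them and they are set aside, while paths that return to N go into
    a separate term [near], which sums back to order b.

    Finiteness of the space serves twice. Independence becomes factorization of expectations of
    arbitrary functions, and integrals over the concentration kernel become finite sums over a grid
    that contains every y_j. The final bounds do not involve the step h, so it can be chosen last.
    Smallness of the errors may be assumed throughout, since otherwise the theorem is trivial for a
    large constant. *)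

Section FiniteExpectation.
Variables (R : rcfType) (Om : finType) (p : Om -> R).

Definition Ex (f : Om -> R) := \sum_w p w * f w.

Lemma eq_Ex f g : f =1 g -> Ex f = Ex g.
Proof. by move=> fg; apply: eq_bigr => w _; rewrite fg. Qed.

Lemma ExD f g : Ex (fun w => f w + g w) = Ex f + Ex g.
Proof. by rewrite -big_split; apply: eq_bigr => w _; rewrite mulrDr. Qed.

Lemma ExZ c f : Ex (fun w => c * f w) = c * Ex f.
Proof. by rewrite mulr_sumr; apply: eq_bigr => w _; rewrite mulrCA. Qed.

Lemma ExZr c f : Ex (fun w => f w * c) = Ex f * c.
Proof. by rewrite mulr_suml; apply: eq_bigr => w _; rewrite mulrA. Qed.

Lemma ExN f : Ex (fun w => - f w) = - Ex f.
Proof. by rewrite -sumrN; apply: eq_bigr => w _; rewrite mulrN. Qed.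

Lemma ExB f g : Ex (fun w => f w - g w) = Ex f - Ex g.
Proof. by rewrite ExD ExN. Qed.

Lemma Ex_sum (I : Type) (r : seq I) (P : pred I) (f : I -> Om -> R) :
  Ex (fun w => \sum_(i <- r | P i) f i w) = \sum_(i <- r | P i) Ex (f i).
Proof.
rewrite /Ex exchange_big; apply: eq_bigr => w _; exact: mulr_sumr.
Qed.

Hypotheses (p0 : forall w, 0 <= p w) (p1 : \sum_w p w = 1).

Lemma Ex_cst c : Ex (fun=> c) = c.
Proof. by rewrite /Ex -mulr_suml p1 mul1r. Qed.

Lemma le_Ex f g : (forall w, f w <= g w) -> Ex f <= Ex g.
Proof. by move=> fg; apply: ler_sum => w _; apply: ler_wpM2l. Qed.

Lemma Ex_ge0 f : (forall w, 0 <= f w) -> 0 <= Ex f.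
Proof. by move=> f0; apply: sumr_ge0 => w _; apply: mulr_ge0. Qed.

Lemma ler_norm_Ex f : `|Ex f| <= Ex (fun w => `|f w|).
Proof.
apply: le_trans (ler_norm_sum _ _ _) _; apply: ler_sum => w _.
by rewrite normrM (ger0_norm (p0 w)).
Qed.

End FiniteExpectation.

(** * Sums over paths in graphs of bounded degree *)

Section Paths.
Variables (R : rcfType) (J : finType) (k : R).

Definition degree_le (e : rel J) :=
  (forall a, #|[pred b | e a b]|%:R <= k) /\
  (forall b, #|[pred a | e a b]|%:R <= k).

Definition flip (e : rel J) : rel J := fun a b => e b a.

Lemma degree_le_flip e : degree_le e -> degree_le (flip e).
Proof. by case. Qed.

Lemma sum_card (P : pred J) (c : R) : \sum_(j | P j) c = #|P|%:R * c.
Proof. by rewrite sumr_const mulr_natl. Qed.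

Lemma exchange_rel (e : rel J) (F : J -> J -> R) :
  \sum_a \sum_(b | e a b) F a b = \sum_b \sum_(a | e a b) F a b.
Proof. by rewrite (exchange_big_dep predT). Qed.

Lemma sum_path_l e (u : J -> R) : degree_le e -> (forall j, 0 <= u j) ->
  \sum_a \sum_(b | e a b) u a <= k * \sum_a u a.
Proof.
move=> [e1 e2] u0; rewrite mulr_sumr; apply: ler_sum => a _.
rewrite sum_card; exact: (ler_wpM2r (u0 a) (e1 a)).
Qed.

Lemma sum_path_r e (u : J -> R) : degree_le e -> (forall j, 0 <= u j) ->
  \sum_a \sum_(b | e a b) u b <= k * \sum_a u a.
Proof.
move=> [e1 e2] u0; rewrite exchange_rel mulr_sumr.
apply: ler_sum => b _; rewrite sum_card; exact: (ler_wpM2r (u0 b) (e2 b)).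
Qed.

Variables (e1 e2 : rel J).
Hypotheses (d1 : degree_le e1) (d2 : degree_le e2) (k0 : 0 <= k).

(** By the inequality of arithmetic and geometric means, a product along a path costs a third of the
    cube at each vertex, and each vertex occupies a given position on at most [k ^+ 2] paths. *)
Lemma sum_path3 (u : J -> R) : (forall j, 0 <= u j) ->
  \sum_a \sum_(b | e1 a b) \sum_(c | e2 b c) u a * u b * u c
    <= k ^+ 2 * \sum_j u j ^+ 3.
Proof.
move=> u0.
have u30 j : 0 <= u j ^+ 3 by rewrite exprn_ge0.
have S0 : 0 <= \sum_j u j ^+ 3 by exact: sumr_ge0.
have am a b c : u a * u b * u c <=
    3^-1 * u a ^+ 3 + (3^-1 * u b ^+ 3 + 3^-1 * u c ^+ 3).
  have ua := u0 a; have ub := u0 b; have uc := u0 c; move: ua ub uc.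
  move: (u a) (u b) (u c) => r s t r0 s0 t0.
  (* Half of this product is r^3 + s^3 + t^3 - 3 r s t. *)
  have H : 0 <= (r + s + t) * ((r - s) ^+ 2 + (s - t) ^+ 2 + (t - r) ^+ 2).
    by rewrite mulr_ge0 ?addr_ge0 ?sqr_ge0.
  nra.
apply: (@le_trans _ _ (\sum_a \sum_(b | e1 a b) \sum_(c | e2 b c)
   (3^-1 * u a ^+ 3 + (3^-1 * u b ^+ 3 + 3^-1 * u c ^+ 3)))).
  by apply: ler_sum => a _; apply: ler_sum => b _; apply: ler_sum => c _.
under eq_bigr => a _ do (under eq_bigr => b _ do rewrite !big_split /=;
  rewrite !big_split /=).
rewrite !big_split /=.
have T1 : \sum_a \sum_(b | e1 a b) \sum_(c | e2 b c) 3^-1 * u a ^+ 3 <=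
    3^-1 * (k ^+ 2 * \sum_j u j ^+ 3).
  apply: (@le_trans _ _ (\sum_a \sum_(b | e1 a b) k * (3^-1 * u a ^+ 3))).
    apply: ler_sum => a _; apply: ler_sum => b _; rewrite sum_card.
    apply: ler_wpM2r; [by rewrite mulr_ge0 // invr_ge0 | exact: d2.1].
  apply: le_trans (sum_path_l d1 _) _ => [j|]; first by rewrite !mulr_ge0 ?invr_ge0.
  rewrite -!mulr_sumr; lra.
have T2 : \sum_a \sum_(b | e1 a b) \sum_(c | e2 b c) 3^-1 * u b ^+ 3 <=
    3^-1 * (k ^+ 2 * \sum_j u j ^+ 3).
  apply: (@le_trans _ _ (\sum_a \sum_(b | e1 a b) k * (3^-1 * u b ^+ 3))).
    apply: ler_sum => a _; apply: ler_sum => b _; rewrite sum_card.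
    apply: ler_wpM2r; [by rewrite mulr_ge0 // invr_ge0 | exact: d2.1].
  apply: le_trans (sum_path_r d1 _) _ => [j|]; first by rewrite !mulr_ge0 ?invr_ge0.
  rewrite -!mulr_sumr; lra.
have T3 : \sum_a \sum_(b | e1 a b) \sum_(c | e2 b c) 3^-1 * u c ^+ 3 <=
    3^-1 * (k ^+ 2 * \sum_j u j ^+ 3).
  apply: le_trans (sum_path_r d1 _) _ => [j|].
    by apply: sumr_ge0 => c _; rewrite mulr_ge0 ?invr_ge0.
  apply: le_trans (ler_wpM2l k0 (sum_path_r d2 _)) _ => [j|].
    by rewrite mulr_ge0 ?invr_ge0.
  rewrite -mulr_sumr; lra.
have := lerD T1 (lerD T2 T3); lra.
Qed.

Variable u : J -> R.
Hypotheses (u0 : forall j, 0 <= u j).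
Hypothesis u1 : forall P : pred J, #|P|%:R <= k -> \sum_(j | P j) u j <= 1.

(** A path starting outside [N] either stays outside, and is counted by cubes, or visits [N] at its
    second or third vertex. In the latter case the two other factors are summed out by [u1], leaving
    a first power on [N]. No cube of a variable in [N] appears, since it need not be independent of
    a weight carried by the block. *)
Lemma sum_path3_split (N : {set J}) :
  \sum_(a | a \notin N) \sum_(b | e1 a b) \sum_(c | e2 b c) u a * u b * u c
    <= k ^+ 2 * (\sum_(j | j \notin N) u j ^+ 3) + 2 * \sum_(j in N) u j.
Proof.
pose v j := if j \notin N then u j else 0.
pose n j := if j \in N then u j else 0.
have v0 j : 0 <= v j by rewrite /v; case: ifP.
have n0 j : 0 <= n j by rewrite /n; case: ifP.
have -> : \sum_(j | j \notin N) u j ^+ 3 = \sum_j v j ^+ 3.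
  rewrite big_mkcond; apply: eq_bigr => j _; rewrite /v.
  by case: ifP => // _; rewrite expr0n.
have nE : \sum_(j in N) u j = \sum_j n j by rewrite big_mkcond.
apply: le_trans (lerD (sum_path3 v0) (lexx _)).
have -> : 2 * \sum_(j in N) u j = \sum_j n j + \sum_j n j by rewrite nE; ring.
apply: (@le_trans _ _ (\sum_a \sum_(b | e1 a b) \sum_(c | e2 b c)
   (v a * v b * v c + (u a * n b * u c + u a * u b * n c)))).
  rewrite big_mkcond; apply: ler_sum => a _; case: ifP => aN; last first.
    apply: sumr_ge0 => b _; apply: sumr_ge0 => c _.
    by rewrite !addr_ge0 ?mulr_ge0.
  apply: ler_sum => b _; apply: ler_sum => c _.
  have H1 : 0 <= u a * n b * u c by rewrite !mulr_ge0.
  have H2 : 0 <= u a * u b * n c by rewrite !mulr_ge0.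
  move: H1 H2; rewrite /v /n aN; case: (b \in N) => /=; case: (c \in N) => /=; lra.
under eq_bigr => a _ do (under eq_bigr => b _ do rewrite !big_split /=;
  rewrite !big_split /=).
rewrite !big_split /=; apply: lerD => //; apply: lerD.
  rewrite exchange_rel; apply: ler_sum => b _.
  have -> : \sum_(a | e1 a b) \sum_(c | e2 b c) u a * n b * u c =
      n b * ((\sum_(a | e1 a b) u a) * \sum_(c | e2 b c) u c).
    rewrite mulr_suml mulr_sumr; apply: eq_bigr => a _.
    by rewrite !mulr_sumr; apply: eq_bigr => c _; rewrite mulrCA mulrA.
  rewrite ler_piMr // -[leRHS]mulr1; apply: ler_pM; rewrite ?sumr_ge0 //.
    by apply: u1; exact: d1.2.
  by apply: u1; exact: d2.1.
rewrite exchange_rel (eq_bigr (fun b => \sum_(c | e2 b c) \sum_(a | e1 a b)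
  u a * u b * n c)) => [|b _]; last by rewrite exchange_big.
rewrite exchange_rel; apply: ler_sum => c _.
have -> : \sum_(b | e2 b c) \sum_(a | e1 a b) u a * u b * n c =
    n c * \sum_(b | e2 b c) u b * \sum_(a | e1 a b) u a.
  rewrite mulr_sumr; apply: eq_bigr => b _; rewrite !mulr_sumr.
  by apply: eq_bigr => a _; rewrite mulrC (mulrC (u b)).
rewrite ler_piMr //; apply: le_trans (u1 (d2.2 c)).
apply: ler_sum => b _; rewrite ler_piMr //; exact/u1/d1.2.
Qed.

End Paths.

(** * Local dependence on a finite space *)

Section Dependence.
Variables (R : rcfType) (Om J : finType) (p : Om -> R) (x : J -> Om -> R).
Local Notation E := (Ex p).

(** Measurability with respect to the variables x_i, i in [D]: on a finite space it is only
    factorization through their values. *)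
Definition dep (D : {set J}) (f : Om -> R) :=
  forall w w', (forall i, i \in D -> x i w = x i w') -> f w = f w'.

Definition indep (D1 D2 : {set J}) := forall f g, dep D1 f -> dep D2 g ->
  E (fun w => f w * g w) = E f * E g.

Lemma dep_sub (D D' : {set J}) f : D \subset D' -> dep D f -> dep D' f.
Proof.
by move=> /subsetP s df w w' H; apply: df => i iD; apply: H; apply: s.
Qed.

Lemma dep_x (D : {set J}) i : i \in D -> dep D (x i).
Proof. by move=> iD w w' ->. Qed.

Lemma dep_sum (I : Type) (r : seq I) (P : pred I) (D : {set J}) (f : I -> Om -> R) :
  (forall i, P i -> dep D (f i)) -> dep D (fun w => \sum_(i <- r | P i) f i w).
Proof. by move=> df w w' H; apply: eq_bigr => j /df/(_ w w' H). Qed.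

Lemma depM (D : {set J}) f g : dep D f -> dep D g -> dep D (fun w => f w * g w).
Proof. by move=> df dg w w' H; rewrite (df w w' H) (dg w w' H). Qed.

Lemma dep_comp (h : R -> R) (D : {set J}) f :
  dep D f -> dep D (fun w => h (f w)).
Proof. by move=> df w w' H /=; rewrite (df w w' H). Qed.

End Dependence.
Arguments dep_comp {R Om J x} h {D f}.

Section Setting.
Variables (R : rcfType) (Om J : finType) (p : Om -> R) (x : J -> Om -> R).
Variables (A B : J -> {set J}) (k b bet : R).
Local Notation E := (Ex p).

Definition nbr_sum i w := \sum_(j in A i) x j w.
Definition total w := \sum_i x i w.
Definition variance_sum_local w := \sum_i x i w * nbr_sum i w.
Definition outer_sum (N : {set J}) w := \sum_(j | j \notin N) x j w.

(** The instances in use are ([A i], [B i]), which carries the weight |x_i y_i|, and the empty pair,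
    which gives unweighted statements. The last clause bounds the number of indices that cannot be
    decoupled from the weight. *)
Definition block (D N : {set J}) := [/\ D \subset N, indep p x D (~: N) &
  #|[pred j | N :&: A j != set0]|%:R <= k].

(* [b] stands for kappa^2 beta3, and [bet] for the bias left by truncation and
   rounding, which destroy E x_i = 0 and Var S = 1. *)
Record local_dependence : Prop := LocalDependence {
  prob_ge0 : forall w, 0 <= p w;
  prob_sum1 : \sum_w p w = 1;
  k_ge1 : 1 <= k;
  mem_A : forall i, i \in A i;
  LDself : forall i, indep p x [set i] (~: A i);
  LDblock : forall i, block (A i) (B i);
  card_B : forall i, #|[pred j | i \in B j]|%:R <= k;
  x_le : forall i w, `|x i w| <= k^-1;
  cubes_le : k ^+ 2 * \sum_i E (fun w => `|x i w| ^+ 3) <= b;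
  b_gt0 : 0 < b;
  means_le : \sum_i `|E (x i)| <= bet;
  EU_le : `|E variance_sum_local - 1| <= bet;
  bet_small : bet <= 16^-1 }.

End Setting.

(** * Moments of the sum, with and without a block weight *)

Section Moments.
Variables (R : rcfType) (Om J : finType) (p : Om -> R) (x : J -> Om -> R).
Variables (A B : J -> {set J}) (k b bet : R).
Hypothesis LD : local_dependence p x A B k b bet.
Local Notation E := (Ex p).
Local Notation dep := (dep x).
Local Notation block := (block p x A k).
Local Notation y := (nbr_sum x A).
Local Notation S := (total x).
Local Notation U := (variance_sum_local x A).
Local Notation So := (outer_sum x).

Let p0 := prob_ge0 LD.
Let p1 := prob_sum1 LD.
Let k1 := k_ge1 LD.
Let Aself := mem_A LD.
Let xk := x_le LD.

Let k0 : 0 < k. Proof. exact: lt_le_trans k1. Qed.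

Definition eA : rel J := fun i j => j \in A i.
Definition eB : rel J := fun i j => j \in B i.

Lemma card_block D N : block D N -> #|[pred j in N]|%:R <= k.
Proof.
case=> _ _ H; apply: le_trans H; rewrite ler_nat; apply: subset_leq_card.
apply/subsetP => j; rewrite !inE => jN; apply/set0Pn; exists j.
by rewrite inE jN Aself.
Qed.

Lemma subAB i : A i \subset B i. Proof. by case: (LDblock LD i). Qed.

Lemma eB_degree : degree_le k eB.
Proof.
split=> [a|c]; [exact: (card_block (LDblock LD a))|].
exact: (card_B LD c).
Qed.

Lemma eA_degree : degree_le k eA.
Proof.
split=> [a|c].
  apply: le_trans (eB_degree.1 a); rewrite ler_nat; apply: subset_leq_card.
  exact: subAB.
apply: le_trans (eB_degree.2 c); rewrite ler_nat; apply: subset_leq_card.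
by apply/subsetP => a; rewrite !inE; apply: (subsetP (subAB a)).
Qed.

Lemma sum_x_le1 (P : pred J) w : #|P|%:R <= k -> \sum_(j | P j) `|x j w| <= 1.
Proof.
move=> Pk; apply: le_trans (ler_sum _ (fun j _ => xk j w)) _.
by rewrite sum_card ler_pdivrMr ?mul1r.
Qed.

Lemma y_le1 i w : `|y i w| <= 1.
Proof.
by apply: le_trans (ler_norm_sum _ _ _) _; apply: sum_x_le1; exact: eA_degree.1.
Qed.

Lemma S_So (N : {set J}) w : S w = \sum_(j in N) x j w + So N w.
Proof. by rewrite /S (bigID (mem N)). Qed.

Lemma S_y i w : S w - y i w = So (A i) w.
Proof. by rewrite (S_So (A i)) addrC addKr. Qed.

Lemma So_near D N w : block D N -> `|S w - So N w| <= 1.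
Proof.
move=> bl; rewrite (S_So N) addrK; apply: le_trans (ler_norm_sum _ _ _) _.
by apply: sum_x_le1; apply: card_block bl.
Qed.

Lemma dep_So (N : {set J}) : dep (~: N) (So N).
Proof. by apply: dep_sum => j jN; apply: dep_x; rewrite inE. Qed.

Lemma indep_x i f : dep (~: A i) f -> E (fun w => x i w * f w) = E (x i) * E f.
Proof. by apply: (LDself LD); apply: dep_x; rewrite inE. Qed.

Lemma bet0 : 0 <= bet.
Proof. apply: le_trans (means_le LD); by apply: sumr_ge0. Qed.

(** In S^2 = U + sum of x_i (S - y_i), each summand of the second part factors into E x_i times a
    first moment. That moment is at most half of E S^2 plus a constant, so the second part is a
    small multiple of the quantity being bounded, plus a constant, and is absorbed. *)
Lemma second_moment : E (fun w => S w ^+ 2) <= 2.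
Proof.
have E1 : E (fun w => S w ^+ 2) = E U + \sum_i E (x i) * E (So (A i)).
  rewrite (_ : \sum_i _ = E (fun w => \sum_i x i w * So (A i) w)); last first.
    rewrite Ex_sum; apply: eq_bigr => i _; rewrite indep_x //; exact: dep_So.
  rewrite -ExD; apply: eq_Ex => w; rewrite expr2 {1}/S mulr_suml -big_split.
  by apply: eq_bigr => i _ /=; rewrite -mulrDr -S_y addrC subrK.
set s := E _ in E1 *.
have s1 i : `|E (So (A i))| <= 2^-1 * s + 3 / 2.
  apply: le_trans (ler_norm_Ex p0 _) _.
  rewrite -(ExZ p) -(Ex_cst p1 (3 / 2)) -ExD; apply: le_Ex => // w.
  rewrite -S_y; apply: le_trans (ler_normB _ _) _.
  have := y_le1 i w; have := sqr_ge0 (`|S w| - 1).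
  by rewrite -(real_normK (num_real (S w))); nra.
have s0 : 0 <= s by apply: Ex_ge0 => // w; apply: sqr_ge0.
have H : `|\sum_i E (x i) * E (So (A i))| <= bet * (2^-1 * s + 3 / 2).
  apply: le_trans (ler_norm_sum _ _ _) _.
  apply: (@le_trans _ _ (\sum_i `|E (x i)| * (2^-1 * s + 3 / 2))).
    by apply: ler_sum => i _; rewrite normrM ler_wpM2l.
  by rewrite -mulr_suml ler_wpM2r ?(means_le LD) //; lra.
have := bet0; move: H (EU_le LD); rewrite !ler_norml => /andP[_ H] /andP[_ HU] bb.
have : bet * (2^-1 * s + 3 / 2) <= 16^-1 * (2^-1 * s + 3 / 2).
  by rewrite ler_wpM2r ?(bet_small LD) //; lra.
have := bet_small LD; lra.
Qed.

Lemma first_moment : E (fun w => `|S w|) <= 2.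
Proof.
have /(le_trans _) : E (fun w => (1 + S w ^+ 2) * 2^-1) <= 3 / 2.
  by rewrite ExZr ExD Ex_cst //; have := second_moment; lra.
move=> H; apply: le_trans (H _ _) _; last lra.
apply: le_Ex => // w; have := sqr_ge0 (`|S w| - 1).
by rewrite -(real_normK (num_real (S w))); nra.
Qed.

Lemma first_moment_So D N : block D N -> E (fun w => `|So N w|) <= 3.
Proof.
move=> bl; have : E (fun w => `|S w| + 1) <= 3.
  by rewrite ExD Ex_cst //; have := first_moment; lra.
apply: le_trans; apply: le_Ex => // w; have := So_near w bl.
have := ler_normB (S w) (S w - So N w); rewrite opprB addrC subrK; lra.
Qed.

Section Block.
Variables (D N : {set J}) (w : Om -> R).
Hypotheses (bl : block D N) (dw : dep D w) (w0 : forall o, 0 <= w o).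

Lemma block_indep f : dep (~: N) f -> E (fun o => w o * f o) = E w * E f.
Proof. by move=> df; case: bl => _ + _; apply. Qed.

(** Dropping the summands in [N] changes [S] by at most 1 and makes it independent of [w]; the
    unweighted moment then applies. *)
Lemma block_first_moment : E (fun o => w o * `|S o|) <= 4 * E w.
Proof.
have : E (fun o => w o * `|So N o| + w o) <= 4 * E w.
  rewrite ExD block_indep; last by apply: (dep_comp (Num.norm)); exact: dep_So.
  have := first_moment_So bl; have := Ex_ge0 p0 w0; nra.
apply: le_trans; apply: le_Ex => // o; have := So_near o bl.
have := ler_normD (S o - So N o) (So N o); rewrite subrK.
have := w0 o; nra.
Qed.

Lemma block_second_moment : E (fun o => w o * S o ^+ 2) <= 14 * E w.
Proof.
have H : E (fun o => So N o ^+ 2) <= 6.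
  have : E (fun o => 2 * S o ^+ 2 + 2) <= 6.
    by rewrite ExD ExZ Ex_cst //; have := second_moment; lra.
  apply: le_trans; apply: le_Ex => // o; have := So_near o bl.
  rewrite ler_norml => /andP[h1 h2].
  have : (S o - So N o) ^+ 2 <= 1 by nra.
  have := sqr_ge0 (S o + (S o - So N o)); lra.
have : E (fun o => w o * So N o ^+ 2 * 2 + w o * 2) <= 14 * E w.
  rewrite ExD !ExZr block_indep; last first.
    by apply: (dep_comp (fun t => t ^+ 2)); exact: dep_So.
  have := Ex_ge0 p0 w0; nra.
apply: le_trans; apply: le_Ex => // o; have := So_near o bl.
rewrite ler_norml => /andP[h1 h2].
have : S o ^+ 2 <= So N o ^+ 2 * 2 + 2.
  have : (S o - So N o) ^+ 2 <= 1 by nra.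
  have := sqr_ge0 (So N o - (S o - So N o)); lra.
have := w0 o; nra.
Qed.

(** Without the summands in [N] and [A j] the sum is within 2 of [S]. The block separates [w] from
    this sum and x_j together; then x_j is separated from the sum, which avoids [A j]. *)
Lemma block_far_cube j : j \notin N ->
  E (fun o => w o * (`|x j o| ^+ 3 * (2 + `|S o|))) <= 8 * E w * E (fun o => `|x j o| ^+ 3).
Proof.
move=> jN; pose So2 o := \sum_(i | i \notin N :|: A j) x i o.
have near o : `|S o - So2 o| <= 2.
  rewrite /So2 (S_So (N :|: A j)) addrK; apply: le_trans (ler_norm_sum _ _ _) _.
  apply: le_trans (_ : \sum_(i in N) `|x i o| + \sum_(i in A j) `|x i o| <= _).
    rewrite !(big_mkcond (fun i => i \in _)) -big_split; apply: ler_sum => i _ /=.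
    rewrite inE; have := normr_ge0 (x i o).
    by case: (i \in N); case: (i \in A j) => /=; lra.
  have := sum_x_le1 o (card_block bl); have := sum_x_le1 o (eA_degree.1 j); lra.
have dS2 : dep (~: (N :|: A j)) So2.
  by apply: dep_sum => i iN; apply: dep_x; rewrite inE.
have d3 : dep [set j] (fun o => `|x j o| ^+ 3).
  by apply: (dep_comp (fun t => `|t| ^+ 3)); apply: dep_x; rewrite inE.
have dn : dep (~: (N :|: A j)) (fun o => `|So2 o|).
  exact: (dep_comp (Num.norm)).
have e3 : 0 <= E (fun o => `|x j o| ^+ 3).
  by apply: Ex_ge0 => // o; rewrite exprn_ge0.
have eS : E (fun o => `|So2 o|) <= 4.
  have : E (fun o => `|S o| + 2) <= 4.
    by rewrite ExD Ex_cst //; have := first_moment; lra.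
  apply: le_trans; apply: le_Ex => // o; have := near o.
  have := ler_normB (S o) (S o - So2 o); rewrite opprB addrC subrK; lra.
have ind : E (fun o => w o * (`|x j o| ^+ 3 * `|So2 o|)) =
    E w * (E (fun o => `|x j o| ^+ 3) * E (fun o => `|So2 o|)).
  rewrite block_indep; last first.
    apply: depM; first by apply: dep_sub d3; rewrite sub1set inE.
    by apply: dep_sub dn; rewrite finset.setCS finset.subsetUl.
  congr (_ * _); apply: (LDself LD (i := j)) => //.
  by apply: dep_sub dn; rewrite finset.setCS finset.subsetUr.
have ind1 : E (fun o => w o * `|x j o| ^+ 3) = E w * E (fun o => `|x j o| ^+ 3).
  by rewrite block_indep //; apply: dep_sub d3; rewrite sub1set inE.
have : E (fun o => w o * (`|x j o| ^+ 3 * `|So2 o|) + w o * `|x j o| ^+ 3 * 4) <=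
    8 * E w * E (fun o => `|x j o| ^+ 3).
  rewrite ExD ExZr ind ind1; have := Ex_ge0 p0 w0 => W0.
  have : E w * E (fun o => `|x j o| ^+ 3) * E (fun o => `|So2 o|) <=
      E w * E (fun o => `|x j o| ^+ 3) * 4.
    by rewrite ler_wpM2l // mulr_ge0.
  nra.
apply: le_trans; apply: le_Ex => // o; have := near o.
have := ler_normD (S o - So2 o) (So2 o); rewrite subrK => h1 h2.
have c0 : 0 <= w o * `|x j o| ^+ 3 by rewrite mulr_ge0 // exprn_ge0.
rewrite !mulrA -mulrDr ler_wpM2l //; lra.
Qed.

End Block.
End Moments.

(** * The approximate Stein identity for functions of the sum and its variance statistic *)

Section Expansion.
Variables (R : rcfType) (Om J : finType) (p : Om -> R) (x : J -> Om -> R).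
Variables (A B : J -> {set J}) (k b bet : R).
Hypothesis LD : local_dependence p x A B k b bet.
Local Notation E := (Ex p).
Local Notation dep := (dep x).
Local Notation block := (block p x A k).
Local Notation y := (nbr_sum x A).
Local Notation S := (total x).
Local Notation U := (variance_sum_local x A).
Local Notation eA := (eA A).

Let p0 := prob_ge0 LD.
Let p1 := prob_sum1 LD.
Let k1 := k_ge1 LD.
Let Aself := mem_A LD.
Let k0 : 0 <= k. Proof. exact: le_trans k1. Qed.

(** [U] without the products that have a factor in [A j], hence a function of the variables outside
    [A j]. *)
Definition Uo j o :=
  \sum_(l | l \notin A j) \sum_(m in A l | m \notin A j) x l o * x m o.

Lemma dep_Uo j : dep (~: A j) (Uo j).
Proof.
apply: dep_sum => l lj; apply: dep_sum => m /andP[_ mj].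
by apply: depM; apply: dep_x; rewrite inE.
Qed.

(** A deleted product x_l x_m, with m in [A l], has l or m in [A j]. Multiplied by x_j, these give
    paths j, l, m along the edges of [A], and paths j, m, l whose second edge is reversed. *)
Lemma U_Uo j o : `|U o - Uo j o| <=
  \sum_(l in A j) \sum_(m in A l) `|x l o| * `|x m o| +
  \sum_(m in A j) \sum_(l | m \in A l) `|x m o| * `|x l o|.
Proof.
pose t l m := `|x l o| * `|x m o|.
have -> : \sum_(m in A j) \sum_(l | m \in A l) `|x m o| * `|x l o| =
    \sum_l \sum_(m in A l | m \in A j) t l m.
  rewrite [RHS](exchange_big_dep (mem (A j))) /=; last by move=> l m _ /andP[].
  by apply: eq_bigr => m mj; apply: eq_big => [l|l _]; rewrite ?mj ?andbT // mulrC.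
have -> : \sum_(l in A j) \sum_(m in A l) `|x l o| * `|x m o| =
    \sum_l \sum_(m in A l) (if l \in A j then t l m else 0).
  rewrite big_mkcond; apply: eq_bigr => l _.
  by case: ifP => // _; rewrite big1.
have -> : Uo j o = \sum_l \sum_(m in A l)
    (if (l \notin A j) && (m \notin A j) then x l o * x m o else 0).
  rewrite /Uo big_mkcond; apply: eq_bigr => l _.
  case: ifP => _ /=; last by rewrite big1.
  by rewrite big_mkcondr.
rewrite -big_split /= /U -sumrB.
apply: le_trans (ler_norm_sum _ _ _) _; apply: ler_sum => l _.
rewrite big_mkcondr -big_split /= /y mulr_sumr -sumrB.
apply: le_trans (ler_norm_sum _ _ _) _; apply: ler_sum => m _.
have t0 : 0 <= t l m by rewrite mulr_ge0.
by case: (l \in A j); case: (m \in A j) => /=;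
  rewrite ?subrr ?normr0 ?subr0 ?normrM -/(t l m); lra.
Qed.

Section Block.
Variables (D N : {set J}) (w : Om -> R).
Hypotheses (bl : block D N) (dw : dep D w) (w0 : forall o, 0 <= w o).

(** For these j the whole block [D] lies outside [A j], so x_j is separated at once from the weight
    and from the rest of the sum. *)
Definition good j := N :&: A j == set0.

(** The price of the paths that return to [N], where cubes cannot be separated from the weight. The
    factor 2 + |S| comes from 1 + |S - y_j| in [FL], with |y_j| <= 1. *)
Definition near := E (fun o => w o * ((\sum_(j in N) `|x j o|) * (2 + `|S o|))).

Lemma good_notin j : good j -> j \notin N.
Proof.
move=> g; apply/negP => jN; have : j \in N :&: A j by rewrite inE jN Aself.
by rewrite (eqP g) inE.
Qed.

Lemma good_sub j : good j -> D \subset ~: A j.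
Proof.
move=> g; case: bl => DN _ _; apply/subsetP => i /(subsetP DN) iN.
rewrite inE; apply/negP => iA; have : i \in N :&: A j by rewrite inE iN.
by rewrite (eqP g) inE.
Qed.

Lemma good_triples o :
  \sum_(j | good j) `|x j o| * `|U o - Uo j o| <=
  2 * k ^+ 2 * (\sum_(j | j \notin N) `|x j o| ^+ 3) + 4 * \sum_(j in N) `|x j o|.
Proof.
have u1 (P : pred J) : #|P|%:R <= k -> \sum_(j | P j) `|x j o| <= 1.
  exact: sum_x_le1 LD _ _.
have dA : degree_le k eA := eA_degree LD.
have h1 := sum_path3_split dA dA k0 (u := fun j => `|x j o|) (fun j => normr_ge0 _) u1 N.
have h2 := sum_path3_split dA (degree_le_flip dA) k0 (u := fun j => `|x j o|)
  (fun j => normr_ge0 _) u1 N.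
have := lerD h1 h2.
set s3 := \sum_(j | j \notin N) _ ^+ 3; set s1 := \sum_(j in N) `|x j o| => h.
have -> : 2 * k ^+ 2 * s3 + 4 * s1 = k ^+ 2 * s3 + 2 * s1 + (k ^+ 2 * s3 + 2 * s1).
  by ring.
apply: le_trans h; rewrite -big_split /= big_mkcond [leRHS]big_mkcond.
apply: ler_sum => j _; case: ifP => [/good_notin -> | _]; last first.
  by case: ifP => // _; rewrite addr_ge0 // !sumr_ge0 // => l _;
    rewrite !sumr_ge0 // => m _; rewrite !mulr_ge0.
apply: le_trans (ler_wpM2l (normr_ge0 _) (U_Uo j o)) _.
rewrite mulrDr !mulr_sumr; apply: lerD; apply: ler_sum => l _;
  by rewrite mulr_sumr; apply: ler_sum => m _; rewrite mulrA.
Qed.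

Variables (F : R -> R -> Om -> R) (M : Om -> R) (L : R).
Hypothesis dF : forall s u, dep D (F s u).
Hypothesis FM : forall s u o, `|F s u o| <= M o.
Hypothesis L0 : 0 <= L.
Hypothesis FL : forall s u u' o,
  `|F s u o - F s u' o| <= L * `|u - u'| * (1 + `|s|).

Let M0 o : 0 <= M o. Proof. exact: le_trans (FM 0 0 o). Qed.

(** With [U] replaced by [Uo j], everything but x_j is a function of the variables outside [A j],
    and x_j factors out with its small mean. The Lipschitz bound in u pays for the replacement. *)
Lemma expansion_good j : good j ->
  `|E (fun o => w o * (x j o * F (S o - y j o) (U o) o))| <=
  `|E (x j)| * E (fun o => w o * M o) +
  L * E (fun o => w o * (`|x j o| * `|U o - Uo j o| * (2 + `|S o|))).
Proof.
move=> g.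
rewrite (_ : E _ = E (x j) * E (fun o => w o * F (S o - y j o) (Uo j o) o) +
  E (fun o => w o * (x j o * (F (S o - y j o) (U o) o - F (S o - y j o) (Uo j o) o)))); last first.
  rewrite -(indep_x LD); last first.
    move=> o o' H; rewrite !(S_y x A).
    have sD := good_sub g.
    rewrite (dep_So H) (dep_Uo H) (dep_sub sD dw H).
    by rewrite (dep_sub sD (dF _ _) H).
  by rewrite -ExD; apply: eq_Ex => o; ring.
apply: le_trans (ler_normD _ _) _; apply: lerD.
  rewrite normrM ler_wpM2l //; apply: le_trans (ler_norm_Ex p0 _) _.
  by apply: le_Ex => // o; rewrite normrM (ger0_norm (w0 o)) ler_wpM2l.
apply: le_trans (ler_norm_Ex p0 _) _; rewrite -ExZ; apply: le_Ex => // o.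
rewrite !normrM (ger0_norm (w0 o)) [leRHS]mulrCA ler_wpM2l //.
rewrite -(mulrA `|x j o|) [leRHS]mulrCA ler_wpM2l //; apply: le_trans (FL _ _ _ _) _.
rewrite mulrA ler_wpM2l ?mulr_ge0 //.
have := y_le1 LD j o; have := ler_normB (S o) (y j o); lra.
Qed.

Lemma sum_bad_le1 o : \sum_(j | ~~ good j) `|x j o| <= 1.
Proof. by apply: (sum_x_le1 LD); case: bl. Qed.

(** A weighted Stein identity: subtracting from x_j F(S, U) the nearly vanishing term x_j F(S - y_j,
    U) leaves differences in the first argument only. The bad indices keep the full [F], bounded by
    [M]. [F] may itself depend on the block, because the width of the test function will. *)
Lemma expansion :
  `|E (fun o => w o * (S o * F (S o) (U o) o)) -
    E (fun o => w o * \sum_(j | good j)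
         x j o * (F (S o) (U o) o - F (S o - y j o) (U o) o))| <=
  E (fun o => w o * (M o * \sum_(j | ~~ good j) `|x j o|)) +
  bet * E (fun o => w o * M o) + L * (16 * b * E w + 4 * near).
Proof.
rewrite -ExB (_ : E _ = E (fun o => w o * \sum_(j | ~~ good j) x j o * F (S o) (U o) o) +
   \sum_(j | good j) E (fun o => w o * (x j o * F (S o - y j o) (U o) o))); last first.
  rewrite -Ex_sum -ExD; apply: eq_Ex => o; rewrite -!mulr_sumr -mulrBr -mulrDr.
  congr (_ * _); rewrite {1}/S mulr_suml (bigID good) /= addrAC -sumrB addrC.
  by congr (_ + _); apply: eq_bigr => j _; ring.
apply: le_trans (ler_normD _ _) _; rewrite -addrA; apply: lerD.
  apply: le_trans (ler_norm_Ex p0 _) _; apply: le_Ex => // o.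
  rewrite normrM (ger0_norm (w0 o)) ler_wpM2l // -mulr_suml normrM.
  by rewrite mulrC; apply: ler_pM => //; apply: ler_norm_sum.
apply: le_trans (ler_norm_sum _ _ _) _.
apply: le_trans (ler_sum _ expansion_good) _; rewrite big_split /= -mulr_suml.
apply: lerD.
  rewrite ler_wpM2r //; first by apply: Ex_ge0 => // o; rewrite mulr_ge0.
  apply: le_trans (means_le LD); rewrite big_mkcond; apply: ler_sum => j _.
  by case: ifP.
rewrite -mulr_sumr ler_wpM2l // -Ex_sum.
have far : \sum_(j | j \notin N) E (fun o => w o * (`|x j o| ^+ 3 * (2 + `|S o|))) <=
    8 * E w * \sum_j E (fun o => `|x j o| ^+ 3).
  rewrite big_mkcond mulr_sumr; apply: ler_sum => j _; case: ifP => [jN|_].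
    exact: (block_far_cube LD bl).
  by rewrite !mulr_ge0 ?Ex_ge0 // => o; rewrite exprn_ge0.
have W0 : 0 <= E w by exact: Ex_ge0.
have far2 : 2 * k ^+ 2 * (8 * E w * \sum_j E (fun o => `|x j o| ^+ 3)) <= 16 * b * E w.
  have := cubes_le LD => /(ler_wpM2r W0); lra.
apply: le_trans (lerD far2 (lexx _)).
have k20 : 0 <= 2 * k ^+ 2 by rewrite mulr_ge0 // sqr_ge0.
apply: le_trans (lerD (ler_wpM2l k20 far) (lexx _)).
rewrite /near -Ex_sum -!ExZ -ExD; apply: le_Ex => // o.
have s0 : 0 <= 2 + `|S o| by rewrite addr_ge0.
rewrite -mulr_sumr -mulr_suml -!mulr_sumr -mulr_suml.
have /(ler_wpM2l (w0 o)) := ler_wpM2r s0 (good_triples o); lra.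
Qed.

End Block.
End Expansion.

(** * Test functions *)

Section ClippedRoot.
Variable R : rcfType.
Implicit Types u v : R.

Definition clip u : R := if u <= 2^-1 then 2^-1 else if u <= 2 then u else 2.
Definition rsq u : R := (Num.sqrt (clip u))^-1.

Lemma clip_bounds u : 2^-1 <= clip u /\ clip u <= 2.
Proof. by rewrite /clip; case: (lerP u 2^-1) => h1; [|case: (lerP u 2) => h2]; split; lra. Qed.

Lemma clip_lipschitz u v : `|clip u - clip v| <= `|u - v|.
Proof.
have := ler_norm (u - v); have := ler_norm (v - u); rewrite distrC => h1 h2.
rewrite ler_norml /clip.
by case: (lerP u 2^-1) => ?; [|case: (lerP u 2) => ?];
  (case: (lerP v 2^-1) => ?; [|case: (lerP v 2) => ?]); apply/andP; split; lra.
Qed.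

Lemma sqrt_clip u : [/\ 2 / 3 <= Num.sqrt (clip u), Num.sqrt (clip u) <= 3 / 2 &
  Num.sqrt (clip u) ^+ 2 = clip u].
Proof.
have [h1 h2] := clip_bounds u; split.
- rewrite -(@ler_pXn2r _ 2) ?nnegrE ?sqrtr_ge0 //; last lra.
  rewrite sqr_sqrtr; lra.
- rewrite -(@ler_pXn2r _ 2) ?nnegrE ?sqrtr_ge0 //; last lra.
  rewrite sqr_sqrtr; lra.
by rewrite sqr_sqrtr; lra.
Qed.

Lemma rsq_ge0 u : 0 <= rsq u.
Proof. by rewrite invr_ge0 sqrtr_ge0. Qed.

Lemma rsq_le u : rsq u <= 3 / 2.
Proof.
have [h1 _ _] := sqrt_clip u.
have : (Num.sqrt (clip u))^-1 <= (2 / 3)^-1 by rewrite lef_pV2 ?posrE //; lra.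
by rewrite invf_div.
Qed.

Lemma rsq_sqr u : rsq u ^+ 2 = (clip u)^-1.
Proof. by have [_ _ h] := sqrt_clip u; rewrite exprVn h. Qed.

Lemma rsq_sqr_ge u : 2^-1 <= rsq u ^+ 2.
Proof.
have [h1 h2] := clip_bounds u.
by rewrite rsq_sqr lef_pV2 ?posrE //; lra.
Qed.

Lemma rsq_lipschitz u v : `|rsq u - rsq v| <= 3 / 2 * `|u - v|.
Proof.
apply: le_trans (_ : 3 / 2 * `|clip u - clip v| <= _); last first.
  by rewrite ler_wpM2l ?clip_lipschitz //; lra.
rewrite /rsq; have [a1 a2 e1] := sqrt_clip u; have [c1 c2 e2] := sqrt_clip v.
have [m1 _] := clip_bounds u; have [m2 _] := clip_bounds v.
move: (Num.sqrt (clip u)) (Num.sqrt (clip v)) a1 a2 c1 c2 e1 e2 => s t a1 a2 c1 c2.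
move: (clip u) (clip v) m1 m2 => cu cv m1 m2 es et; rewrite -es -et.
have s0 : 0 < s by lra.
have t0 : 0 < t by lra.
have -> : s^-1 - t^-1 = (s ^+ 2 - t ^+ 2) * (- (s * t * (s + t))^-1).
  by field; rewrite !gt_eqF //; lra.
rewrite normrM mulrC ler_wpM2r // normrN normfV ger0_norm; last first.
  by rewrite !mulr_ge0 //; lra.
have st : 2^-1 <= s * t.
  rewrite -(@ler_pXn2r _ 2) ?nnegrE //; [|lra|by rewrite mulr_ge0; lra].
  rewrite exprMn es et; nra.
have -> : (3 / 2 : R) = (2 / 3)^-1 by rewrite invf_div.
rewrite lef_pV2 ?posrE ?mulr_gt0 //; [nra | lra | lra].
Qed.

(** The defect vanishes where clipping is inactive, and elsewhere |u - 1| >= 1/2 turns a linear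
    bound into a quadratic one. Being of second order, it costs E (U - 1)^2, of order [b] + [bet],
    and not its square root. *)
Lemma rsq_defect u : `|1 - u * rsq u ^+ 2| <= 4 * (u - 1) ^+ 2.
Proof.
rewrite rsq_sqr /clip; case: (lerP u 2^-1) => h1; [|case: (lerP u 2) => h2].
- by rewrite invrK ger0_norm; nra.
- rewrite divff ?subrr ?normr0; last by rewrite gt_eqF //; lra.
  by rewrite mulr_ge0 ?sqr_ge0.
- by rewrite ler0_norm; nra.
Qed.

End ClippedRoot.

(** * The bounded increasing test function and its derivative *)

Section TestFunction.
Variable R : realFieldType.
Implicit Types x z e a : R.

Let v x : R := (1 + `|x|)^-1.

Let v_gt0 x : 0 < v x. Proof. by rewrite invr_gt0; have := normr_ge0 x; lra. Qed.

Let vE x : v x * (1 + `|x|) = 1.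
Proof. by rewrite mulVf // gt_eqF //; have := normr_ge0 x; lra. Qed.

Let v_ge0 x : 0 <= v x. Proof. exact: ltW. Qed.

Let v_le1 x : v x <= 1.
Proof. have := vE x; have := v_gt0 x; have := normr_ge0 x; nra. Qed.

Let v_diff x z : v x - v z = v x * v z * (`|z| - `|x|).
Proof.
have -> : v x - v z = v x * (v z * (1 + `|z|)) - v z * (v x * (1 + `|x|)).
  by rewrite !vE !mulr1.
by ring.
Qed.

Let v_step x e : 0 <= e -> `|v (x - e) - v x| <= e * (v x * v (x - e)).
Proof.
move=> e0; rewrite v_diff normrM ger0_norm ?mulr_ge0 ?v_ge0 //.
rewrite (mulrC (v x)) [leLHS]mulrC ler_wpM2r ?mulr_ge0 ?v_ge0 //.
apply: le_trans (ler_dist_dist _ _) _; rewrite opprB addrC subrK ger0_norm //.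
Qed.

Let v_diff_prod x z : x * v x - z * v z =
  v x * v z * ((x - z) + (x * `|z| - z * `|x|)).
Proof.
have -> : x * v x - z * v z =
    x * v x * (v z * (1 + `|z|)) - z * v z * (v x * (1 + `|x|)).
  by rewrite !vE !mulr1.
by ring.
Qed.

(** For equal signs the left side is 0; for opposite signs it is 2|xz|, while (x - z)^2 >= 4|xz|.
    Thus the kink of |x| at 0 enters the test function only at second order. *)
Let cross x z : `|x * `|z| - z * `|x| | <= 2^-1 * (x - z) ^+ 2.
Proof.
have s1 := sqr_ge0 (x - z); have s2 := sqr_ge0 (x + z).
by case: (ger0P x) => hx; case: (ger0P z) => hz; rewrite ler_norml;
  apply/andP; split; nra.
Qed.

Let phi1 x := v x ^+ 2.

Let phi1_step x e : 0 <= e -> e <= 1 -> `|phi1 (x - e) - phi1 x| <= 3 * e * phi1 x.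
Proof.
move=> e0 e1; have := v_step x e0; have := v_gt0 x; have := v_gt0 (x - e).
have := v_le1 (x - e).
rewrite /phi1 subr_sqr normrM (ger0_norm (_ : 0 <= v (x - e) + v x)); last first.
  by rewrite addr_ge0 // ltW.
move: (v (x - e)) (v x) => s t s1 s0 t0 H.
(* Since e <= 1 and s <= 1, the increment of [v] is at most t. *)
have H2 : s <= 2 * t.
  have ts0 : 0 <= t * s by rewrite mulr_ge0 // ltW.
  have h1 : e * (t * s) <= 1 * (t * s) by rewrite ler_wpM2r.
  have h2 : t * s <= t * 1 by rewrite ler_wpM2l // ltW.
  move: H; rewrite ler_norml => /andP[_ H]; lra.
have st0 : 0 <= s + t by lra.
have st3 : s + t <= 3 * t by lra.
have := ler_pM (normr_ge0 (s - t)) st0 H st3.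
have : 0 <= 3 * e * t ^+ 2 * (1 - s) by rewrite !mulr_ge0 ?sqr_ge0 //; lra.
nra.
Qed.

Let tf1_taylor x e : 0 <= e -> e <= 1 ->
  `|x * v x - (x - e) * v (x - e) - e * phi1 x| <= 2 * e ^+ 2 * phi1 x.
Proof.
move=> e0 e1; rewrite v_diff_prod /phi1.
have := cross x (x - e); have -> : x - (x - e) = e by ring.
move: (x * _ - _) => c hc.
have := v_step x e0; have := v_gt0 x; have := v_gt0 (x - e); have := v_le1 (x - e).
move: (v (x - e)) (v x) => s t s1 s0 t0 H.
have -> : t * s * (e + c) - e * t ^+ 2 = t * (e * (s - t) + s * c) by ring.
have H2 : s <= 2 * t.
  have ts0 : 0 <= t * s by rewrite mulr_ge0 // ltW.
  have h1 : e * (t * s) <= 1 * (t * s) by rewrite ler_wpM2r.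
  have h2 : t * s <= t * 1 by rewrite ler_wpM2l // ltW.
  move: H; rewrite ler_norml => /andP[_ H]; lra.
rewrite normrM (gtr0_norm t0) -mulrA.
apply: le_trans (_ : t * (e * (e * (t * s)) + s * (2^-1 * e ^+ 2)) <= _).
  rewrite ler_wpM2l ?(ltW t0) //; apply: le_trans (ler_normD _ _) _.
  by rewrite !normrM (ger0_norm e0) (gtr0_norm s0) lerD // ler_wpM2l // ltW.
have e20 := sqr_ge0 e.
have -> : t * (e * (e * (t * s)) + s * (2^-1 * e ^+ 2)) = e ^+ 2 * (t * (t * s + s / 2)) by ring.
rewrite [leRHS](_ : _ = e ^+ 2 * (2 * t ^+ 2)); last by ring.
have h1 : t * s <= t * (2 * t) by rewrite ler_wpM2l // ltW.
have h2 : t * t * s <= t * t * 1 by rewrite ler_wpM2l // mulr_ge0 // ltW.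
rewrite ler_wpM2l //; lra.
Qed.

Variable a : R.
Hypothesis a0 : 0 < a.

(* [tf' = phi], and [phi] is integrable of size [a] while [|phi'| <= 2 phi / a]:
   this last property is what makes the concentration estimate self-improving. *)
Definition tf x : R := x / (1 + `|x / a|).
Definition phi x : R := (1 + `|x / a|)^-1 ^+ 2.

Let tfE x : tf x = a * (x / a * v (x / a)).
Proof. by rewrite mulrA (mulrC a) divfK ?gt_eqF. Qed.

Lemma phi_ge0 x : 0 <= phi x. Proof. exact: sqr_ge0. Qed.

Lemma phi_le1 x : phi x <= 1.
Proof. by rewrite expr_le1 // ?(v_le1 (x / a)) // ltW // (v_gt0 (x / a)). Qed.

Lemma phi_ge x : `|x| <= a -> 4^-1 <= phi x.
Proof.
move=> xa; have h : `|x / a| <= 1.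
  by rewrite normrM normfV (gtr0_norm a0) ler_pdivrMr ?mul1r.
have h2 : 2^-1 <= (1 + `|x / a|)^-1.
  by rewrite lef_pV2 ?posrE //; have := normr_ge0 (x / a); lra.
rewrite /phi; nra.
Qed.

Lemma tf_le x : `|tf x| <= a.
Proof.
rewrite tfE normrM (gtr0_norm a0) -[leRHS]mulr1 ler_wpM2l ?(ltW a0) //.
rewrite normrM (gtr0_norm (v_gt0 _)) mulrC.
have := vE (x / a); have := v_gt0 (x / a); lra.
Qed.

Let subE x z : (x - z) / a = x / a - z / a. Proof. by rewrite mulrBl. Qed.

Lemma tf_taylor x e : 0 <= e -> e <= a ->
  `|tf x - tf (x - e) - e * phi x| <= 2 * e * (e / a) * phi x.
Proof.
move=> e0 ea; have E0 : 0 <= e / a by rewrite divr_ge0 // ltW.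
have E1 : e / a <= 1 by rewrite ler_pdivrMr ?mul1r.
have := tf1_taylor (x / a) E0 E1; rewrite -subE => /(ler_wpM2l (ltW a0)).
rewrite -{1}(gtr0_norm a0) -normrM !mulrBr -!tfE.
have -> : a * (e / a * phi1 (x / a)) = e * phi x.
  by rewrite mulrA (mulrC a) divfK ?gt_eqF.
have -> : a * (2 * (e / a) ^+ 2 * phi1 (x / a)) = 2 * e * (e / a) * phi x.
  have ee : e = a * (e / a) by rewrite mulrC divfK // gt_eqF.
  by rewrite {3}ee expr2 /phi1 /phi /v; ring.
by [].
Qed.

Lemma phi_step x e : 0 <= e -> e <= a ->
  `|phi (x - e) - phi x| <= 3 * (e / a) * phi x.
Proof.
move=> e0 ea; have E0 : 0 <= e / a by rewrite divr_ge0 // ltW.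
have E1 : e / a <= 1 by rewrite ler_pdivrMr ?mul1r.
by have := phi1_step (x / a) E0 E1; rewrite -subE.
Qed.

Lemma tf_incr x z : z <= x -> 0 <= tf x - tf z /\ tf x - tf z <= x - z.
Proof.
move=> zx; rewrite !tfE -mulrBr v_diff_prod.
have zx' : z / a <= x / a by rewrite ler_pM2r ?invr_gt0.
have -> : x - z = a * (x / a - z / a) by rewrite -subE mulrC divfK // gt_eqF.
move: (x / a) (z / a) zx' => X Z ZX.
have vX := vE X; have vZ := vE Z; have vX0 := v_gt0 X; have vZ0 := v_gt0 Z.
have H : 0 <= X - Z + (X * `|Z| - Z * `|X|) /\
     X - Z + (X * `|Z| - Z * `|X|) <= (X - Z) * ((1 + `|X|) * (1 + `|Z|)).
  have d0 : 0 <= X - Z by rewrite subr_ge0.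
  have d1 := mulr_ge0 d0 (normr_ge0 X); have d2 := mulr_ge0 d0 (normr_ge0 Z).
  have d3 := mulr_ge0 d1 (normr_ge0 Z); move: d1 d2 d3.
  by case: (ger0P X) => hX; case: (ger0P Z) => hZ; split; nra.
case: H => H1 H2; split; first by rewrite !mulr_ge0 // ltW.
rewrite ler_wpM2l ?(ltW a0) //.
have /(le_trans _) : v X * v Z * ((X - Z) * ((1 + `|X|) * (1 + `|Z|))) <= X - Z.
  rewrite (_ : _ * _ = (v X * (1 + `|X|)) * (v Z * (1 + `|Z|)) * (X - Z)); last by ring.
  by rewrite vX vZ !mul1r.
by apply; rewrite ler_wpM2l // mulr_ge0 // ltW.
Qed.

Lemma tf_lipschitz x z : `|tf x - tf z| <= `|x - z|.
Proof.
case: (lerP z x) => h.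
  by have [h1 h2] := tf_incr h; rewrite !ger0_norm // subr_ge0.
have [h1 h2] := tf_incr (ltW h); rewrite (distrC (tf x)).
by rewrite !ger0_norm // subr_ge0 ltW.
Qed.

End TestFunction.

(** * Variance bounds for sums of local statistics *)

Section LocalSums.
Variables (R : rcfType) (Om J : finType) (p : Om -> R) (x : J -> Om -> R).
Variables (A B : J -> {set J}) (k b bet : R).
Hypothesis LD : local_dependence p x A B k b bet.
Local Notation E := (Ex p).
Local Notation dep := (dep x).
Local Notation block := (block p x A k).
Local Notation y := (nbr_sum x A).
Local Notation U := (variance_sum_local x A).
Local Notation eA := (eA A).

Let p0 := prob_ge0 LD.
Let p1 := prob_sum1 LD.
Let k1 := k_ge1 LD.
Let Aself := mem_A LD.
Let k0 : 0 <= k. Proof. exact: le_trans k1. Qed.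

Lemma dep_y i : dep (A i) (y i).
Proof. by apply: dep_sum => j jA; apply: dep_x. Qed.

Lemma dep_xi i : dep (A i) (x i).
Proof. exact: dep_x. Qed.

(** Two local statistics are uncorrelated as soon as one of the two intersections is empty, so both
    can be required of a pair that may be correlated. The relation is then symmetric, and the last
    clause of [block] bounds its degree in both directions. *)
Definition linked : rel J :=
  fun j l => (B j :&: A l != set0) && (B l :&: A j != set0).

Lemma linked_degree : degree_le k linked.
Proof.
split=> a; case: (LDblock LD a) => _ _; apply: le_trans; rewrite ler_nat;
  by apply: subset_leq_card; apply/subsetP => j; rewrite !inE => /andP[].
Qed.

(** Only linked pairs contribute, and twice a covariance is at most the sum of the two second
    moments; each index has at most [k] links. *)
Lemma variance_local (Z : J -> Om -> R) : (forall j, dep (A j) (Z j)) ->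
  E (fun o => (\sum_j Z j o - \sum_j E (Z j)) ^+ 2) <=
  k * \sum_j E (fun o => Z j o ^+ 2).
Proof.
move=> dZ; pose c j o := Z j o - E (Z j).
have dc j : dep (A j) (c j) by move=> o o' H; rewrite /c (dZ j o o' H).
have c0 j : E (c j) = 0 by rewrite ExB Ex_cst ?subrr.
have c2 j : E (fun o => c j o ^+ 2) <= E (fun o => Z j o ^+ 2).
  have -> : E (fun o => c j o ^+ 2) = E (fun o => Z j o ^+ 2) - E (Z j) ^+ 2.
    have -> : E (fun o => c j o ^+ 2) =
      E (fun o => Z j o ^+ 2 - (2 * E (Z j)) * Z j o + E (Z j) ^+ 2).
      by apply: eq_Ex => o; rewrite /c; ring.
    by rewrite ExD ExB ExZ Ex_cst //; ring.
  by rewrite lerBlDr lerDl sqr_ge0.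
have -> : E (fun o => (\sum_j Z j o - \sum_j E (Z j)) ^+ 2) =
    \sum_j \sum_l E (fun o => c j o * c l o).
  under [RHS]eq_bigr => j _ do rewrite -Ex_sum.
  rewrite -[RHS]Ex_sum; apply: eq_Ex => o.
  rewrite -sumrB expr2 mulr_suml; apply: eq_bigr => j _.
  by rewrite mulr_sumr.
pose v j := E (fun o => Z j o ^+ 2).
have v0 j : 0 <= v j by apply: Ex_ge0 => // o; apply: sqr_ge0.
apply: (@le_trans _ _ (\sum_j \sum_(l | linked j l) (2^-1 * v j + 2^-1 * v l))).
  apply: ler_sum => j _; rewrite [leRHS]big_mkcond; apply: ler_sum => l _.
  rewrite /linked; case: eqP => [B0|_] /=.
    have [_ ind _] := LDblock LD j.
    have dl : dep (~: B j) (c l).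
      apply: dep_sub (dc l); apply/subsetP => i iA; rewrite inE; apply/negP => iB.
      by have : i \in B j :&: A l; [rewrite inE iB | rewrite B0 inE].
    by rewrite (ind _ _ (dc j) dl) c0 mul0r.
  case: eqP => [B0|_] /=.
    have [_ ind _] := LDblock LD l.
    have dj : dep (~: B l) (c j).
      apply: dep_sub (dc j); apply/subsetP => i iA; rewrite inE; apply/negP => iB.
      by have : i \in B l :&: A j; [rewrite inE iB | rewrite B0 inE].
    by rewrite (eq_Ex _ (fun o => mulrC (c j o) _)) (ind _ _ (dc l) dj) c0 mul0r.
  apply: (@le_trans _ _ (E (fun o => 2^-1 * c j o ^+ 2 + 2^-1 * c l o ^+ 2))).
    apply: le_Ex => // o; have := sqr_ge0 (c j o - c l o); lra.
  rewrite ExD !ExZ; apply: lerD; rewrite ler_wpM2l ?c2 // invr_ge0 //.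
rewrite (eq_bigr _ (fun j _ => big_split _ _ _ _ _)) big_split /=.
have h0 j : 0 <= 2^-1 * v j by rewrite mulr_ge0 // invr_ge0.
have := lerD (sum_path_l linked_degree h0) (sum_path_r linked_degree h0).
rewrite -!mulr_sumr; lra.
Qed.

Let cube_sum o := \sum_j `|x j o| ^+ 3.

Lemma E_cubes : k ^+ 2 * E cube_sum <= b.
Proof. by rewrite /cube_sum Ex_sum; exact: cubes_le LD. Qed.

Lemma y_abs j o : `|y j o| <= \sum_(m in A j) `|x m o|.
Proof. exact: ler_norm_sum. Qed.

(** Expanding y_j^2 gives paths m, j, l with centre j, hence the reversed first edge. *)
Lemma xy2_cubes o : \sum_j `|x j o| * y j o ^+ 2 <= k ^+ 2 * cube_sum o.
Proof.
have dA := eA_degree LD.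
have := sum_path3 (degree_le_flip dA) dA k0 (u := fun j => `|x j o|)
  (fun j => normr_ge0 _).
apply: le_trans; rewrite exchange_rel; apply: ler_sum => j _.
rewrite (_ : \sum_(a | _) _ = `|x j o| * (\sum_(m in A j) `|x m o|) ^+ 2).
  rewrite ler_wpM2l // -(real_normK (num_real (y j o))).
  by rewrite ler_pXn2r ?nnegrE ?sumr_ge0 // y_abs.
rewrite expr2 mulr_suml mulr_sumr; apply: eq_bigr => m _.
by rewrite !mulr_sumr; apply: eq_bigr => l _; rewrite mulrCA mulrA.
Qed.

Lemma E_xy2 : \sum_j E (fun o => `|x j o| * y j o ^+ 2) <= b.
Proof.
rewrite -Ex_sum; apply: le_trans E_cubes; rewrite -ExZ; apply: le_Ex => // o.
exact: xy2_cubes.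
Qed.

(** Only one edge is summed here, so s^2 t <= (2 s^3 + t^3) / 3 uses one factor [k]; the other one
    is left for the factor of [variance_local] in the variance of the kernel. *)
Lemma x2y_cubes o : k * \sum_j x j o ^+ 2 * `|y j o| <= k ^+ 2 * cube_sum o.
Proof.
rewrite expr2 -mulrA ler_wpM2l //.
have dA := eA_degree LD.
pose u j := 3^-1 * `|x j o| ^+ 3.
have u0 j : 0 <= u j by rewrite mulr_ge0 ?invr_ge0 // exprn_ge0.
apply: (@le_trans _ _ (\sum_j \sum_(m | eA j m) (2 * u j + u m))).
  apply: ler_sum => j _; rewrite -(real_normK (num_real (x j o))).
  apply: le_trans (ler_wpM2l (sqr_ge0 _) (y_abs j o)) _.
  rewrite mulr_sumr; apply: ler_sum => m _; rewrite /u.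
  have h1 := normr_ge0 (x j o); have h2 := normr_ge0 (x m o).
  move: (`|x j o|) (`|x m o|) h1 h2 => s t s0 t0.
  have : 0 <= (2 * s + t) * (s - t) ^+ 2 by rewrite mulr_ge0 ?sqr_ge0 //; lra.
  lra.
rewrite (eq_bigr _ (fun j _ => big_split _ _ _ _ _)) big_split /=.
have h0 j : 0 <= 2 * u j by rewrite mulr_ge0.
have := lerD (sum_path_l dA h0) (sum_path_r dA u0).
rewrite /u -!mulr_sumr /cube_sum; lra.
Qed.

Lemma E_x2y : k * \sum_j E (fun o => x j o ^+ 2 * `|y j o|) <= b.
Proof.
rewrite -Ex_sum -ExZ; apply: le_trans E_cubes; rewrite -ExZ; apply: le_Ex => // o.
exact: x2y_cubes.
Qed.

(** For the local statistics x_j y_j, the factor [k] of [variance_local] is cancelled by one |x_j|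
    <= 1/k, leaving |x_j| y_j^2. *)
Lemma variance_U : E (fun o => (U o - E U) ^+ 2) <= b.
Proof.
have dxy j : dep (A j) (fun o => x j o * y j o).
  by apply: depM; [exact: dep_xi | exact: dep_y].
have := variance_local dxy; rewrite -Ex_sum => /le_trans; apply.
apply: le_trans E_xy2; rewrite mulr_sumr; apply: ler_sum => j _.
rewrite -ExZ; apply: le_Ex => // o; rewrite exprMn mulrA ler_wpM2r ?sqr_ge0 //.
rewrite -(real_normK (num_real (x j o))) expr2 mulrA ler_piMl //.
rewrite mulrC -ler_pdivlMr ?div1r; last exact: lt_le_trans k1.
exact: (x_le LD).
Qed.

Lemma U_concentration : E (fun o => (U o - 1) ^+ 2) <= 2 * b + 2 * bet.
Proof.
apply: (@le_trans _ _ (E (fun o => 2 * (U o - E U) ^+ 2 + 2 * (E U - 1) ^+ 2))).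
  apply: le_Ex => // o; have := sqr_ge0 (U o - E U - (E U - 1)); lra.
rewrite ExD ExZ Ex_cst //; apply: lerD; rewrite ler_wpM2l //; first exact: variance_U.
have := EU_le LD; have := bet_small LD; have := bet0 LD.
by rewrite -(real_normK (num_real (E U - 1))); have := normr_ge0 (E U - 1); nra.
Qed.

Section Good.
Variables D N : {set J}.
Hypothesis bl : block D N.
Local Notation good := (good A N).

(** There are at most [k] bad j with at most [k] neighbours each. If all |x| were at most 1/(4k),
    these k^2 products would sum to at most 1/16; a larger |x| satisfies 1 <= 4 k |x|, so that its
    square is paid by a cube. *)
Lemma bad_mass o : \sum_(j | ~~ good j) `|x j o * y j o| <= 16^-1 + 4 * k ^+ 2 * cube_sum o.
Proof.
have kgt0 : 0 < k by exact: lt_le_trans k1.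
have [dA1 dA2] := eA_degree LD.
pose u j := 4 * k * `|x j o| ^+ 3.
have u0 j : 0 <= u j by rewrite !mulr_ge0 // exprn_ge0.
have sq j : x j o ^+ 2 <= (16 * k ^+ 2)^-1 + u j.
  rewrite /u -(real_normK (num_real (x j o))).
  have := normr_ge0 (x j o); move: `|x j o| => t t0.
  have [h|h] := lerP t (4^-1 / k).
    apply: ler_wpDr; first by rewrite !mulr_ge0 ?exprn_ge0.
    have -> : (16 * k ^+ 2)^-1 = (4^-1 / k) ^+ 2 by field; rewrite gt_eqF.
    by rewrite ler_pXn2r ?nnegrE // divr_ge0 ?invr_ge0.
  apply: ler_wpDl; first by rewrite invr_ge0 mulr_ge0 ?sqr_ge0.
  rewrite exprS mulrA ler_peMl ?sqr_ge0 //.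
  move: h; rewrite ltr_pdivrMr //; lra.
apply: (@le_trans _ _ (\sum_(j | ~~ good j) \sum_(l | eA j l)
    ((16 * k ^+ 2)^-1 + (2^-1 * u j + 2^-1 * u l)))).
  apply: ler_sum => j _; rewrite normrM.
  apply: le_trans (ler_wpM2l (normr_ge0 _) (y_abs j o)) _.
  rewrite mulr_sumr; apply: ler_sum => l _.
  have := sq j; have := sq l; have := sqr_ge0 (`|x j o| - `|x l o|).
  rewrite -(real_normK (num_real (x j o))) -(real_normK (num_real (x l o))); lra.
rewrite (eq_bigr _ (fun j _ => big_split _ _ _ _ _)) big_split /=; apply: lerD.
  have c0 : 0 <= (16 * k ^+ 2)^-1 by rewrite invr_ge0 mulr_ge0 ?sqr_ge0.
  apply: (@le_trans _ _ (\sum_(j | ~~ good j) k * (16 * k ^+ 2)^-1)).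
    by apply: ler_sum => j _; rewrite sum_card; apply: (ler_wpM2r c0 (dA1 j)).
  rewrite sum_card.
  have kc0 : 0 <= k * (16 * k ^+ 2)^-1 by rewrite mulr_ge0.
  case: bl => _ _ /(ler_wpM2r kc0) => /le_trans; apply.
  by rewrite le_eqVlt; apply/orP; left; apply/eqP; field; rewrite gt_eqF.
have h0 j : 0 <= 2^-1 * u j by rewrite mulr_ge0 // invr_ge0.
have := lerD (sum_path_l (eA_degree LD) h0) (sum_path_r (eA_degree LD) h0).
move=> h; apply: (@le_trans _ _
    (\sum_j \sum_(l | eA j l) (2^-1 * u j + 2^-1 * u l))); last first.
  rewrite (eq_bigr _ (fun j _ => big_split _ _ _ _ _)) big_split /=.
  by apply: le_trans h _; rewrite /u -!mulr_sumr /cube_sum; lra.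
rewrite big_mkcond; apply: ler_sum => j _; case: ifP => // _.
by apply: sumr_ge0 => l _; rewrite addr_ge0.
Qed.

(** Keeps the leading coefficient of the concentration estimate away from 0: E U is close to 1, and
    the bad indices carry at most 1/16 + 4 b of it. *)
Lemma good_mass : b <= 64^-1 -> 2^-1 <= \sum_(j | good j) E (fun o => x j o * y j o).
Proof.
move=> bs.
have EUs : E U = \sum_(j | good j) E (fun o => x j o * y j o) +
    E (fun o => \sum_(j | ~~ good j) x j o * y j o).
  by rewrite -Ex_sum -ExD; apply: eq_Ex => o; rewrite /U (bigID good).
have : `|E (fun o => \sum_(j | ~~ good j) x j o * y j o)| <= 16^-1 + 4 * b.
  apply: le_trans (ler_norm_Ex p0 _) _.
  apply: (@le_trans _ _ (E (fun o => 16^-1 + 4 * (k ^+ 2 * cube_sum o)))).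
    apply: le_Ex => // o; apply: le_trans (ler_norm_sum _ _ _) _.
    by rewrite (mulrA 4); exact: bad_mass.
  by rewrite ExD Ex_cst // 2!ExZ; have := E_cubes; lra.
have := bet_small LD; move: (EU_le LD); rewrite !ler_norml => /andP[h1 h2] h3 /andP[h4 h5].
lra.
Qed.

End Good.
End LocalSums.

(** * Concentration of the self-normalized sum *)

Section Kernel.
Variables (R : realFieldType) (h : R) (n : nat).
Hypothesis h0 : 0 < h.

(** The offset puts 0 at index [n], so that the indices up to n + n cover [-1, 1] when h n = 1. *)
Definition tau (r : nat) : R := h * (r%:R - n%:R).

(* Discrete version of the kernel [1(0 <= s < t) - 1(t <= s < 0)]. *)
Definition kap (t : R) (r : nat) : R := (tau r < t)%R%:R - (tau r < 0)%R%:R.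

Lemma tauS r : tau r.+1 = tau r + h.
Proof. by rewrite /tau -natr1; ring. Qed.

Lemma lt_tau r m : (tau r < tau m) = (r < m)%N.
Proof. by rewrite /tau ltr_pM2l // ltrD2r ltr_nat. Qed.

Lemma tau_n : tau n = 0.
Proof. by rewrite /tau subrr mulr0. Qed.

Lemma kap_tau m r : kap (tau m) r = (r < m)%N%:R - (r < n)%N%:R.
Proof. by rewrite /kap -tau_n !lt_tau. Qed.

Let telescope_part (G : R -> R) m : (m <= n + n)%N ->
  \sum_(r < n + n) (G (tau r) - G (tau r + h)) * (r < m)%N%:R =
  G (tau 0) - G (tau m).
Proof.
move=> mn; rewrite (eq_bigr (fun r : 'I__ =>
  if (r < m)%N then G (tau r) - G (tau r.+1) else 0)); last first.
  by move=> r _; rewrite tauS; case: ifP => _; rewrite ?mulr1 ?mulr0.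
rewrite -big_mkcond (big_ord_narrow mn) /=.
have := telescope_sumr (fun r => G (tau r)) (leq0n m); rewrite big_mkord => H.
by rewrite -opprB -H -sumrN; apply: eq_bigr => r _; rewrite opprB.
Qed.

(** The fundamental theorem of calculus on the grid: the kernel selects, with sign, the cells
    between 0 and [tau m]. *)
Lemma kap_telescope (G : R -> R) m : (m <= n + n)%N ->
  \sum_(r < n + n) (G (tau r) - G (tau r + h)) * kap (tau m) r = G 0 - G (tau m).
Proof.
move=> mn; under eq_bigr => r _ do rewrite kap_tau mulrBr.
by rewrite sumrB !telescope_part ?leq_addr // tau_n; ring.
Qed.

Lemma kap_sum m : (m <= n + n)%N ->
  \sum_(r < n + n) h * kap (tau m) r = tau m.
Proof.
move=> mn; have := kap_telescope (fun t => - t) mn; rewrite oppr0 opprK add0r => H.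
by apply: etrans H; apply: eq_bigr => r _; congr (_ * _); ring.
Qed.

Lemma kap_norm m r : `|kap (tau m) r| = kap (tau m) r ^+ 2.
Proof.
rewrite kap_tau; case: (r < m)%N; case: (r < n)%N;
  by rewrite ?subrr ?subr0 ?sub0r ?normrN ?sqrrN ?normr0 ?normr1 ?expr0n ?expr1n.
Qed.

Lemma kap_sign m r : `|kap (tau m) r| <= Num.sg (tau m) * kap (tau m) r.
Proof.
rewrite kap_tau; case: (ltngtP m n) => mn.
- have -> : Num.sg (tau m) = -1 by rewrite ltr0_sg // -tau_n lt_tau.
  case: (ltnP r m) => rm; first by rewrite (ltn_trans rm mn) subrr normr0 mulr0.
  by case: (ltnP r n) => rn; rewrite /= ?sub0r ?subrr ?normrN ?mulr1n ?normr1
    ?normr0 ?mulr0 ?mulN1r ?opprK ?oppr0.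
- have -> : Num.sg (tau m) = 1 by rewrite gtr0_sg // -tau_n lt_tau.
  case: (ltnP r n) => rn; first by rewrite (ltn_trans rn mn) subrr normr0 mulr0.
  by rewrite mul1r /= subr0 ger0_norm.
- by rewrite mn subrr normr0 mulr0.
Qed.

Lemma kap_sqr_sum m : (m <= n + n)%N ->
  \sum_(r < n + n) h * kap (tau m) r ^+ 2 <= `|tau m|.
Proof.
move=> mn; rewrite normrEsg; set s := Num.sg _.
rewrite -[X in _ <= _ * X](kap_sum mn) mulr_sumr.
apply: ler_sum => r _; rewrite -kap_norm mulrCA ler_wpM2l ?kap_sign //.
exact: ltW.
Qed.

(** On the support of the kernel both ends of the cell lie between 0 and [tau m], so |tau r| and h
    are each at most |tau m|. The extra h is kept for the discretization error in [inc_mean]. *)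
Lemma kap_moment m : (m <= n + n)%N ->
  \sum_(r < n + n) h * (`|kap (tau m) r| * (`|tau r| + h)) <= 2 * tau m ^+ 2.
Proof.
move=> mn; rewrite -(real_normK (num_real (tau m))) expr2 mulrA.
apply: le_trans (ler_wpM2l _ (kap_sqr_sum mn)); last by rewrite mulr_ge0.
rewrite mulr_sumr; apply: ler_sum => r _; rewrite [leRHS]mulrCA ler_wpM2l ?(ltW h0) //.
rewrite -kap_norm mulrC.
suff H : kap (tau m) r != 0 -> `|tau r| + h <= 2 * `|tau m|.
  have [->|/H ?] := eqVneq (kap (tau m) r) 0; first by rewrite normr0 !mulr0.
  by rewrite ler_wpM2r.
have step (u v : nat) : (u < v)%N -> tau u + h <= tau v.
  by move=> uv; rewrite -tauS leNgt lt_tau -leqNgt.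
rewrite kap_tau; case: (ltnP r m) => rm; case: (ltnP r n) => rn;
  rewrite ?subrr ?eqxx // => _.
  have := step _ _ rm; have : 0 <= tau r by rewrite -tau_n leNgt lt_tau -leqNgt.
  by move=> t0 t1; rewrite !ger0_norm //; have := ltW h0; lra.
have := step _ _ rn; rewrite tau_n => t1.
have : tau m <= tau r by rewrite leNgt lt_tau -leqNgt.
by move=> t2; rewrite !ler0_norm; have := ltW h0; lra.
Qed.

End Kernel.

(* [tau] is the grid; [grid] lets the integrals over the kernel of the usual
   concentration argument be written as finite sums. *)
Section Concentration.
Variables (R : archiRcfType) (Om J : finType) (p : Om -> R) (x : J -> Om -> R).
Variables (A B : J -> {set J}) (k b bet : R).
Hypothesis LD : local_dependence p x A B k b bet.
Variables (h : R) (n : nat).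
Hypotheses (h0 : 0 < h) (hn : h * n%:R = 1) (hb : h <= b) (bs : b <= 336^-1).
Hypothesis grid : forall j o, exists2 m, (m <= n + n)%N & nbr_sum x A j o = tau h n m.
Local Notation E := (Ex p).
Local Notation dep := (dep x).
Local Notation block := (block p x A k).
Local Notation y := (nbr_sum x A).
Local Notation S := (total x).
Local Notation U := (variance_sum_local x A).
Local Notation tau := (tau h n).
Local Notation kap := (kap h n).

Let p0 := prob_ge0 LD.
Let p1 := prob_sum1 LD.
Let b0 := b_gt0 LD.

Variables (D N : {set J}) (w a : Om -> R).
Hypotheses (bl : block D N) (dw : dep D w) (w0 : forall o, 0 <= w o).
(** The least admissible width. The estimate feeds back on itself with coefficient 42 b / al = 1/8,
    half of the 1/4 in front of the quantity being bounded. *)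
Let al := 336 * b.
Hypotheses (da : dep D a) (ala : forall o, al <= a o) (a4 : forall o, a o <= 4).
Local Notation near := (near p x N w).
Local Notation good := (good A N).

Let al0 : 0 < al. Proof. by rewrite mulr_gt0. Qed.
Let a0 o : 0 < a o. Proof. exact: lt_le_trans (ala o). Qed.

Let g o := rsq (U o).
(** The shift t plays the role of y_j and moves along the grid. It enters multiplied by the random
    g(U), so it cannot be absorbed in z; the parameter c absorbs it, and the estimate is carried for
    all c at once. The growth like 1 + |c| is that of the Lipschitz constant of the test function in
    u. *)
Let X c z t o := (S o - t + c) * g o - z.
Let Dt c z t o := phi (a o) (X c z t o).
Let G c z o t := g o * tf (a o) (X c z t o).
Let q c z := E (fun o => w o * Dt c z 0 o).

Let g0 o : 0 <= g o. Proof. exact: rsq_ge0. Qed.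
Let g1 o : g o <= 3 / 2. Proof. exact: rsq_le. Qed.

Let hg0 o : 0 <= h * g o. Proof. by rewrite mulr_ge0 // ltW. Qed.
Let hg_le o : h * g o <= 3 / 2 * h.
Proof. by rewrite mulrC ler_wpM2r // ltW. Qed.

Let hg_al o : h * g o <= a o.
Proof.
apply: le_trans (hg_le o) (le_trans _ (ala o)); rewrite /al; have := hb; have := h0; lra.
Qed.

Let hg_ratio o : h * g o / a o <= 3 / 2 * (h / al).
Proof.
rewrite mulrA; apply: ler_pM => //; first by rewrite invr_ge0 ltW.
by rewrite lef_pV2 ?posrE.
Qed.

Let XS c z t o : X c z (t + h) o = X c z t o - h * g o.
Proof. by rewrite /X; ring. Qed.

Let D0 c z t o : 0 <= Dt c z t o. Proof. exact: phi_ge0. Qed.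

Let D_step c z t o : `|Dt c z (t + h) o - Dt c z t o| <= 9 / 2 * (h / al) * Dt c z t o.
Proof.
rewrite /Dt XS; apply: le_trans (phi_step (a0 o) _ (hg0 o) (hg_al o)) _.
by rewrite ler_wpM2r ?phi_ge0 //; have := hg_ratio o; lra.
Qed.

Let inc c z o t := G c z o t - G c z o (t + h).

Let inc_ge0 c z o t : 0 <= inc c z o t.
Proof.
rewrite /inc /G -mulrBr mulr_ge0 // XS.
by have [] := tf_incr (a0 o) (_ : X c z t o - h * g o <= X c z t o); rewrite ?gerBl.
Qed.

Let inc_le c z o t : inc c z o t <= 9 / 4 * h.
Proof.
rewrite /inc /G -mulrBr XS.
have [|h1 h2] := tf_incr (a0 o) (_ : X c z t o - h * g o <= X c z t o); first by rewrite gerBl.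
apply: le_trans (_ : g o * (3 / 2 * h) <= _).
  rewrite ler_wpM2l //; apply: le_trans h2 _; rewrite opprB addrC subrK; exact: hg_le.
have : g o * (3 / 2 * h) <= 3 / 2 * (3 / 2 * h).
  by rewrite ler_wpM2r // mulr_ge0 ?(ltW h0) //; lra.
lra.
Qed.

Let inc_close c z o t :
  `|inc c z o t - h * g o ^+ 2 * Dt c z t o| <= 27 / 4 * (h * (h / al)) * Dt c z t o.
Proof.
rewrite /inc /G XS.
have -> : g o * tf (a o) (X c z t o) - g o * tf (a o) (X c z t o - h * g o) -
  h * g o ^+ 2 * Dt c z t o = g o * (tf (a o) (X c z t o) -
  tf (a o) (X c z t o - h * g o) - (h * g o) * phi (a o) (X c z t o)).
  by rewrite /Dt; ring.
rewrite normrM (ger0_norm (g0 o)).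
apply: le_trans (ler_wpM2l (g0 o) (tf_taylor (a0 o) (X c z t o) (hg0 o) (hg_al o))) _.
rewrite -/(Dt c z t o) [leLHS]mulrA ler_wpM2r ?D0 //.
have H0 : 0 <= h * g o / a o by rewrite divr_ge0 // ltW.
have H1 : h * g o * (h * g o / a o) <= 3 / 2 * h * (3 / 2 * (h / al)).
  exact: ler_pM.
have H2 : 0 <= 3 / 2 * h * (3 / 2 * (h / al)).
  by apply: le_trans H1; rewrite mulr_ge0.
have := ler_pM (g0 o) (mulr_ge0 (hg0 o) H0) (g1 o) H1; lra.
Qed.

(** The increments telescope, so their sum is a difference of two values of a function bounded by 3
    a / 2. *)
Let sum_inc c z o : \sum_(r < n + n) inc c z o (tau r) <= 3 * a o.
Proof.
have := telescope_sumr (fun r => G c z o (tau r)) (leq0n (n + n)); rewrite big_mkord => H.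
have -> : \sum_(r < n + n) inc c z o (tau r) = G c z o (tau 0) - G c z o (tau (n + n)).
  by rewrite -opprB -H -sumrN; apply: eq_bigr => r _; rewrite opprB /inc -tauS.
have Gle t : `|G c z o t| <= 3 / 2 * a o.
  rewrite /G normrM (ger0_norm (g0 o)); apply: ler_pM => //; exact: tf_le.
have := Gle (tau 0); have := Gle (tau (n + n)); rewrite !ler_norml => /andP[? ?] /andP[? ?].
lra.
Qed.

Let tau_le1 r : (r <= n + n)%N -> `|tau r| <= 1.
Proof.
move=> rn; rewrite -hn /tau normrM (gtr0_norm h0) ler_wpM2l ?(ltW h0) //.
have : (r%:R : R) <= n%:R + n%:R by rewrite -natrD ler_nat.
have := ler0n R r; rewrite ler_norml => ? ?; apply/andP; split; lra.
Qed.

(** The random kernel of the concentration inequality approach, restricted to good indices so that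
    it is independent of the weight. *)
Let K (r : nat) o := \sum_(j | good j) x j o * kap (y j o) r.

Let K_expand c z o : \sum_(j | good j) x j o * (G c z o 0 - G c z o (y j o)) =
  \sum_(r < n + n) inc c z o (tau r) * K r o.
Proof.
under [RHS]eq_bigr => r _ do rewrite mulr_sumr.
rewrite exchange_big; apply: eq_bigr => j _ /=; have [m mn ->] := grid j o.
rewrite -(kap_telescope h0 _ mn) mulr_sumr; apply: eq_bigr => r _.
by rewrite mulrCA.
Qed.

Let K_mean : \sum_(r < n + n) h * E (K r) = \sum_(j | good j) E (fun o => x j o * y j o).
Proof.
rewrite -[RHS]Ex_sum -mulr_sumr -Ex_sum -ExZ; apply: eq_Ex => o.
rewrite mulr_sumr; under eq_bigr => r _ do rewrite mulr_sumr.
rewrite exchange_big; apply: eq_bigr => j _ /=; have [m mn ->] := grid j o.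
rewrite -[in RHS](kap_sum h0 mn) mulr_sumr; apply: eq_bigr => r _.
by rewrite mulrCA.
Qed.

Let K_moment : \sum_(r < n + n) h * (`|E (K r)| * (`|tau r| + h)) <= 2 * b.
Proof.
apply: (@le_trans _ _ (2 * \sum_j E (fun o => `|x j o| * y j o ^+ 2))); last first.
  by rewrite ler_wpM2l // (E_xy2 LD).
apply: (@le_trans _ _ (\sum_(r < n + n) E (fun o =>
    \sum_j `|x j o| * (h * (`|kap (y j o) r| * (`|tau r| + h)))))).
  apply: ler_sum => r _; rewrite mulrCA -ler_pdivlMr; last first.
    by rewrite mulr_gt0 // ltr_wpDl.
  apply: le_trans (ler_norm_Ex p0 _) _; rewrite -ExZr; apply: le_Ex => // o.
  rewrite ler_pdivlMr; last by rewrite mulr_gt0 // ltr_wpDl.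
  apply: (@le_trans _ _ ((\sum_j `|x j o| * `|kap (y j o) r|) * (h * (`|tau r| + h)))).
    rewrite ler_wpM2r // ?mulr_ge0 ?addr_ge0 ?(ltW h0) //.
    apply: le_trans (ler_norm_sum _ _ _) _; rewrite big_mkcond; apply: ler_sum => j _.
    by rewrite normrM; case: ifP => // _; rewrite mulr_ge0.
  by rewrite mulr_suml; apply: ler_sum => j _; rewrite -mulrA [X in _ * X]mulrCA.
rewrite -Ex_sum -Ex_sum -ExZ; apply: le_Ex => // o.
rewrite exchange_big mulr_sumr; apply: ler_sum => j _ /=; rewrite -mulr_sumr.
rewrite mulrCA ler_wpM2l //; have [m mn ->] := grid j o.
exact: kap_moment.
Qed.

(** At each grid point the kernel is a sum of local statistics. Since [kap] takes only the values 0,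
    1 and -1, integrating its square gives at most |y_j|. *)
Let K_variance : \sum_(r < n + n) h * E (fun o => (K r o - E (K r)) ^+ 2) <= b.
Proof.
apply: le_trans (E_x2y LD).
pose Z (r : nat) j o := if good j then x j o * kap (y j o) r else 0.
have dZ r j : dep (A j) (Z r j).
  move=> o o' H; rewrite /Z; case: ifP => // _.
  by rewrite (dep_xi LD H) (dep_y H).
apply: (@le_trans _ _ (\sum_(r < n + n) h * (k * \sum_j E (fun o => Z r j o ^+ 2)))).
  apply: ler_sum => r _; rewrite ler_wpM2l ?(ltW h0) //.
  have KE o : K r o = \sum_j Z r j o by rewrite /K big_mkcond.
  apply: le_trans (variance_local LD (dZ r)); rewrite le_eqVlt; apply/orP; left.
  apply/eqP; apply: eq_Ex => o; rewrite KE; congr ((_ - _) ^+ 2).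
  by rewrite -Ex_sum; apply: eq_Ex => o'.
rewrite (eq_bigr _ (fun r _ => mulrCA h k _)) -mulr_sumr ler_wpM2l //.
  by have := k_ge1 LD; lra.
under eq_bigr => r _ do rewrite mulr_sumr.
rewrite exchange_big; apply: ler_sum => j _ /=.
rewrite (eq_bigr _ (fun r _ => esym (ExZ p h _))) -Ex_sum; apply: le_Ex => // o.
have [m mn yE] := grid j o.
apply: le_trans (_ : x j o ^+ 2 * (\sum_(r < n + n) h * kap (tau m) r ^+ 2) <= _).
  rewrite mulr_sumr; apply: ler_sum => r _; rewrite [leRHS]mulrCA ler_wpM2l ?(ltW h0) //.
  rewrite /Z yE; case: ifP => _; first by rewrite exprMn.
  by rewrite expr0n mulr_ge0 ?sqr_ge0.
by rewrite yE ler_wpM2l ?sqr_ge0 // kap_sqr_sum.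
Qed.

Let K_dep r : dep (~: N) (K r).
Proof.
apply: dep_sum => j gj; have sN : A j \subset ~: N.
  apply/subsetP => i iA; rewrite inE; apply/negP => iN.
  have : i \in N :&: A j by rewrite inE iN.
  by rewrite (eqP gj) inE.
move=> o o' H.
by rewrite (dep_sub sN (dep_xi LD (i := j)) H) (dep_sub sN (dep_y (A := A) (i := j)) H).
Qed.

(** The product of an increment i and a deviation d is at most i^2 / (2h) + h d^2 / 2, and i^2 <=
    (9/4) h i. The increments then sum to a multiple of a, while the squared deviations, functions
    of the variables outside [N], factor away from the weight. *)
Let fluctuation c z :
  `|E (fun o => w o * \sum_(r < n + n) inc c z o (tau r) * (K r o - E (K r)))| <=
  27 / 8 * E (fun o => w o * a o) + 2^-1 * (b * E w).
Proof.
have W0 : 0 <= E w by exact: Ex_ge0.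
have V : E (fun o => w o * \sum_(r < n + n) h * (K r o - E (K r)) ^+ 2) <= b * E w.
  rewrite (block_indep bl dw); last first.
    apply: dep_sum => r _ o o' H; by rewrite (K_dep r H).
  rewrite mulrC ler_wpM2r // Ex_sum; apply: le_trans K_variance.
  by apply: ler_sum => r _; rewrite ExZ.
apply: le_trans (ler_norm_Ex p0 _) _.
apply: (@le_trans _ _ (27 / 8 * E (fun o => w o * a o) + 2^-1 *
  E (fun o => w o * \sum_(r < n + n) h * (K r o - E (K r)) ^+ 2))); last lra.
rewrite -!ExZ -ExD; apply: le_Ex => // o.
rewrite normrM (ger0_norm (w0 o)) mulrCA [X in _ <= _ + X]mulrCA -mulrDr ler_wpM2l //.
apply: le_trans (ler_norm_sum _ _ _) _.
apply: (@le_trans _ _ (\sum_(r < n + n) (9 / 8 * inc c z o (tau r) +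
   2^-1 * (h * (K r o - E (K r)) ^+ 2)))); last first.
  rewrite big_split /= -!mulr_sumr; have := sum_inc c z o; lra.
apply: ler_sum => r _; rewrite normrM (ger0_norm (inc_ge0 _ _ _ _)).
have i0 := inc_ge0 c z o (tau r); have i1 := inc_le c z o (tau r).
move: (K r o - _) (inc _ _ _ _) i0 i1 => d i i0 i1.
rewrite -(real_normK (num_real d)); have := normr_ge0 d; move: `|d| => e e0.
have s0 := sqr_ge0 (h * e - i).
have i2 : i ^+ 2 <= 9 / 4 * h * i by rewrite expr2 ler_wpM2r.
rewrite -(ler_pM2l h0); lra.
Qed.

Section Improve.
Variables (z Q : R).
Hypotheses (Q0 : 0 <= Q) (qQ : forall c, q c z <= Q * (1 + `|c|)).

Let qD c t : `|t| <= 1 -> E (fun o => w o * Dt c z t o) <= 2 * (Q * (1 + `|c|)).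
Proof.
move=> t1; have -> : E (fun o => w o * Dt c z t o) = q (c - t) z.
  apply: eq_Ex => o; rewrite /Dt /X; congr (_ * phi _ _); ring.
apply: le_trans (qQ _) _; rewrite mulrCA ler_wpM2l //.
have := ler_normB c t; have := normr_ge0 c; lra.
Qed.

(** The grid is crossed one cell at a time. Each crossing changes [Dt] by at most (9/2)(h / al)
    times itself, and by the hypothesis on [Q] the mean of [Dt] is at most 2 Q (1 + |c|) at every
    position; hence the errors add up and do not compound. *)
Let drift_up c m : (m <= n)%N ->
  E (fun o => w o * `|Dt c z (tau (n + m)) o - Dt c z 0 o|) <=
  m%:R * (9 * (h / al) * (Q * (1 + `|c|))).
Proof.
elim: m => [|m IH] mn.
  rewrite mul0r addn0 tau_n (@eq_Ex _ _ p _ (fun=> 0)) ?Ex_cst // => o.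
  by rewrite subrr normr0 mulr0.
rewrite addnS tauS -natr1 mulrDl mul1r.
have t1 : `|tau (n + m)| <= 1 by rewrite tau_le1 // leq_add2l ltnW.
apply: le_trans (lerD (IH (ltnW mn)) (_ : 9 / 2 * (h / al) *
  E (fun o => w o * Dt c z (tau (n + m)) o) <= _)); last first.
  have : 0 <= 9 / 2 * (h / al) by rewrite mulr_ge0 ?divr_ge0 ?ltW //; lra.
  by move=> /(ler_wpM2l)/(_ _ _ (qD c t1)); lra.
rewrite -ExZ -ExD; apply: le_Ex => // o.
have := ler_wpM2l (w0 o) (D_step c z (tau (n + m)) o).
have := ler_wpM2l (w0 o) (ler_distD (Dt c z (tau (n + m)) o)
  (Dt c z (tau (n + m) + h) o) (Dt c z 0 o)); lra.
Qed.

Let drift_down c m : (m <= n)%N ->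
  E (fun o => w o * `|Dt c z (tau (n - m)) o - Dt c z 0 o|) <=
  m%:R * (9 * (h / al) * (Q * (1 + `|c|))).
Proof.
elim: m => [|m IH] mn.
  rewrite mul0r subn0 tau_n (@eq_Ex _ _ p _ (fun=> 0)) ?Ex_cst // => o.
  by rewrite subrr normr0 mulr0.
have tE : tau (n - m) = tau (n - m.+1) + h by rewrite -tauS subnSK.
rewrite -natr1 mulrDl mul1r.
have t1 : `|tau (n - m.+1)| <= 1.
  by rewrite tau_le1 // (leq_trans (leq_subr _ _)) // leq_addr.
apply: le_trans (lerD (IH (ltnW mn)) (_ : 9 / 2 * (h / al) *
  E (fun o => w o * Dt c z (tau (n - m.+1)) o) <= _)); last first.
  have : 0 <= 9 / 2 * (h / al) by rewrite mulr_ge0 ?divr_ge0 ?ltW //; lra.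
  by move=> /(ler_wpM2l)/(_ _ _ (qD c t1)); lra.
rewrite -ExZ -ExD tE; apply: le_Ex => // o.
have := ler_wpM2l (w0 o) (D_step c z (tau (n - m.+1)) o).
have := ler_wpM2l (w0 o) (ler_distD (Dt c z (tau (n - m.+1) + h) o)
  (Dt c z (tau (n - m.+1)) o) (Dt c z 0 o)).
rewrite (distrC (Dt c z (tau (n - m.+1)) o) (Dt c z (tau (n - m.+1) + h) o)); lra.
Qed.

Let drift c (r : nat) : (r <= n + n)%N ->
  E (fun o => w o * `|Dt c z (tau r) o - Dt c z 0 o|) <=
  9 * (`|tau r| / al) * (Q * (1 + `|c|)).
Proof.
move=> rn; have tE m : m%:R * (9 * (h / al) * (Q * (1 + `|c|))) =
    9 * (h * m%:R / al) * (Q * (1 + `|c|)) by ring.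
have [nr|nr] := leqP n r.
  rewrite -(subnKC nr); apply: le_trans (drift_up c _) _; first by rewrite leq_subLR.
  rewrite tE le_eqVlt; apply/orP; left; apply/eqP; congr (_ * (_ / _) * _).
  by rewrite /tau natrD addrC addKr normrM !ger0_norm // ltW.
rewrite -(subKn (ltnW nr)); apply: le_trans (drift_down c _) _; first exact: leq_subr.
rewrite tE le_eqVlt; apply/orP; left; apply/eqP; congr (_ * (_ / _) * _).
rewrite /tau (natrB _ (leq_subr r n)) addrC addKr normrM normrN !ger0_norm //.
exact: ltW.
Qed.

(** Two errors occur: the increment over a cell against its linear part at [tau r], and the drift
    from [tau r] to 0. They are proportional to h and to |tau r|, a sum that [K_moment]
    integrates. *)
Let inc_mean c (r : nat) : (r <= n + n)%N ->
  `|E (fun o => w o * inc c z o (tau r)) - h * E (fun o => w o * (g o ^+ 2 * Dt c z 0 o))|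
  <= h * (`|tau r| + h) * (21 / al * (Q * (1 + `|c|))).
Proof.
move=> rn; rewrite -ExZ -ExB; apply: le_trans (ler_norm_Ex p0 _) _.
have H1 := drift c rn; have H2 := qD c (tau_le1 rn).
have hal0 : 0 <= h * (h / al) by rewrite mulr_ge0 ?divr_ge0 // ltW.
have Qc0 : 0 <= Q * (1 + `|c|) by rewrite mulr_ge0 // addr_ge0.
apply: (@le_trans _ _ (9 / 4 * h * E (fun o => w o * `|Dt c z (tau r) o - Dt c z 0 o|) +
   27 / 4 * (h * (h / al)) * E (fun o => w o * Dt c z (tau r) o))); last first.
  have e1 : 9 / 4 * h * E (fun o => w o * `|Dt c z (tau r) o - Dt c z 0 o|) <=
      9 / 4 * h * (9 * (`|tau r| / al) * (Q * (1 + `|c|))).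
    by rewrite ler_wpM2l // mulr_ge0 ?(ltW h0) //; lra.
  have e2 : 27 / 4 * (h * (h / al)) * E (fun o => w o * Dt c z (tau r) o) <=
      27 / 4 * (h * (h / al)) * (2 * (Q * (1 + `|c|))).
    by rewrite ler_wpM2l // mulr_ge0 //; lra.
  apply: le_trans (lerD e1 e2) _.
  have : 0 <= h * (h / al) * (Q * (1 + `|c|)) by rewrite mulr_ge0.
  have : 0 <= h * (`|tau r| / al) * (Q * (1 + `|c|)).
    by rewrite mulr_ge0 // mulr_ge0 ?divr_ge0 // ltW.
  lra.
rewrite -!ExZ -ExD; apply: le_Ex => // o.
rewrite (_ : w o * _ - _ = w o * (inc c z o (tau r) - h * g o ^+ 2 * Dt c z 0 o));
  last by ring.
rewrite [leRHS](_ : _ = w o * (9 / 4 * h * `|Dt c z (tau r) o - Dt c z 0 o| +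
  27 / 4 * (h * (h / al)) * Dt c z (tau r) o)); last by ring.
rewrite normrM (ger0_norm (w0 o)) ler_wpM2l //.
have h1 := inc_close c z o (tau r).
have h2 : `|h * g o ^+ 2 * Dt c z (tau r) o - h * g o ^+ 2 * Dt c z 0 o| <=
    9 / 4 * h * `|Dt c z (tau r) o - Dt c z 0 o|.
  rewrite -mulrBr normrM ler_wpM2r // ger0_norm ?mulr_ge0 ?sqr_ge0 ?(ltW h0) //.
  rewrite mulrC ler_wpM2r ?(ltW h0) //; have := g0 o; have := g1 o; nra.
have := ler_distD (h * g o ^+ 2 * Dt c z (tau r) o) (inc c z o (tau r))
   (h * g o ^+ 2 * Dt c z 0 o).
lra.
Qed.

(** In [expansion] with F = g(u) tf((s + c) g(u) - z), the term with S F is at most 6 E[w a], while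
    the sum of differences is at least q / 4 minus errors, of which Q (1 + |c|) / 8 comes from the
    drift. Solving for q halves [Q]. *)
Lemma concentration_step c : q c z <=
  (1 + `|c|) * (50 * E (fun o => w o * a o) + 144 * near + Q / 2).
Proof.
have W0 : 0 <= E w by exact: Ex_ge0.
have wa0 o : 0 <= w o * a o by rewrite mulr_ge0 // ltW.
have Wa0 : 0 <= E (fun o => w o * a o) by exact: Ex_ge0.
have near0 : 0 <= near.
  by apply: Ex_ge0 => // o; rewrite !mulr_ge0 ?sumr_ge0 ?addr_ge0.
have bE : 336 * (b * E w) <= E (fun o => w o * a o).
  by rewrite mulrA -ExZ; apply: le_Ex => // o; rewrite mulrC ler_wpM2l.
pose F s u o := rsq u * tf (a o) ((s + c) * rsq u - z).
have dF s u : dep D (F s u) by move=> o o' H; rewrite /F (da H).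
have FM s u o : `|F s u o| <= 3 / 2 * a o.
  rewrite /F normrM (ger0_norm (rsq_ge0 _)); apply: ler_pM => //.
  - exact: rsq_ge0.
  - exact: rsq_le.
  - exact: tf_le.
have c1 : 0 <= `|c| by [].
have FL s u u' o : `|F s u o - F s u' o| <= (9 * (1 + `|c|)) * `|u - u'| * (1 + `|s|).
  have -> : F s u o - F s u' o =
      (rsq u - rsq u') * tf (a o) ((s + c) * rsq u - z) +
      rsq u' * (tf (a o) ((s + c) * rsq u - z) - tf (a o) ((s + c) * rsq u' - z)).
    by rewrite /F; ring.
  apply: le_trans (ler_normD _ _) _; rewrite normrM (normrM (rsq u')) (ger0_norm (rsq_ge0 _)).
  have l1 := rsq_lipschitz u u'.
  have l2 : `|rsq u - rsq u'| * `|tf (a o) ((s + c) * rsq u - z)| <= 3 / 2 * `|u - u'| * 4.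
    by apply: ler_pM => //; apply: le_trans (tf_le (a0 o) _) (a4 o).
  have l3 : rsq u' * `|tf (a o) ((s + c) * rsq u - z) - tf (a o) ((s + c) * rsq u' - z)| <=
      3 / 2 * ((`|s| + `|c|) * (3 / 2 * `|u - u'|)).
    apply: ler_pM; rewrite ?rsq_ge0 ?rsq_le //.
    apply: le_trans (tf_lipschitz (a0 o) _ _) _.
    rewrite (_ : _ - _ = (s + c) * (rsq u - rsq u')); last by ring.
    by rewrite normrM; apply: ler_pM => //; apply: ler_normD.
  apply: le_trans (lerD l2 l3) _.
  have d0 : 0 <= `|u - u'| by []. have s0 : 0 <= `|s| by [].
  have e1 := mulr_ge0 d0 s0; have e2 := mulr_ge0 d0 c1; have e3 := mulr_ge0 e1 c1.
  lra.
have L0 : 0 <= 9 * (1 + `|c|) by rewrite mulr_ge0 // addr_ge0.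
have M0 := expansion LD bl dw w0 dF FM L0 FL; move: M0.
set T := E (fun o => w o * \sum_(j | good j) _).
have SF : `|E (fun o => w o * (S o * F (S o) (U o) o))| <= 6 * E (fun o => w o * a o).
  have dwa : dep D (fun o => w o * a o) by exact: depM.
  apply: le_trans (_ : 3 / 2 * E (fun o => w o * a o * `|S o|) <= _); last first.
    by have := block_first_moment LD bl dwa wa0; lra.
  apply: le_trans (ler_norm_Ex p0 _) _; rewrite -ExZ; apply: le_Ex => // o.
  rewrite normrM (normrM (S o)) (ger0_norm (w0 o)).
  have ws0 : 0 <= w o * `|S o| by rewrite mulr_ge0.
  have := ler_wpM2l ws0 (FM (S o) (U o) o); lra.
have TE : T = E (fun o => w o * \sum_(r < n + n) inc c z o (tau r) * E (K r)) +
   E (fun o => w o * \sum_(r < n + n) inc c z o (tau r) * (K r o - E (K r))).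
  rewrite -ExD; apply: eq_Ex => o; rewrite -mulrDr; congr (_ * _).
  transitivity (\sum_(r < n + n) inc c z o (tau r) * K r o).
    rewrite -K_expand; apply: eq_bigr => j _; congr (_ * _).
    by rewrite /F /G /X subr0.
  by rewrite -big_split; apply: eq_bigr => r _ /=; ring.
(* The coefficient 1/4 is the lower bound 1/2 on the mass of the mean kernel times the lower bound
   1/2 on g(U)^2. *)
have main : E (fun o => w o * \sum_(r < n + n) inc c z o (tau r) * E (K r)) >=
    4^-1 * q c z - 42 * b * (al^-1 * (Q * (1 + `|c|))).
  have -> : E (fun o => w o * \sum_(r < n + n) inc c z o (tau r) * E (K r)) =
      \sum_(r < n + n) E (K r) * E (fun o => w o * inc c z o (tau r)).
    rewrite (eq_bigr _ (fun r _ => esym (ExZ p _ _))) -Ex_sum; apply: eq_Ex => o.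
    by rewrite mulr_sumr; apply: eq_bigr => r _; ring.
  have Qc0 : 0 <= 21 / al * (Q * (1 + `|c|)).
    by rewrite mulr_ge0 ?divr_ge0 ?mulr_ge0 ?addr_ge0 // ltW.
  set mm := E (fun o => w o * (g o ^+ 2 * Dt c z 0 o)).
  have mm_q : 2^-1 * q c z <= mm.
    rewrite -ExZ; apply: le_Ex => // o; rewrite mulrCA ler_wpM2l // ler_wpM2r //.
    exact: rsq_sqr_ge.
  have q0 : 0 <= q c z by apply: Ex_ge0 => // o; rewrite mulr_ge0.
  have m1 : \sum_(r < n + n) E (K r) * E (fun o => w o * inc c z o (tau r)) =
     (\sum_(r < n + n) h * E (K r)) * mm + \sum_(r < n + n)
      E (K r) * (E (fun o => w o * inc c z o (tau r)) - h * mm).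
    rewrite mulr_suml -big_split; apply: eq_bigr => r _ /=; ring.
  rewrite m1 K_mean.
  have gm : 2^-1 <= \sum_(j | good j) E (fun o => x j o * y j o).
    by apply: (good_mass LD bl); have := bs; lra.
  have e1 : 4^-1 * q c z <= (\sum_(j | good j) E (fun o => x j o * y j o)) * mm.
    have : 2^-1 * (2^-1 * q c z) <= (\sum_(j | good j) E (fun o => x j o * y j o)) * mm.
      by apply: ler_pM => //; rewrite ?mulr_ge0 ?invr_ge0 //.
    lra.
  have e2 : `|\sum_(r < n + n) E (K r) * (E (fun o => w o * inc c z o (tau r)) - h * mm)| <=
      42 * b * (al^-1 * (Q * (1 + `|c|))).
    apply: le_trans (ler_norm_sum _ _ _) _.
    apply: (@le_trans _ _ (\sum_(r < n + n) h * (`|E (K r)| * (`|tau r| + h)) *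
        (21 / al * (Q * (1 + `|c|))))).
      apply: ler_sum => r _; rewrite normrM [leRHS](_ : _ = `|E (K r)| *
        (h * (`|tau r| + h) * (21 / al * (Q * (1 + `|c|))))); last by ring.
      rewrite ler_wpM2l //.
      by apply: inc_mean; apply: ltnW.
    rewrite -mulr_suml; have := ler_wpM2r Qc0 K_moment; lra.
  move: e2; rewrite ler_norml => /andP[e2 _]; lra.
have := fluctuation c z; rewrite !ler_norml => /andP[f1 _].
move: SF; rewrite ler_norml => /andP[_ SF] /andP[T1 _].
have alE : 42 * b * (al^-1 * (Q * (1 + `|c|))) = 8^-1 * (Q * (1 + `|c|)).
  rewrite /al invfM; field; by rewrite gt_eqF // b0.
have bad : E (fun o => w o * (3 / 2 * a o * \sum_(j | ~~ good j) `|x j o|)) <=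
    3 / 2 * E (fun o => w o * a o).
  rewrite -ExZ; apply: le_Ex => // o; rewrite [leRHS]mulrCA ler_wpM2l //.
  apply: ler_piMr; last exact: (sum_bad_le1 LD bl).
  by rewrite mulr_ge0 ?(ltW (a0 o)) //; lra.
have wM : E (fun o => w o * (3 / 2 * a o)) = 3 / 2 * E (fun o => w o * a o).
  by rewrite -ExZ; apply: eq_Ex => o; ring.
rewrite wM in T1; rewrite alE in main.
have bt : bet * E (fun o => w o * a o) <= 16^-1 * E (fun o => w o * a o).
  by rewrite ler_wpM2r // (bet_small LD).
have c2 := mulr_ge0 c1 Wa0; have c3 := mulr_ge0 c1 near0.
have c4 := ler_wpM2l c1 bE; rewrite TE in T1; lra.
Qed.

End Improve.

Let X0 := 50 * E (fun o => w o * a o) + 144 * near.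

Let X0_ge0 : 0 <= X0.
Proof.
apply: addr_ge0; apply: mulr_ge0 => //; apply: Ex_ge0 => // o.
  by rewrite mulr_ge0 // ltW.
by rewrite !mulr_ge0 ?sumr_ge0 ?addr_ge0.
Qed.

(** 2 X0 is the fixed point of Q -> X0 + Q / 2. The iteration can start from q <= E w because [phi]
    is at most 1. *)
Let iterate z m c : q c z <= (2 * X0 + E w / 2 ^+ m) * (1 + `|c|).
Proof.
have W0 : 0 <= E w by exact: Ex_ge0.
elim: m c => [|m IH] c.
  rewrite expr0 divr1; apply: (@le_trans _ _ (E w)).
    by apply: le_Ex => // o; rewrite ler_piMr // phi_le1.
  have c0 : 0 <= `|c| by [].
  have := mulr_ge0 X0_ge0 c0; have := mulr_ge0 W0 c0; have := X0_ge0; lra.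
have Q0 : 0 <= 2 * X0 + E w / 2 ^+ m.
  by rewrite addr_ge0 ?mulr_ge0 // invr_ge0 exprn_ge0.
apply: le_trans (concentration_step Q0 IH c) _; rewrite mulrC ler_wpM2r ?addr_ge0 //.
rewrite exprS invfM -/X0; lra.
Qed.

Theorem concentration z :
  E (fun o => w o * (`|S o * rsq (U o) - z| <= a o)%R%:R) <=
  400 * E (fun o => w o * a o) + 1152 * near.
Proof.
have W0 : 0 <= E w by exact: Ex_ge0.
suff H : q 0 z <= 2 * X0.
  (* [phi] is at least 1/4 on the window. *)
  apply: (@le_trans _ _ (4 * q 0 z)); last by move: H; rewrite /X0; lra.
  rewrite -ExZ; apply: le_Ex => // o; rewrite mulrCA ler_wpM2l //.
  case: (lerP _ (a o)) => ha /=; last by rewrite mulr_ge0.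
  have := phi_ge (a0 o) ha; rewrite /Dt /X subr0 addr0 /=; lra.
apply/ler_addgt0Pr => e e0.
have [m] : exists m : nat, E w / 2 ^+ m <= e.
  exists (Num.bound (E w / e)).
  rewrite ler_pdivrMr ?exprn_gt0 // mulrC -ler_pdivrMr //.
  apply: le_trans (_ : (Num.bound (E w / e))%:R <= _).
    by apply/ltW/archi_boundP; rewrite divr_ge0 // ltW.
  by rewrite -natrX ler_nat ltnW // ltn_expl.
by have := iterate z m 0; rewrite normr0 addr0 mulr1; lra.
Qed.

End Concentration.

(** * Stein's method on a finite space *)

(** In the application c is [Phi z]. The derivative is eliminated through Stein's equation f'(s) = s
    f(s) + 1(s <= z) - c, so that the finite-space argument involves no calculus. The last term of
    [stein_taylor] accounts for the jump of f' when z separates s and t. *)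
Record stein_solution (R : realFieldType) (z c : R) (f : R -> R) : Prop := SteinSolution {
  stein_le : forall s, `|f s| <= 6;
  stein_lip : forall s t, `|f s - f t| <= 2 * `|s - t|;
  stein_deriv_le : forall s, `|s * f s + (s <= z)%R%:R - c| <= 2;
  stein_taylor : forall s t,
    `|f s - f t - (s - t) * (s * f s + (s <= z)%R%:R - c)| <=
    `|s - t| ^+ 2 * (6 + 2 * `|s|) + 4 * `|s - t| * (`|s - z| <= `|s - t|)%R%:R }.

Section Kolmogorov.
Variables (R : archiRcfType) (Om J : finType) (p : Om -> R) (x : J -> Om -> R).
Variables (A B : J -> {set J}) (k b bet th : R).
Hypothesis LD : local_dependence p x A B k b bet.
Local Notation E := (Ex p).
Local Notation dep := (dep x).
Local Notation block := (block p x A k).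
Local Notation y := (nbr_sum x A).
Local Notation S := (total x).
Local Notation U := (variance_sum_local x A).
Local Notation So := (outer_sum x).
Hypothesis th_ge : \sum_i \sum_(j in A i) E (fun o => `|x i o * x j o|) <= th.

Let p0 := prob_ge0 LD.
Let p1 := prob_sum1 LD.
Let b0 := b_gt0 LD.
Let k1 := k_ge1 LD.
Let k0 : 0 < k. Proof. exact: lt_le_trans k1. Qed.

(** A function that depends on no variable is constant. The weight 1 lives on this block, which
    turns weighted estimates into unweighted ones. *)
Lemma block_set0 : block finset.set0 finset.set0.
Proof.
split; first by rewrite finset.sub0set.
  move=> f g df _; rewrite [E g]/Ex mulr_sumr; apply: eq_bigr => o _.
  rewrite mulrCA; congr (_ * (_ * _)).
  rewrite (eq_Ex _ (g := fun=> f o)) ?Ex_cst // => o'; apply: df => i.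
  by rewrite inE.
rewrite eq_card0 ?(ltW k0) // => j.
by rewrite !inE finset.set0I eqxx.
Qed.

Lemma x_block i : block (A i) (B i). Proof. exact: LDblock LD i. Qed.

Definition wxy i o := `|x i o * y i o|.

Lemma wxy_ge0 i o : 0 <= wxy i o. Proof. exact: normr_ge0. Qed.

Lemma dep_wxy i : dep (A i) (wxy i).
Proof.
by move=> o o' H; rewrite /wxy (dep_xi LD H) (dep_y H).
Qed.

Lemma wxy_le_th : \sum_i E (wxy i) <= th.
Proof.
apply: le_trans th_ge; apply: ler_sum => i _; rewrite -Ex_sum; apply: le_Ex => // o.
rewrite /wxy /y mulr_sumr; exact: ler_norm_sum.
Qed.

Lemma th_ge0 : 0 <= th.
Proof. by apply: le_trans wxy_le_th; apply: sumr_ge0 => i _; exact: (Ex_ge0 p0 (wxy_ge0 i)). Qed.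

Lemma sum_cubes_S : k ^+ 2 * \sum_j E (fun o => `|x j o| ^+ 3 * (2 + `|S o|)) <= 8 * b.
Proof.
apply: le_trans (_ : 8 * (k ^+ 2 * \sum_j E (fun o => `|x j o| ^+ 3)) <= _); last first.
  by have := cubes_le LD; lra.
rewrite mulrCA ler_wpM2l ?sqr_ge0 // mulr_sumr; apply: ler_sum => j _.
have d1 : dep finset.set0 (fun=> 1) by [].
have jN : j \notin (finset.set0 : {set J}) by rewrite inE.
have := block_far_cube LD block_set0 d1 (fun _ => ler01) jN.
by rewrite Ex_cst // mulr1 (eq_Ex _ (fun o => mul1r _)).
Qed.

Lemma xy2_S : \sum_j E (fun o => `|x j o| * y j o ^+ 2 * (2 + `|S o|)) <= 8 * b.
Proof.
apply: le_trans sum_cubes_S; rewrite -Ex_sum -Ex_sum -ExZ; apply: le_Ex => // o.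
rewrite -!mulr_suml mulrA ler_wpM2r ?addr_ge0 //; exact: (xy2_cubes LD).
Qed.

(** Paths m, j, l with m in [A j] and l in [B j]: the second edge runs in the graph of the [B j],
    whose degrees are bounded in both directions as well. *)
Lemma near_sum : \sum_j near p x (B j) (wxy j) <= 8 * b.
Proof.
apply: le_trans sum_cubes_S; rewrite -Ex_sum -Ex_sum -ExZ; apply: le_Ex => // o.
rewrite -mulr_suml mulrA.
under eq_bigr => j _ do rewrite mulrA.
rewrite -mulr_suml ler_wpM2r ?addr_ge0 //.
have := sum_path3 (degree_le_flip (eA_degree LD)) (eB_degree LD) (ltW k0)
  (u := fun j => `|x j o|) (fun j => normr_ge0 _).
apply: le_trans; rewrite exchange_rel; apply: ler_sum => j _.
rewrite /wxy normrM.
apply: le_trans (_ : `|x j o| * (\sum_(m in A j) `|x m o|) * \sum_(l in B j) `|x l o| <= _).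
  rewrite ler_wpM2r ?sumr_ge0 // ler_wpM2l //; exact: y_abs.
rewrite -mulrA mulrCA mulr_suml; apply: ler_sum => m _; rewrite 2!mulr_sumr.
by apply: ler_sum => l _; rewrite mulrA.
Qed.

(** Write S^4 as the sum of the x_i S^3 and compare S^3 with (S - y_i)^3, of which x_i is
    independent. The difference costs |x_i y_i| (5 S^2 + 3), whose mean is at most 73 = 5 * 14 + 3
    times that of |x_i y_i| by [block_second_moment]; hence [th]. The remainder contains 4 [bet] <=
    1/4 times the moment itself and is absorbed. *)
Lemma fourth_moment : E (fun o => S o ^+ 4) <= 100 * th + 1.
Proof.
have [s0 [t0 bb]] : [/\ 0 <= E (fun o => S o ^+ 4), 0 <= th & 0 <= bet].
  split; [|exact: th_ge0|exact: bet0 LD].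
  by apply: Ex_ge0 => // o; rewrite (exprM _ 2 2) sqr_ge0.
have E1 : E (fun o => S o ^+ 4) =
    \sum_i E (fun o => x i o * (S o ^+ 3 - So (A i) o ^+ 3)) +
    \sum_i E (x i) * E (fun o => So (A i) o ^+ 3).
  rewrite [X in _ + X](eq_bigr (fun i => E (fun o => x i o * So (A i) o ^+ 3))); last first.
    move=> i _; rewrite -(indep_x LD) //.
    by apply: (dep_comp (fun t => t ^+ 3)); exact: dep_So.
  rewrite -big_split /= (eq_bigr (fun i => E (fun o => x i o * S o ^+ 3))); last first.
    by move=> i _; rewrite -ExD; apply: eq_Ex => o; ring.
  by rewrite -Ex_sum; apply: eq_Ex => o; rewrite -mulr_suml -exprS.
have T1 : \sum_i E (fun o => x i o * (S o ^+ 3 - So (A i) o ^+ 3)) <= 73 * th.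
  apply: le_trans (_ : 73 * \sum_i E (wxy i) <= _); last first.
    by have := wxy_le_th; lra.
  rewrite mulr_sumr; apply: ler_sum => i _.
  have := block_second_moment LD (x_block i) (dep_wxy (i := i)) (wxy_ge0 i) => H.
  apply: le_trans (_ : 5 * E (fun o => wxy i o * S o ^+ 2) + 3 * E (wxy i) <= _); last lra.
  rewrite -!ExZ -ExD; apply: le_Ex => // o; rewrite -(S_y x A).
  apply: le_trans (ler_norm _) _; rewrite normrM /wxy normrM.
  have y1 := y_le1 LD i o; have x0 := normr_ge0 (x i o).
  have -> : S o ^+ 3 - (S o - y i o) ^+ 3 =
    y i o * (3 * S o ^+ 2 - 3 * (S o * y i o) + y i o ^+ 2) by ring.
  rewrite normrM mulrA.
  have xy0 : 0 <= `|x i o| * `|y i o| by rewrite mulr_ge0.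
  have : `|3 * S o ^+ 2 - 3 * (S o * y i o) + y i o ^+ 2| <= 5 * S o ^+ 2 + 3.
    move: y1; rewrite !ler_norml => /andP[y1 y2].
    have y3 : y i o ^+ 2 <= 1 by nra.
    have := sqr_ge0 (S o); have := sqr_ge0 (S o - y i o); have := sqr_ge0 (S o + y i o).
    have := sqr_ge0 (y i o) => ? ? ? ?; apply/andP; split; lra.
  by move=> /(ler_wpM2l xy0); lra.
have T2 : \sum_i E (x i) * E (fun o => So (A i) o ^+ 3) <=
    bet * (4 * E (fun o => S o ^+ 4) + 8).
  apply: le_trans (ler_norm _) _; apply: le_trans (ler_norm_sum _ _ _) _.
  apply: (@le_trans _ _ (\sum_i `|E (x i)| * (4 * E (fun o => S o ^+ 4) + 8))); last first.
    by rewrite -mulr_suml ler_wpM2r ?(means_le LD) //; lra.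
  apply: ler_sum => i _; rewrite normrM ler_wpM2l //.
  apply: le_trans (ler_norm_Ex p0 _) _.
  rewrite -(Ex_cst p1 8) -ExZ -ExD; apply: le_Ex => // o.
  have : `|So (A i) o| <= `|S o| + 1.
    by rewrite -(S_y x A); have := ler_normB (S o) (y i o); have := y_le1 LD i o; lra.
  have -> : S o ^+ 4 = `|S o| ^+ 4.
    by rewrite (exprM _ 2 2) -(real_normK (num_real (S o))) -exprM.
  rewrite normrX; have := normr_ge0 (So (A i) o); have := normr_ge0 (S o).
  move: `|S o| `|So (A i) o| => s t hs ht hst.
  have h1 : t ^+ 3 <= (s + 1) ^+ 3 by rewrite ler_pXn2r ?nnegrE //; lra.
  have h2 : 0 <= (s + 1) * (s - 1) ^+ 2 by rewrite mulr_ge0 ?sqr_ge0 //; lra.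
  have h4 : s ^+ 3 <= s ^+ 4 + 1.
    have [s1|s1] := lerP s 1.
      by have := exprn_ile1 3 hs s1; have := exprn_ge0 4 hs; lra.
    have : 0 <= s ^+ 3 * (s - 1) by rewrite mulr_ge0 ?exprn_ge0 //; lra.
    lra.
  lra.
have := ler_wpM2r (_ : 0 <= 4 * E (fun o => S o ^+ 4) + 8) (bet_small LD) => H.
have {}H := H ltac:(lra); lra.
Qed.

(** Divided by [k], the sum of the y_j is a combination of the x_i with coefficients in [0, 1], so
    that it is estimated in the manner of [S]. *)
Definition nbr_total o := k^-1 * \sum_j y j o.

Local Notation T := nbr_total.

Let c i : R := k^-1 * #|[pred j | i \in A j]|%:R.

Let c_bounds i : 0 <= c i /\ c i <= 1.
Proof.
split; first by rewrite mulr_ge0 ?invr_ge0 // ltW.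
rewrite /c mulrC ler_pdivrMr // mul1r; exact: (eA_degree LD).2.
Qed.

Let TE o : T o = \sum_i c i * x i o.
Proof.
rewrite /T /y (exchange_big_dep predT) //= mulr_sumr; apply: eq_bigr => i _.
by rewrite sum_card mulrA.
Qed.

Lemma T_second_moment : E (fun o => T o ^+ 2) <= 2 * th + 1.
Proof.
pose To i o := \sum_(j | j \notin A i) c j * x j o.
have dTo i : dep (~: A i) (To i).
  by apply: dep_sum => j jA o o' H; rewrite H // inE.
have near_T i o : `|T o - To i o| <= \sum_(j in A i) `|x j o|.
  rewrite TE (bigID (mem (A i))) /= addrK; apply: le_trans (ler_norm_sum _ _ _) _.
  apply: ler_sum => j _; have [h1 h2] := c_bounds j.
  by rewrite normrM (ger0_norm h1) ler_piMl.
have near1 i o : `|T o - To i o| <= 1.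
  by apply: le_trans (near_T i o) _; apply: (sum_x_le1 LD); exact: (eA_degree LD).1.
have s0 : 0 <= E (fun o => T o ^+ 2) by apply: Ex_ge0 => // o; apply: sqr_ge0.
have E1 : E (fun o => T o ^+ 2) = \sum_i c i * E (fun o => x i o * (T o - To i o)) +
    \sum_i c i * (E (x i) * E (To i)).
  rewrite -big_split /= (eq_bigr (fun i => E (fun o => c i * x i o * T o))); last first.
    move=> i _; rewrite -(indep_x LD (dTo i)) -mulrDr -ExD -ExZ; apply: eq_Ex => o.
    by ring.
  by rewrite -Ex_sum; apply: eq_Ex => o; rewrite -mulr_suml -TE expr2.
have T1 : \sum_i c i * E (fun o => x i o * (T o - To i o)) <= th.
  apply: le_trans th_ge; apply: ler_sum => i _; have [h1 h2] := c_bounds i.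
  apply: le_trans (_ : E (fun o => \sum_(j in A i) `|x i o * x j o|) <= _); last first.
    by rewrite Ex_sum.
  apply: le_trans (ler_norm _) _; rewrite normrM (ger0_norm h1).
  apply: le_trans (ler_piMl (normr_ge0 _) h2) _.
  apply: le_trans (ler_norm_Ex p0 _) _; apply: le_Ex => // o.
  rewrite normrM; apply: le_trans (ler_wpM2l (normr_ge0 _) (near_T i o)) _.
  by rewrite mulr_sumr; apply: ler_sum => j _; rewrite normrM.
have T2 : \sum_i c i * (E (x i) * E (To i)) <= bet * (2^-1 * E (fun o => T o ^+ 2) + 3 / 2).
  apply: le_trans (ler_norm _) _; apply: le_trans (ler_norm_sum _ _ _) _.
  apply: (@le_trans _ _ (\sum_i `|E (x i)| * (2^-1 * E (fun o => T o ^+ 2) + 3 / 2))); last first.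
    by rewrite -mulr_suml ler_wpM2r ?(means_le LD) //; lra.
  apply: ler_sum => i _; have [h1 h2] := c_bounds i.
  rewrite normrM (ger0_norm h1); apply: le_trans (ler_piMl (normr_ge0 _) h2) _.
  rewrite normrM ler_wpM2l //; apply: le_trans (ler_norm_Ex p0 _) _.
  rewrite -(Ex_cst p1 (3 / 2)) -ExZ -ExD; apply: le_Ex => // o.
  have := near1 i o; have := ler_normB (T o) (T o - To i o); rewrite opprB addrC subrK.
  have := sqr_ge0 (`|T o| - 1); rewrite -(real_normK (num_real (T o))); lra.
have H : bet * (2^-1 * E (fun o => T o ^+ 2) + 3 / 2) <=
    16^-1 * (2^-1 * E (fun o => T o ^+ 2) + 3 / 2).
  by rewrite ler_wpM2r ?(bet_small LD) //; lra.
have := th_ge0; lra.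
Qed.

Lemma S2T_moment : E (fun o => S o ^+ 2 * `|T o|) <= 51 * (1 + th).
Proof.
apply: (@le_trans _ _ (2^-1 * E (fun o => S o ^+ 4) + 2^-1 * E (fun o => T o ^+ 2))).
  rewrite -!ExZ -ExD; apply: le_Ex => // o; rewrite -(real_normK (num_real (T o))).
  have := sqr_ge0 (S o ^+ 2 - `|T o|); lra.
have := fourth_moment; have := T_second_moment; lra.
Qed.

Lemma ST_moment : E (fun o => `|S o| * `|T o|) <= 2 * (1 + th).
Proof.
apply: (@le_trans _ _ (2^-1 * E (fun o => S o ^+ 2) + 2^-1 * E (fun o => T o ^+ 2))).
  rewrite -!ExZ -ExD; apply: le_Ex => // o.
  rewrite -(real_normK (num_real (T o))) -(real_normK (num_real (S o))).
  have := sqr_ge0 (`|S o| - `|T o|); lra.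
have := second_moment LD; have := T_second_moment; have := th_ge0; lra.
Qed.

Variables (h : R) (n : nat).
Hypotheses (h0 : 0 < h) (hn : h * n%:R = 1) (hb : h <= b) (bs : b <= 336^-1).
Hypothesis grid : forall j o, exists2 m, (m <= n + n)%N & y j o = tau h n m.

Variables (z cz : R) (f : R -> R).
Hypothesis St : stein_solution z cz f.

Let W o := S o * rsq (U o).

Let local_concentration j :
  E (fun o => wxy j o * (`|W o - z| <= 336 * b + 3 / 2 * `|y j o|)%R%:R) <=
  400 * (336 * b * E (wxy j) + 3 / 2 * E (fun o => `|x j o| * y j o ^+ 2)) +
  1152 * near p x (B j) (wxy j).
Proof.
have y1 o := y_le1 LD j o.
have dy : dep (A j) (fun o => 336 * b + 3 / 2 * `|y j o|).
  by move=> o o' H; rewrite (dep_y H).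
have := concentration LD h0 hn hb bs grid (x_block j) (dep_wxy (i := j)) (wxy_ge0 j)
  dy _ _ z.
move=> H; apply: le_trans (H _ _) _ => [o|o|].
- by have := normr_ge0 (y j o); lra.
- by have := y1 o; have := bs; lra.
rewrite lerD2r ler_wpM2l // -!ExZ -ExD; apply: le_Ex => // o.
rewrite /wxy normrM -(real_normK (num_real (y j o))); lra.
Qed.

Let F s (u : R) (_ : Om) := rsq u * f (s * rsq u).

(** On the empty block every index is good and [near] vanishes, so only the bias and the cubes
    remain. *)
Let stein_expansion : `|E (fun o => W o * f (W o)) -
  E (fun o => \sum_j x j o * (F (S o) (U o) o - F (S o - y j o) (U o) o))| <=
  9 * bet + 144 * b.
Proof.
have d1 : dep finset.set0 (fun=> 1) by [].
have FM s u o : `|F s u o| <= 9.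
  rewrite /F normrM (ger0_norm (rsq_ge0 _)).
  apply: le_trans (_ : 3 / 2 * 6 <= _); last lra.
  by apply: ler_pM; rewrite ?rsq_ge0 ?rsq_le ?(stein_le St).
have FL s u u' o : `|F s u o - F s u' o| <= 9 * `|u - u'| * (1 + `|s|).
  have -> : F s u o - F s u' o = (rsq u - rsq u') * f (s * rsq u) +
     rsq u' * (f (s * rsq u) - f (s * rsq u')) by rewrite /F; ring.
  apply: le_trans (ler_normD _ _) _; rewrite normrM (normrM (rsq u')).
  rewrite (ger0_norm (rsq_ge0 _)); have l1 := rsq_lipschitz u u'.
  have l2 : `|rsq u - rsq u'| * `|f (s * rsq u)| <= 3 / 2 * `|u - u'| * 6.
    by apply: ler_pM => //; exact: (stein_le St).
  have l3 : rsq u' * `|f (s * rsq u) - f (s * rsq u')| <=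
      3 / 2 * (2 * (`|s| * (3 / 2 * `|u - u'|))).
    apply: ler_pM; rewrite ?rsq_ge0 ?rsq_le //.
    apply: le_trans (stein_lip St _ _) _; rewrite -mulrBr normrM.
    by rewrite ler_wpM2l // ler_wpM2l.
  have : 0 <= `|u - u'| * `|s| by rewrite mulr_ge0.
  have : 0 <= `|u - u'| by []. lra.
have dF s u : dep finset.set0 (F s u) by [].
have := expansion LD block_set0 d1 (fun _ => ler01) dF FM (ler0n R 9) FL.
rewrite (_ : near _ _ _ _ = 0); last first.
  rewrite /near (eq_Ex _ (g := fun=> 0)) ?Ex_cst // => o.
  by rewrite big_set0 mul0r mulr0.
have allgood : good A (finset.set0 : {set J}) =1 predT.
  by move=> j; rewrite /good finset.set0I eqxx.
rewrite (eq_Ex p (f := fun o => 1 * (9 * \sum_(j | _) _)) (g := fun=> 0)); last first.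
  move=> o; rewrite big1 ?mulr0 // => j.
  by rewrite allgood.
rewrite !Ex_cst // => H; apply: le_trans (le_trans _ H) _; last lra.
rewrite le_eqVlt; apply/orP; left; apply/eqP; congr (`|_ - _|).
  by apply: eq_Ex => o; rewrite /W /F; ring.
by apply: eq_Ex => o; rewrite mul1r; apply: eq_bigl => j; rewrite allgood.
Qed.

Let f' s := s * f s + (s <= z)%R%:R - cz.

Let xy_step j o : `|x j o * (F (S o) (U o) o - F (S o - y j o) (U o) o) -
    x j o * y j o * (rsq (U o) ^+ 2 * f' (W o))| <=
  27 / 8 * (3 * (`|x j o| * y j o ^+ 2 * (2 + `|S o|))) +
  9 * (wxy j o * (`|W o - z| <= 336 * b + 3 / 2 * `|y j o|)%R%:R).
Proof.
have g0 := rsq_ge0 (U o); have g1 := rsq_le (U o).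
have WE : (S o - y j o) * rsq (U o) = W o - y j o * rsq (U o).
  by rewrite /W; ring.
have := stein_taylor St (W o) (W o - y j o * rsq (U o)).
rewrite (_ : W o - (W o - y j o * rsq (U o)) = y j o * rsq (U o)); last by ring.
rewrite /F WE -/(W o) -/(f' (W o)) => H.
rewrite (_ : _ - _ = x j o * rsq (U o) * (f (W o) - f (W o - y j o * rsq (U o)) -
  y j o * rsq (U o) * f' (W o))); last by ring.
rewrite normrM (normrM (x j o)) (ger0_norm g0).
have xg0 : 0 <= `|x j o| * rsq (U o) by rewrite mulr_ge0.
apply: le_trans (ler_wpM2l xg0 H) _.
have WS : `|W o| <= 3 / 2 * `|S o|.
  by rewrite /W normrM (ger0_norm g0) mulrC ler_wpM2r.
have ind : ((`|W o - z| <= `|y j o * rsq (U o)|)%R%:R : R) <=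
    (`|W o - z| <= 336 * b + 3 / 2 * `|y j o|)%R%:R.
  case: (lerP _ `|y j o * rsq (U o)|) => [hW|_]; last by [].
  have -> // : `|W o - z| <= 336 * b + 3 / 2 * `|y j o|.
  apply: le_trans hW _; rewrite normrM (ger0_norm g0) mulrC.
  have := ler_wpM2r (normr_ge0 (y j o)) g1; have := b0; lra.
rewrite mulrDr; apply: lerD.
  rewrite normrM (ger0_norm g0) -(real_normK (num_real (y j o))).
  set yy := `|y j o|; set xx := `|x j o|; set g := rsq (U o) in g0 g1 *.
  have xx0 : 0 <= xx by exact: normr_ge0.
  have yy0 : 0 <= yy by exact: normr_ge0.
  have s0 : 0 <= `|S o| by [].
  have xy0 : 0 <= xx * yy ^+ 2 by rewrite mulr_ge0 // exprn_ge0.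
  have g3 : g ^+ 3 <= (3 / 2) ^+ 3 by rewrite ler_pXn2r ?nnegrE //; lra.
  have H2 : 0 <= xx * yy ^+ 2 * (6 + 2 * `|W o|).
    by rewrite mulr_ge0 // addr_ge0 ?mulr_ge0.
  have H3 := ler_wpM2r H2 g3.
  have H4 := ler_wpM2l xy0 WS; lra.
set i1 : R := (_ <= `|y j o * rsq (U o)|)%R%:R in ind *.
set i2 : R := (_ <= 336 * b + _)%R%:R in ind *.
rewrite normrM (ger0_norm g0) /wxy normrM.
set yy := `|y j o|; set xx := `|x j o|; set g := rsq (U o) in g0 g1 *.
  have xx0 : 0 <= xx by exact: normr_ge0.
  have yy0 : 0 <= yy by exact: normr_ge0.
have xy0 : 0 <= xx * yy by rewrite mulr_ge0.
have g2 : g ^+ 2 <= (3 / 2) ^+ 2 by rewrite ler_pXn2r ?nnegrE //; lra.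
have i20 : 0 <= i2 by rewrite /i2 ler0n.
have i10 : 0 <= i1 by rewrite /i1 ler0n.
have h1 := ler_wpM2l xy0 ind.
have h2 := ler_wpM2r (mulr_ge0 xy0 i10) g2.
lra.
Qed.

(** The main term of the expansion is E[U g(U)^2 f'(W)]. As U g(U)^2 is 1 up to second order, it is
    close to E f'(W), and Stein's equation leaves the difference of the distribution functions. *)
Theorem kolmogorov : `|E (fun o => (W o <= z)%R%:R) - cz| <=
  2000 * (1000 * (b * (1 + th))) + 25 * bet.
Proof.
have th0 := th_ge0; have bt0 : 0 <= b * th by rewrite mulr_ge0 // ltW.
have taylor : `|E (fun o => \sum_j x j o * (F (S o) (U o) o - F (S o - y j o) (U o) o)) -
   E (fun o => U o * (rsq (U o) ^+ 2 * f' (W o)))| <=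
   27 / 8 * (3 * \sum_j E (fun o => `|x j o| * y j o ^+ 2 * (2 + `|S o|))) +
   9 * \sum_j E (fun o => wxy j o * (`|W o - z| <= 336 * b + 3 / 2 * `|y j o|)%R%:R).
  rewrite -ExB; apply: le_trans (ler_norm_Ex p0 _) _.
  rewrite -!Ex_sum -!ExZ -ExD; apply: le_Ex => // o.
  rewrite {1}/variance_sum_local mulr_suml -sumrB; apply: le_trans (ler_norm_sum _ _ _) _.
  by rewrite !mulr_sumr -big_split /=; apply: ler_sum => j _; exact: xy_step.
have conc : \sum_j E (fun o => wxy j o * (`|W o - z| <= 336 * b + 3 / 2 * `|y j o|)%R%:R) <=
    400 * (336 * b * th + 3 / 2 * b) + 1152 * (8 * b).
  apply: le_trans (ler_sum _ (fun j _ => local_concentration j)) _.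
  rewrite big_split /= -!mulr_sumr big_split /= -!mulr_sumr.
  have h1 : 336 * b * \sum_j E (wxy j) <= 336 * b * th.
    by rewrite ler_wpM2l ?wxy_le_th // mulr_ge0 // ltW.
  have h2 := E_xy2 LD; have h3 := near_sum; lra.
have defect : `|E (fun o => U o * (rsq (U o) ^+ 2 * f' (W o))) - E (fun o => f' (W o))| <=
    8 * (2 * b + 2 * bet).
  rewrite -ExB; apply: le_trans (ler_norm_Ex p0 _) _.
  apply: le_trans (_ : 8 * E (fun o => (U o - 1) ^+ 2) <= _); last first.
    by rewrite ler_wpM2l // (U_concentration LD).
  rewrite -ExZ; apply: le_Ex => // o.
  rewrite (_ : _ - _ = - (1 - U o * rsq (U o) ^+ 2) * f' (W o)); last by ring.
  rewrite normrM normrN.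
  have := ler_pM (normr_ge0 _) (normr_ge0 _) (rsq_defect (U o)) (stein_deriv_le St (W o)).
  lra.
have fE : E (fun o => f' (W o)) =
    E (fun o => W o * f (W o)) + E (fun o => (W o <= z)%R%:R) - cz.
  by rewrite -[X in _ - X](Ex_cst p1 cz) -ExD -ExB.
have := xy2_S; move: stein_expansion taylor defect.
rewrite fE !ler_norml => /andP[a1 a2] /andP[c1 c2] /andP[d1 d2] xs.
have := b0; have := bet0 LD; move=> *; apply/andP; split; lra.
Qed.

End Kolmogorov.

From mathcomp Require Import zify.
From mathcomp Require Import all_classical all_reals all_analysis.
From mathcomp Require Import measurable_realfun.
Import numFieldNormedType.Exports.
Local Open Scope classical_set_scope.
Local Open Scope ring_scope.

(** * Stein's equation for the normal law *)

Section Normal.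
Variable R : realType.
Implicit Types x z : R.
Local Notation p := (normal_pdf (0 : R) 1).

Lemma pdfE x : p x = normal_peak 1 * expR (- x ^+ 2 / 2).
Proof. by rewrite normal_pdfE ?oner_eq0 // /normal_fun subr0 expr1n. Qed.

Lemma pdf_gt0 x : 0 < p x.
Proof. by rewrite pdfE mulr_gt0 ?normal_peak_gt0 ?oner_eq0 ?expR_gt0. Qed.

Lemma is_derive_pdf x : is_derive x 1 p (- x * p x).
Proof.
have -> : p = (fun t => normal_peak 1 * expR (- t ^+ 2 / 2)).
  by apply/funext => t; rewrite pdfE.
apply: is_derive_eq.
by rewrite /GRing.scale /=; field.
Qed.

Let sqrt_2pi : 1 <= Num.sqrt (pi *+ 2 : R) /\ Num.sqrt (pi *+ 2 : R) <= 3.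
Proof.
have h1 := pihalf_ge1 R; have h2 := pihalf_lt2 R; split.
  by rewrite -{1}(sqrtr1 R); apply: ler_wsqrtr; lra.
apply: le_trans (ler_wsqrtr (_ : _ <= 3 ^+ 2)) _; first lra.
by rewrite sqrtr_sqr ger0_norm.
Qed.

Lemma peak_ge : 3^-1 <= normal_peak (1 : R).
Proof.
have [h1 h2] := sqrt_2pi.
by rewrite /normal_peak expr1n mul1r lef_pV2 ?posrE //; lra.
Qed.

Lemma peak_le : normal_peak (1 : R) <= 1.
Proof.
have [h1 h2] := sqrt_2pi.
by rewrite /normal_peak expr1n mul1r invf_le1 //; lra.
Qed.

Lemma pdf_le1 x : p x <= 1.
Proof. exact: le_trans (normal_pdf_ub _ _ (oner_neq0 _)) peak_le. Qed.

Lemma pdf_ge x : `|x| <= 1 -> 6^-1 <= p x.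
Proof.
move=> x1; have x2 : x ^+ 2 <= 1 by rewrite -(real_normK (num_real x)) expr_le1.
have h : 2^-1 <= expR (- x ^+ 2 / 2) by apply: le_trans (expR_ge1Dx _); lra.
by rewrite pdfE; have := peak_ge; nra.
Qed.

Lemma is_derive_Phi x : is_derive x 1 (@Phi R) (p x).
Proof.
have [] := @continuous_FTC1 R p -oo%O x (x + 1) _ _ _ _.
- by rewrite ltrDl.
- apply: integrableS (integrable_normal_pdf 0 1) => //.
- by rewrite ltNyr.
- apply: (@continuous_normal_pdf R 0 1 _ x). exact: oner_neq0.
move=> d1 d2; split; first exact: d1.
by rewrite -derive1E; exact: d2.
Qed.

Lemma Phi_ge0 x : 0 <= Phi x.
Proof. by rewrite fine_ge0. Qed.

Lemma Phi_le1 x : Phi x <= 1.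
Proof.
rewrite -lee_fin fineK ?fin_num_measure //; exact: probability_le1.
Qed.

(** The identity is a normal variable on the line; the limits of [Phi] at infinity are those of its
    distribution function. *)
Let X : measurableTypeR R -> R := idfun.
Let mX : measurable_fun setT X. Proof. exact: measurable_id. Qed.
HB.instance Definition _ := @isMeasurableFun.Build _ _ _ _ X mX.

Lemma Phi_near1 x e : 0 < e -> exists2 t, x < t & 1 - e < Phi t.
Proof.
move=> e0.
have /fine_cvgP[_ H] := cvg_cdfy1 (X : {RV (normal_prob 0 1 : probability _ R) >-> R}).
have {}H : Phi t @[t --> +oo] --> (1 : R) by [].
have : \forall t \near +oo, x < t /\ 1 - e < Phi t.
  near=> t; split; near: t; first exact/nbhs_pinfty_gt/num_real.
  apply: (cvgr_gt (1 : R)) => //; lra.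
by move=> /filter_ex[t []]; exists t.
Unshelve. all: by end_near. Qed.

Lemma Phi_near0 x e : 0 < e -> exists2 t, t < x & Phi t < e.
Proof.
move=> e0.
have /fine_cvgP[_ H] := cvg_cdfNy0 (X : {RV (normal_prob 0 1 : probability _ R) >-> R}).
have {}H : Phi t @[t --> -oo] --> (0 : R) by [].
have : \forall t \near -oo, t < x /\ Phi t < e.
  near=> t; split; near: t; first exact/nbhs_ninfty_lt/num_real.
  exact: (cvgr_lt (0 : R)).
by move=> /filter_ex[t []]; exists t.
Unshelve. all: by end_near. Qed.

Lemma is_derive_cont (f df : R -> R) (A : set R) :
  (forall t : R, is_derive t 1 f (df t)) -> {within A, continuous f}.
Proof.
move=> fd; apply: continuous_subspaceT => t.
apply/differentiable_continuous/derivable1_diffP.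
by case: (fd t).
Qed.

Lemma Phi_mvt (s t : R) : s < t -> exists2 c, s < c < t & Phi t - Phi s = p c * (t - s).
Proof.
move=> st; have [c] := MVT st (fun c _ => is_derive_Phi c) (is_derive_cont is_derive_Phi).
by rewrite in_itv /=; exists c.
Qed.

Lemma Phi_mono (s t : R) : s <= t -> Phi s <= Phi t.
Proof.
rewrite le_eqVlt => /predU1P[->//|st]; have [c _ E] := Phi_mvt st.
by rewrite -subr_ge0 E mulr_ge0 ?(ltW (pdf_gt0 c)) // subr_ge0 ltW.
Qed.

Lemma Phi_lipschitz (s t : R) : s <= t -> Phi t <= Phi s + (t - s).
Proof.
rewrite le_eqVlt => /predU1P[->|st]; first by rewrite subrr addr0.
have [c _ E] := Phi_mvt st; rewrite -lerBlDl E ler_piMl ?pdf_le1 //.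
by rewrite subr_ge0 ltW.
Qed.

(** Its derivative -p(x) / x^2 is negative on each half-line, and it tends to 1 at plus infinity and
    to 0 at minus infinity. Comparison with a far point gives the two Mills inequalities. *)
Let mills x : R := p x / x + Phi x.

Let is_derive_mills x : x != 0 -> is_derive x 1 mills (- p x / x ^+ 2).
Proof.
move=> x0; rewrite /mills.
have dp := is_derive_pdf x; have dP := is_derive_Phi x.
have dV := is_deriveV x0 (is_derive_id x (1 : R)).
apply: is_derive_eq; rewrite /GRing.scale /=; field; exact: x0.
Qed.

Let mills_mvt (s t : R) : s < t -> (0 < s) || (t < 0) ->
  exists2 c, s < c < t & mills t - mills s = - p c / c ^+ 2 * (t - s).
Proof.
move=> st sgn; have nz c : s <= c <= t -> c != 0.
  move=> /andP[sc ct]; case/orP: sgn => h; first by rewrite gt_eqF // (lt_le_trans h).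
  by rewrite lt_eqF // (le_lt_trans ct).
have [||c] := @MVT R mills (fun c => - p c / c ^+ 2) s t st.
- move=> c; rewrite in_itv /= => /andP[sc ct]; apply: is_derive_mills.
  by rewrite nz // !ltW.
- apply: derivable_within_continuous => c; rewrite in_itv /= => cst.
  by case: (is_derive_mills (nz _ cst)).
by rewrite in_itv /=; exists c.
Qed.

Lemma mills_right x : 0 < x -> x * (1 - Phi x) <= p x.
Proof.
move=> x0; rewrite mulrC -ler_pdivlMr //.
suff : 1 <= mills x by rewrite /mills; lra.
apply/ler_addgt0Pr => e e0; have [t xt Pt] := Phi_near1 x e0.
have [|c _ E] := mills_mvt xt; first by rewrite x0.
have : mills t <= mills x.
  rewrite -subr_le0 E mulNr mulNr oppr_le0 mulr_ge0 ?divr_ge0 ?sqr_ge0 ?(ltW (pdf_gt0 c)) //.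
  by rewrite subr_ge0 ltW.
have : 0 <= p t / t by rewrite divr_ge0 ?(ltW (pdf_gt0 t)) // ltW // (lt_trans x0).
rewrite /mills; lra.
Qed.

Lemma mills_left x : x < 0 -> - x * Phi x <= p x.
Proof.
move=> x0; have nx0 : 0 < - x by rewrite oppr_gt0.
rewrite mulrC -ler_pdivlMr // invrN mulrN.
suff : mills x <= 0 by rewrite /mills; lra.
apply/ler_addgt0Pr => e e0; have [t xt Pt] := Phi_near0 x e0.
have [|c _ E] := mills_mvt xt; first by rewrite x0 orbT.
have : mills x <= mills t.
  rewrite -subr_le0 E mulNr mulNr oppr_le0 mulr_ge0 ?divr_ge0 ?sqr_ge0 ?(ltW (pdf_gt0 c)) //.
  by rewrite subr_ge0 ltW.
have : p t / t <= 0.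
  by rewrite mulr_ge0_le0 ?(ltW (pdf_gt0 t)) // invr_le0 ltW // (lt_trans xt).
rewrite /mills; lra.
Qed.

(** The envelope of the Stein solutions over all z. The Mills inequalities bound it by 1 / |x|, and
    for |x| < 1 the density is at least 1/6. *)
Let ratio x : R := Phi x * (1 - Phi x) / p x.

Let ratio_bound x : 0 <= ratio x /\ `|x| * ratio x <= 1.
Proof.
have px := pdf_gt0 x; have P0 := Phi_ge0 x; have P1 := Phi_le1 x.
have Q0 : 0 <= 1 - Phi x by rewrite subr_ge0.
split; first by rewrite !mulr_ge0 // invr_ge0 ltW.
rewrite /ratio mulrA ler_pdivrMr // mul1r.
have [x0|x0|->] := ltgtP x 0.
- rewrite mulrA ltr0_norm //; apply: le_trans (mills_left x0).
  by rewrite ler_piMr ?mulr_ge0 ?oppr_ge0 ?(ltW x0) //; lra.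
- rewrite mulrCA gtr0_norm //; apply: le_trans (mills_right x0).
  by rewrite ler_piMl ?mulr_ge0 ?(ltW x0).
- by rewrite normr0 mul0r ltW // pdf_gt0.
Qed.

Let ratio_le6 x : ratio x <= 6.
Proof.
have [r0 r1] := ratio_bound x; have [x1|x1] := lerP 1 `|x|.
  by have := ler_wpM2r r0 x1; lra.
have h := pdf_ge (ltW x1); rewrite /ratio ler_pdivrMr ?pdf_gt0 //.
have P0 := Phi_ge0 x; have P1 := Phi_le1 x; nra.
Qed.

Variable z : R.

(** Each branch is differentiable on the whole line, so the mean value theorem applies up to z,
    where the branches agree. *)
Let fm (w : R) : R := (1 - Phi z) * (Phi w / p w).
Let fp (w : R) : R := Phi z * ((1 - Phi w) / p w).
Let f (w : R) : R := if w <= z then fm w else fp w.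

Let is_derive_pV (w : R) : is_derive w 1 (fun t => (p t)^-1) (w / p w).
Proof.
have dp := is_derive_pdf w; have pn : p w != 0 by rewrite gt_eqF // pdf_gt0.
apply: (is_derive_eq (is_deriveV pn dp)).
by rewrite /GRing.scale /=; field.
Qed.

Let is_derive_fm (w : R) : is_derive w 1 fm (w * fm w + (1 - Phi z)).
Proof.
have pn : p w != 0 by rewrite gt_eqF // pdf_gt0.
have dV := is_derive_pV w; have dP := is_derive_Phi w.
by apply: is_derive_eq; rewrite /fm /GRing.scale /=; field.
Qed.

Let is_derive_fp (w : R) : is_derive w 1 fp (w * fp w - Phi z).
Proof.
have pn : p w != 0 by rewrite gt_eqF // pdf_gt0.
have dV := is_derive_pV w; have dP := is_derive_Phi w.
by apply: is_derive_eq; rewrite /fp /GRing.scale /=; field.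
Qed.

Let f_bound w : `|f w| <= ratio w.
Proof.
have pw := pdf_gt0 w; have P0 := Phi_ge0 w; have P1 := Phi_le1 w.
have Pz0 := Phi_ge0 z; have Pz1 := Phi_le1 z.
have pV : 0 <= (p w)^-1 by rewrite invr_ge0 ltW.
rewrite /f /ratio; case: (leP w z) => [/Phi_mono h|/ltW/Phi_mono h].
  rewrite ger0_norm /fm; last by rewrite mulr_ge0 ?divr_ge0 //; lra.
  by rewrite mulrA ler_wpM2r // mulrC ler_wpM2l //; lra.
rewrite ger0_norm /fp; last by rewrite mulr_ge0 ?divr_ge0 //; lra.
by rewrite mulrA ler_wpM2r // ler_wpM2r //; lra.
Qed.

Let f_le6 w : `|f w| <= 6.
Proof. exact: le_trans (f_bound w) (ratio_le6 w). Qed.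

Let f' (w : R) : R := w * f w + (w <= z)%R%:R - Phi z.

Let f'_le2 w : `|f' w| <= 2.
Proof.
have [r0 r1] := ratio_bound w.
have h1 : `|w * f w| <= 1.
  by rewrite normrM; apply: le_trans r1; rewrite ler_wpM2l ?f_bound.
have Pz0 := Phi_ge0 z; have Pz1 := Phi_le1 z.
have h2 : `|(w <= z)%R%:R - Phi z| <= 1.
  by rewrite ler_norml; case: (w <= z) => /=; apply/andP; split; lra.
rewrite /f' -addrA; apply: le_trans (ler_normD _ _) _; lra.
Qed.

Let f_mvt_left (s t : R) : s < t -> t <= z ->
  exists2 c, s < c < t & f t - f s = f' c * (t - s).
Proof.
move=> st tz; have [c] := MVT st (fun c _ => is_derive_fm c) (is_derive_cont is_derive_fm).
rewrite in_itv /= => /andP[sc ct]; exists c; first by rewrite sc.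
by rewrite /f' /f tz (le_trans (ltW st) tz) (le_trans (ltW ct) tz) -addrA.
Qed.

Let f_z w : z <= w -> f w = fp w.
Proof.
rewrite le_eqVlt /f => /predU1P[<-|zw]; last by rewrite leNgt zw.
by rewrite lexx /fm /fp; ring.
Qed.

Let f_mvt_right (s t : R) : s < t -> z <= s ->
  exists2 c, s < c < t & f t - f s = f' c * (t - s).
Proof.
move=> st zs; have [c] := MVT st (fun c _ => is_derive_fp c) (is_derive_cont is_derive_fp).
rewrite in_itv /= => /andP[sc ct]; exists c; first by rewrite sc.
have zc := le_lt_trans zs sc.
rewrite /f' (f_z (le_trans zs (ltW st))) (f_z zs) (f_z (ltW zc)).
by rewrite (leNgt c) zc /= addr0.
Qed.

Let f_lip_lt (s t : R) : s < t -> `|f t - f s| <= 2 * (t - s).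
Proof.
have lip u v : u < v -> (v <= z) || (z <= u) -> `|f v - f u| <= 2 * (v - u).
  move=> uv side; have [c _ ->] : exists2 c, u < c < v & f v - f u = f' c * (v - u).
    by case/orP: side; [exact: f_mvt_left|exact: f_mvt_right].
  by rewrite normrM (gtr0_norm (_ : 0 < v - u)) ?subr_gt0 // ler_wpM2r // subr_ge0 ltW.
move=> st; have [tz|zt] := leP t z; first by rewrite lip // tz.
have [zs|sz] := leP z s; first by rewrite lip // zs orbT.
have h1 := lip s z sz; have h2 := lip z t zt.
rewrite lexx orbT in h2; rewrite lexx in h1.
apply: le_trans (ler_distD (f z) _ _) _.
by have := h1 isT; have := h2 isT; lra.
Qed.

Let f_lip (s t : R) : `|f s - f t| <= 2 * `|s - t|.
Proof.
have [st|ts|->] := ltgtP s t.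
- by rewrite distrC (distrC s) (gtr0_norm (_ : 0 < t - s)) ?subr_gt0 // f_lip_lt.
- by rewrite (gtr0_norm (_ : 0 < s - t)) ?subr_gt0 // f_lip_lt.
- by rewrite !subrr !normr0 mulr0.
Qed.

(** The intermediate point stays on the side of s, so that the indicators in f' cancel in the Taylor
    remainder. *)
Let f_mvt (s t : R) : (s <= z) = (t <= z) ->
  exists c, [/\ `|c - s| <= `|s - t|, (c <= z) = (s <= z) & f s - f t = f' c * (s - t)].
Proof.
move=> side; have [st|ts|->] := ltgtP s t; last first.
- by exists t; rewrite !subrr mulr0 normr0; split.
- have [c /andP[tc cs] E] : exists2 c, t < c < s & f s - f t = f' c * (s - t).
    have [sz|zs] := leP s z; first exact: f_mvt_left.
    by apply: f_mvt_right => //; rewrite ltW // ltNge -side -ltNge.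
  exists c; split => //; first by rewrite distrC !gtr0_norm; lra.
  have [sz|zs] := leP s z; first by rewrite (le_trans (ltW cs)).
  by apply/negbTE; rewrite -ltNge (le_lt_trans _ tc) // ltW // ltNge -side -ltNge.
- have [c /andP[sc ct] E] : exists2 c, s < c < t & f t - f s = f' c * (t - s).
    have [sz|zs] := leP s z; first by apply: f_mvt_left => //; rewrite -side.
    by apply: f_mvt_right => //; rewrite ltW.
  exists c; split => //; [|..|by rewrite -opprB E -mulrN opprB].
    by rewrite (distrC s) !gtr0_norm; lra.
  have [sz|zs] := leP s z; last by apply/negbTE; rewrite -ltNge (lt_trans zs).
  by rewrite (le_trans (ltW ct)) // -side.
Qed.

(** If z separates s and t then |s - z| <= |s - t|, and the Lipschitz bound together with |f'| <= 2
    gives the jump term. Otherwise f' varies between s and the intermediate point at a rate of at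
    most 6 + 2|s|. *)
Let f_taylor (s t : R) : `|f s - f t - (s - t) * f' s| <=
  `|s - t| ^+ 2 * (6 + 2 * `|s|) + 4 * `|s - t| * (`|s - z| <= `|s - t|)%R%:R.
Proof.
have d0 : 0 <= `|s - t| by [].
have [/f_mvt[c [cs cz ->]]|ne] := eqVneq (s <= z) (t <= z).
  apply: ler_wpDr; first by rewrite !mulr_ge0.
  rewrite (_ : _ - _ = (s - t) * (f' c - f' s)); last by ring.
  rewrite normrM expr2 -mulrA ler_wpM2l //.
  rewrite (_ : f' c - f' s = (c - s) * f c + s * (f c - f s)); last first.
    by rewrite /f' cz; ring.
  apply: le_trans (ler_normD _ _) _; rewrite !normrM.
  have h1 : `|c - s| * `|f c| <= `|s - t| * 6 by apply: ler_pM.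
  have h2 : `|s| * `|f c - f s| <= `|s| * (2 * `|s - t|).
    by rewrite ler_wpM2l //; apply: le_trans (f_lip _ _) _; rewrite ler_wpM2l.
  lra.
have -> : (`|s - z| <= `|s - t|) = true.
  move: ne; case: (leP s z) => sz; case: (leP t z) => tz // _.
    by rewrite !ler0_norm; lra.
  by rewrite !ger0_norm; lra.
rewrite mulr1; apply: ler_wpDl; first by rewrite mulr_ge0 ?sqr_ge0 // addr_ge0 ?mulr_ge0.
apply: le_trans (ler_normB _ _) _; rewrite normrM.
have := f_lip s t; have := ler_wpM2l d0 (f'_le2 s); lra.
Qed.

Lemma stein_solution_normal : exists f : R -> R, stein_solution z (Phi z) f.
Proof. by exists f; split; [exact: f_le6|exact: f_lip|exact: f'_le2|exact: f_taylor]. Qed.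

End Normal.

(** * Truncation and discretization *)

Section IndependentProduct.
Context d (T : measurableType d) (R : realType) (P : probability T R).
Variables X Y : {RV P >-> R}.
Hypothesis XY : forall A B : set R, measurable A -> measurable B ->
  P (X @^-1` A `&` Y @^-1` B) = (P (X @^-1` A) * P (Y @^-1` B))%E.
Hypotheses (iX : P.-integrable setT (EFin \o X)).
Hypotheses (iXY : P.-integrable setT (EFin \o (fun w => X w * Y w))).
Hypothesis EX0 : (\int[P]_w (X w)%:E = 0)%E.

Let phi w : R * R := (X w, Y w).

Let mphi : measurable_fun setT phi.
Proof. by apply: measurable_fun_pair; exact: measurable_funPT. Qed.

Let mu1 : probability (R) R := distribution P X.
Let mu2 : probability (R) R := distribution P Y.

Let f : R * R -> \bar R := fun z => (z.1 * z.2)%:E.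

Let mf : measurable_fun [set: R * R] f.
Proof.
apply/measurable_EFinP; apply: measurable_funM; first exact: measurable_fst.
exact: measurable_snd.
Qed.

Let joint A : measurable A -> (mu1 \x mu2)%E A = pushforward P phi A.
Proof.
by move=> mA; apply: product_measure_unique => // B C; exact: XY.
Qed.

(** The joint law agrees with the product of the laws on rectangles, hence everywhere, and Fubini's
    theorem integrates X to 0 first. *)
Lemma integral_indep_product0 : (\int[P]_w (X w * Y w)%:E = 0)%E.
Proof.
have -> : (\int[P]_w (X w * Y w)%:E = \int[pushforward P phi]_z f z)%E.
  by rewrite integral_pushforward.
rewrite (eq_measure_integral (mu1 \x mu2)%E) => [|A mA _]; last exact/esym/joint.
have intf : (mu1 \x mu2)%E.-integrable setT f.
  have /integrableP[_ fin] : (pushforward P phi).-integrable setT f.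
    by apply: integrable_pushforward.
  apply/integrableP; split; first exact: mf.
  by rewrite (eq_measure_integral (pushforward P phi)) => [//|A mA _]; exact: joint.
rewrite -integral21_prod_meas1 // integral0_eq // => y _ /=.
rewrite /fubini_G /f /= (eq_integral (fun x => (y%:E * x%:E)%E)); last first.
  by move=> x _; rewrite -EFinM mulrC.
rewrite integralZl //; last first.
  by apply: integrable_pushforward => //; exact: EFin_measurable.
by rewrite integral_distribution // EX0 mule0.
Qed.
End IndependentProduct.

(** * Expectations under P and under the law of a finite-valued code *)

Section RealExpectation.
Context d (T : measurableType d) (R : realType) (P : probability T R).
Implicit Types f g : T -> R.

Definition intg f := P.-integrable setT (EFin \o f).
Definition EP f : R := \int[P]_w f w.

Lemma EP_fin f : intg f -> (\int[P]_w (f w)%:E = (EP f)%:E)%E.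
Proof. by move=> If; rewrite /EP /Rintegral fineK //; exact: integrable_fin_num. Qed.

Lemma intg_measurable f : intg f -> measurable_fun setT f.
Proof. by move=> /integrableP[/measurable_EFinP]. Qed.

Lemma intgD f g : intg f -> intg g -> intg (fun w => f w + g w).
Proof. exact: integrableD. Qed.

Lemma intgB f g : intg f -> intg g -> intg (fun w => f w - g w).
Proof. exact: integrableB. Qed.

Lemma intgZ c f : intg f -> intg (fun w => c * f w).
Proof. exact: integrableZl. Qed.

Lemma intg_abs f : intg f -> intg (fun w => `|f w|).
Proof. by move=> If; have := integrable_abse If. Qed.

Lemma intg_sum (I : Type) (r : seq I) (Q : pred I) (f : I -> T -> R) :
  (forall i, Q i -> intg (f i)) -> intg (fun w => \sum_(i <- r | Q i) f i w).
Proof.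
move=> If; rewrite /intg (_ : _ \o _ = fun w => (\sum_(i <- r | Q i) (f i w)%:E)%E).
  exact: integrable_sum.
by apply/funext => w /=; rewrite sumEFin.
Qed.

Lemma intg_cst c : intg (fun=> c).
Proof. by apply: finite_measure_integrable_cst. Qed.

Lemma intg_le f g : measurable_fun setT f -> (forall w, `|f w| <= g w) ->
  intg g -> intg f.
Proof.
move=> mf fg Ig; apply: le_integrable Ig => //; first exact/measurable_EFinP.
by move=> w _ /=; rewrite lee_fin (le_trans (fg w)) ?ler_norm.
Qed.

Lemma EPD f g : intg f -> intg g -> EP (fun w => f w + g w) = EP f + EP g.
Proof. exact: RintegralD. Qed.

Lemma EPB f g : intg f -> intg g -> EP (fun w => f w - g w) = EP f - EP g.
Proof. exact: RintegralB. Qed.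

Lemma EPZ c f : intg f -> EP (fun w => c * f w) = c * EP f.
Proof. by move=> If; rewrite /EP RintegralZl. Qed.

Lemma EP_cst c : EP (fun=> c) = c.
Proof. by rewrite /EP Rintegral_cst // [X in fine X](@probability_setT _ _ _ P) mulr1. Qed.

Lemma EP_sum (I : Type) (r : seq I) (Q : pred I) (f : I -> T -> R) :
  (forall i, intg (f i)) ->
  EP (fun w => \sum_(i <- r | Q i) f i w) = \sum_(i <- r | Q i) EP (f i).
Proof.
move=> If; rewrite /EP /Rintegral.
under eq_integral => w _ do rewrite -sumEFin.
rewrite integral_sum //= (eq_bigr (fun i => (EP (f i))%:E)) => [|i _].
  by rewrite sumEFin.
exact: EP_fin.
Qed.

Lemma EP_le f g : intg f -> intg g -> (forall w, f w <= g w) -> EP f <= EP g.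
Proof. by move=> If Ig fg; apply: le_Rintegral. Qed.

Lemma EP_ge0 f : (forall w, 0 <= f w) -> 0 <= EP f.
Proof. by move=> f0; apply: Rintegral_ge0. Qed.

Lemma EP_norm f : intg f -> `|EP f| <= EP (fun w => `|f w|).
Proof. by move=> If; apply: le_normr_Rintegral. Qed.

Lemma expectationE f : fine ('E_P[f]) = EP f.
Proof. by rewrite unlock. Qed.

Section Coding.
Variables (Om : finType) (code : T -> Om).
Hypothesis mcode : forall v, measurable (code @^-1` [set v]).

Definition law v : R := fine (P (code @^-1` [set v])).

Let decomp (u : Om -> R) w : u (code w) = \sum_v u v * \1_(code @^-1` [set v]) w.
Proof.
rewrite (bigD1 (code w)) //= big1 ?addr0 => [|v vw].
  by rewrite indicE mem_set // mulr1.
rewrite indicE memNset ?mulr0 //= => E; by rewrite E eqxx in vw.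
Qed.

Let intg_indic v : intg (\1_(code @^-1` [set v])).
Proof. exact: integrable_indic. Qed.

Let EP_indic v : EP (\1_(code @^-1` [set v])) = law v.
Proof. by rewrite /EP /Rintegral integral_indic // setIT. Qed.

Lemma intg_code u : intg (fun w => u (code w)).
Proof.
rewrite (_ : (fun w => u (code w)) =
    fun w => \sum_v u v * \1_(code @^-1` [set v]) w); last exact/funext/decomp.
by apply: intg_sum => v _; apply: intgZ.
Qed.

Lemma EP_code u : EP (fun w => u (code w)) = Ex law u.
Proof.
rewrite (_ : (fun w => u (code w)) =
    fun w => \sum_v u v * \1_(code @^-1` [set v]) w); last exact/funext/decomp.
rewrite EP_sum => [|v]; last exact: intgZ.
by apply: eq_bigr => v _; rewrite EPZ // EP_indic mulrC.
Qed.

Lemma law_ge0 v : 0 <= law v.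
Proof. exact: fine_ge0. Qed.

Lemma law_sum1 : \sum_v law v = 1.
Proof.
have := EP_code (fun=> 1); rewrite EP_cst /Ex => ->.
by apply: eq_bigr => v _; rewrite mulr1.
Qed.

Lemma measurable_code (Q : pred Om) : measurable (code @^-1` [set v | Q v]).
Proof.
rewrite (_ : _ @^-1` _ = \big[setU/set0]_(v | Q v) (code @^-1` [set v])).
  exact: bigsetU_measurable.
rewrite -bigcup_seq_cond; apply/seteqP; split => w /=.
  by move=> Qw; exists (code w) => //=; rewrite mem_index_enum.
by move=> [v /andP[_ Qv] /= ->].
Qed.

Lemma law_event (Q : pred Om) :
  P (code @^-1` [set v | Q v]) = (Ex law (fun v => (Q v)%:R))%:E.
Proof.
rewrite -(EP_code (fun v => (Q v)%:R)) -(EP_fin (intg_code (fun v => (Q v)%:R))).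
rewrite -[X in P X]setIT -integral_indic //; last exact: measurable_code.
apply: eq_integral => w _; rewrite indicE.
suff -> : (w \in code @^-1` [set v | Q v]) = Q (code w) by [].
by apply/idP/idP => [/set_mem|Qw]; [|exact: mem_set].
Qed.

End Coding.
End RealExpectation.

(** * Rounding to the grid *)

Section Rounding.
Variables (R : realType) (n : nat).
Hypothesis n0 : (0 < n)%N.
Let h : R := n%:R^-1.

(** Rounding towards 0 on both sides never increases absolute values, so that absolute moments and
    the bound 1/k carry over without a rounding error. *)
Definition idx (u : R) : nat :=
  if 0 <= u then (n + Num.trunc (u * n%:R))%N else (n - Num.trunc (- u * n%:R))%N.

Let nR0 : 0 < n%:R :> R. Proof. by rewrite ltr0n. Qed.

Let trunc_bounds (u : R) : 0 <= u ->
  h * (Num.trunc (u * n%:R))%:R <= u /\ u - h <= h * (Num.trunc (u * n%:R))%:R.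
Proof.
move=> u0; have un0 : 0 <= u * n%:R by rewrite mulr_ge0 // ltW.
have /andP[h1 h2] := truncn_itv un0.
have hp : 0 <= h by rewrite invr_ge0 ltW.
have E : h * (u * n%:R) = u by rewrite /h (mulrC u) mulKf ?gt_eqF.
have := ler_wpM2l hp h1; have := ler_wpM2l hp (ltW h2).
by rewrite E -natr1 mulrDr mulr1; split; lra.
Qed.

Let trunc_le (u : R) : 0 <= u -> u <= 1 -> (Num.trunc (u * n%:R) <= n)%N.
Proof.
move=> u0 u1; rewrite truncn_le_nat; apply: le_lt_trans (_ : n%:R < _).
  by rewrite ler_piMl // ltW.
by rewrite ltr_nat.
Qed.

Lemma idx_le u : `|u| <= 1 -> (idx u <= n + n)%N.
Proof.
rewrite ler_norml /idx => /andP[u1 u2]; case: ifP => u0.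
  by rewrite leq_add2l trunc_le.
exact: leq_trans (leq_subr _ _) (leq_addr _ _).
Qed.

Lemma tau_idx u : `|u| <= 1 ->
  `|tau h n (idx u)| <= `|u| /\ `|u - tau h n (idx u)| <= h.
Proof.
move=> u1; have h0 : 0 <= h by rewrite invr_ge0 ltW.
rewrite /tau /idx; have [u0|u0] := leP 0 u.
  rewrite natrD addrC addKr; have [h1 h2] := trunc_bounds u0.
  rewrite (ger0_norm u0) ger0_norm ?mulr_ge0 //; split => //.
  by rewrite ger0_norm; lra.
have nu0 : 0 <= - u by rewrite oppr_ge0 ltW.
have nu1 : - u <= 1 by move: u1; rewrite ltr0_norm.
rewrite natrB ?trunc_le // addrC addKr mulrN normrN opprK.
have [h1 h2] := trunc_bounds nu0.
rewrite (ltr0_norm u0) ger0_norm ?mulr_ge0 //; split => //.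
by rewrite ler0_norm; lra.
Qed.

Lemma measurable_idx m : measurable [set u | idx u = m].
Proof.
have mono : {homo (fun u => (idx u)%:R : R) : u v / u <= v}.
  move=> u v uv; rewrite ler_nat /idx.
  case: (leP 0 u) => u0; case: (leP 0 v) => v0.
  - by rewrite leq_add2l le_truncn // ler_wpM2r // ltW.
  - by have := lt_le_trans v0 (le_trans u0 uv); rewrite ltxx.
  - exact: leq_trans (leq_subr _ _) (leq_addr _ _).
  - by rewrite leq_sub2l // le_truncn // ler_wpM2r ?(ltW nR0) // lerN2.
have mf := nondecreasing_measurable (@measurableT _ R) mono.
have := mf measurableT [set m%:R] (measurable_set1 _); rewrite setTI.
by congr measurable; apply/seteqP; split => u /=; [move/eqP; rewrite eqr_nat => /eqP|move=> ->].
Qed.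

End Rounding.

(** * Independence, from sigma-algebras to the discretized law *)

Section SigmaFamily.
Context d (T : measurableType d) (R : realType) (P : probability T R) (J : finType).
Variable X : J -> {RV P >-> R}.
Implicit Types D : {set J}.

Lemma sigma_family_sub D D' : D \subset D' -> sigma_family X D `<=` sigma_family X D'.
Proof.
move=> /fintype.subsetP DD'; apply: smallest_sub; first exact: smallest_sigma_algebra.
move=> E [j jD XE]; apply: sub_sigma_algebra; exists j => //; exact: DD'.
Qed.

Lemma indep_families_sub D1 D2 D1' D2' : D1' \subset D1 -> D2' \subset D2 ->
  indep_families X D1 D2 -> indep_families X D1' D2'.
Proof.
move=> s1 s2 ind E F HE HF.
by apply: ind; [exact: sigma_family_sub HE|exact: sigma_family_sub HF].
Qed.

Lemma sigma_family_cylinder D (F : J -> set R) : (forall i, measurable (F i)) ->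
  sigma_family X D (\big[setI/setT]_(i in D) (X i @^-1` F i)).
Proof.
move=> mF; pose G := \bigcup_(j in [set` D]) preimage_set_system setT (X j) measurable.
apply: (@bigsetI_measurable _ (g_sigma_algebraType G)) => i iD.
apply: sub_sigma_algebra; exists i => //; exists (F i); first exact: mF.
by rewrite setTI.
Qed.

Lemma sigma_family0 D : sigma_family X D set0.
Proof. exact: sigma_algebra0. Qed.

Lemma bigsetI_mem (Q : pred J) (F : J -> set T) w :
  (\big[setI/setT]_(i | Q i) F i) w <-> forall i, Q i -> F i w.
Proof.
rewrite -bigcap_seq_cond; split => [H i Qi|H i /andP[_ /H //]].
by apply: H; rewrite /= mem_index_enum.
Qed.

End SigmaFamily.

Section Discretization.
Context d (T : measurableType d) (R : realType) (P : probability T R) (J : finType).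
Variables (X : J -> {RV P >-> R}) (A : J -> {set J}) (s k : R) (n : nat).
Hypotheses (s0 : 0 < s) (k1 : 1 <= k) (n0 : (0 < n)%N).
Let h : R := n%:R^-1.
Let k0 : 0 < k. Proof. exact: lt_le_trans k1. Qed.

Definition trunc_scaled (r : R) : R := r * (`|r| <= s / k)%R%:R / s.
Definition truncated i w : R := trunc_scaled (X i w).
Local Notation xi := truncated.
Definition codes : finType := {ffun J -> 'I_(n + n).+1}.
Definition code (w : T) : codes := [ffun i => inord (idx n (xi i w))].
(** The bound 1/k is enforced here because it must hold at every code, including those that never
    occur; at a code that occurs the rounded value satisfies it anyway. *)
Definition discretized (i : J) (v : codes) : R :=
  if (i \in A i) && (`|tau h n (v i)| <= k^-1) then tau h n (v i) else 0.
Local Notation x := discretized.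

Lemma trunc_scaled_le r : `|trunc_scaled r| <= k^-1.
Proof.
rewrite /trunc_scaled; case: (lerP `|r| (s / k)) => rk; last first.
  by rewrite /= mulr0 mul0r normr0 invr_ge0 ltW.
rewrite /= mulr1 normrM normfV (gtr0_norm s0) ler_pdivrMr //.
by rewrite mulrC.
Qed.

Lemma trunc_scaled_le1 r : `|trunc_scaled r| <= 1.
Proof. by apply: le_trans (trunc_scaled_le r) _; rewrite invf_le1. Qed.

Lemma measurable_trunc_scaled : measurable_fun setT trunc_scaled.
Proof.
apply: measurable_funM => //; apply: measurable_funM => //.
rewrite (_ : (fun r => _) = \1_[set r : R | `|r| <= s / k]); last first.
  apply/funext => r; rewrite indicE; congr (_ %:R); congr nat_of_bool.
  by apply/idP/idP => [|/set_mem //]; exact: mem_set.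
apply: measurable_indic.
rewrite (_ : [set r : R | _] = `[- (s / k), s / k]%classic) //.
by apply/seteqP; split => r /=; rewrite in_itv /= ler_norml.
Qed.

Lemma code_tau i w : tau h n (code w i) = tau h n (idx n (xi i w)).
Proof. by rewrite ffunE inordK // ltnS idx_le ?trunc_scaled_le1. Qed.

Lemma x_code i w : i \in A i ->
  `|x i (code w)| <= `|xi i w| /\ `|xi i w - x i (code w)| <= h.
Proof.
move=> iA; have [h1 h2] := tau_idx n0 (trunc_scaled_le1 (X i w)).
rewrite /x iA code_tau /= (le_trans h1) //; exact: trunc_scaled_le.
Qed.

Let pre (m : 'I_(n + n).+1) : set R := [set r | idx n (trunc_scaled r) = m].

Let mpre m : measurable (pre m).
Proof.
have := measurable_trunc_scaled measurableT (measurable_idx n0 m).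
by rewrite setTI.
Qed.

Let code_eq w i m : (code w i = m) <-> (X i @^-1` pre m) w.
Proof.
rewrite /code ffunE /pre /=; split => [<-|E].
  by rewrite inordK // ltnS idx_le ?trunc_scaled_le1.
by apply/val_inj; rewrite /= inordK ?ltnS ?idx_le ?trunc_scaled_le1.
Qed.

Definition proj (D : {set J}) (v : codes) : codes := [ffun i => if i \in D then v i else ord0].

(** The event is a cylinder over [D], unless a differs from the filler [ord0] somewhere off [D],
    when it is empty. *)
Lemma sigma_family_code D (a : codes) :
  sigma_family X D (code @^-1` [set v | proj D v == a]).
Proof.
have [/forallP H|/forallPn[i]] := boolP [forall i, (i \notin D) ==> (a i == ord0)].
  rewrite (_ : _ @^-1` _ = \big[setI/setT]_(i in D) (X i @^-1` pre (a i))).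
    exact: sigma_family_cylinder.
  apply/seteqP; split => w /=.
    move=> /eqP/ffunP E; apply/bigsetI_mem => i iD; apply/code_eq.
    by have := E i; rewrite ffunE iD.
  move=> /bigsetI_mem E; apply/eqP/ffunP => i; rewrite ffunE.
  case: ifP => iD; first exact/code_eq/E.
  by have := H i; rewrite iD => /eqP ->.
rewrite negb_imply => /andP[iD ai].
rewrite (_ : _ @^-1` _ = set0); first exact: sigma_family0.
apply/seteqP; split => w //= /eqP/ffunP/(_ i); rewrite ffunE (negbTE iD) => E.
by rewrite -E eqxx in ai.
Qed.

Lemma measurable_code1 v : measurable (code @^-1` [set v]).
Proof.
rewrite (_ : _ @^-1` _ = \big[setI/setT]_(i in setT) (X i @^-1` pre (v i))).
  apply: bigsetI_measurable => i _; rewrite -[X in measurable X]setTI.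
  exact: measurable_funPT.
apply/seteqP; split => w /=.
  by move=> <-; apply/bigsetI_mem => i _; apply/code_eq.
move=> /bigsetI_mem E; apply/ffunP => i; apply/code_eq/E; exact: mem_set.
Qed.

Local Notation law := (law P code).
Local Notation E := (Ex law).

Let nonnull : {set J} := [set i | i \in A i]%SET.

Lemma dep_proj D f v : dep x D f -> f v = f (proj (D :&: nonnull) v).
Proof.
move=> df; apply: df => i iD; rewrite /x ffunE !inE iD /=.
by case: (i \in A i).
Qed.

(** Functions of the discretized variables are combinations of indicators of the events
    [proj D v == a], to which independence of the sigma-algebras applies. Indices outside [nonnull]
    have x_i = 0 and drop out. *)
Lemma indep_law D1 D2 : indep_families X (D1 :&: nonnull) (D2 :&: nonnull) ->
  indep law x D1 D2.
Proof.
move=> ind f g df dg.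
pose q1 a v : R := (proj (D1 :&: nonnull) v == a)%:R.
pose q2 a v : R := (proj (D2 :&: nonnull) v == a)%:R.
have fE v : f v = \sum_a f a * q1 a v.
  rewrite (dep_proj v df) (bigD1 (proj (D1 :&: nonnull) v)) //= big1 => [|a].
    by rewrite /q1 eqxx mulr1 addr0.
  by rewrite /q1 eq_sym => /negbTE ->; rewrite mulr0.
have gE v : g v = \sum_a g a * q2 a v.
  rewrite (dep_proj v dg) (bigD1 (proj (D2 :&: nonnull) v)) //= big1 => [|a].
    by rewrite /q2 eqxx mulr1 addr0.
  by rewrite /q2 eq_sym => /negbTE ->; rewrite mulr0.
have mc := measurable_code1.
have qq a c : E (fun v => q1 a v * q2 c v) = E (q1 a) * E (q2 c).
  apply/EFin_inj; rewrite EFinM -!(law_event P mc).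
  rewrite -ind; [|exact: sigma_family_code|exact: sigma_family_code].
  rewrite (eq_Ex _ (g := fun v => ((proj (D1 :&: nonnull) v == a) &&
    (proj (D2 :&: nonnull) v == c))%:R)).
    by rewrite -(law_event P mc); congr (P _); apply/seteqP;
      split => w /=; [move=> /andP[]|move=> [-> ->]].
  by move=> v; rewrite /q1 /q2; case: eqP; case: eqP; rewrite ?mulr1 ?mulr0 ?mul0r.
rewrite (eq_Ex _ fE) (eq_Ex _ gE) !Ex_sum mulr_suml.
rewrite (eq_Ex _ (g := fun v => \sum_a \sum_c f a * g c * (q1 a v * q2 c v))).
  rewrite Ex_sum; apply: eq_bigr => a _; rewrite Ex_sum mulr_sumr; apply: eq_bigr => c _.
  by rewrite !ExZ qq; ring.
move=> v; rewrite fE gE mulr_suml; apply: eq_bigr => a _.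
by rewrite mulr_sumr; apply: eq_bigr => c _; ring.
Qed.

End Discretization.

(** * Covariances of the original variables, and null indices *)

Section Covariances.
Context d (T : measurableType d) (R : realType) (P : probability T R) (J : finType).
Variables (X : J -> {RV P >-> R}) (A : J -> {set J}).
Hypothesis X2 : forall i, (X i : T -> R) \in Lfun P 2%:E.
Hypothesis EX : forall i, ('E_P[X i] = 0)%E.
Hypothesis LD : LD1 X A.
Hypothesis Var : (0 < 'V_P[sumX X])%E.
Local Notation EP := (EP P).
Local Notation intg := (intg P).

Lemma intg_XX i j : intg (fun w => X i w * X j w).
Proof. by apply/Lfun1_integrable; apply: Lfun2_mul_Lfun1. Qed.

Lemma intg_X i : intg (X i).
Proof. by apply/Lfun1_integrable; apply: Lfun_subset12 => //; exact: fin_num_measure. Qed.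

Lemma EP_X i : EP (X i) = 0.
Proof. by rewrite -expectationE EX. Qed.

Lemma sigma_family_preimage (D : {set J}) i (B : set R) : i \in D -> measurable B ->
  sigma_family X D (X i @^-1` B).
Proof.
move=> iD mB; apply: sub_sigma_algebra; exists i => //; exists B => //.
by rewrite setTI.
Qed.

Lemma EP_XX_indep i j : j \notin A i -> EP (fun w => X i w * X j w) = 0.
Proof.
move=> ji; rewrite /EP /Rintegral integral_indep_product0 //.
- move=> B C mB mC; apply: LD; apply: sigma_family_preimage => //.
    by rewrite finset.inE.
  by rewrite finset.inE.
- exact: intg_X.
- exact: intg_XX.
- by have := EX i; rewrite unlock.
Qed.

(** For such i, (LD1) makes X_i independent of itself, so E X_i^2 = (E X_i)^2 = 0. *)
Lemma null_prob i : i \notin A i -> P [set w | X i w != 0] = 0%E.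
Proof.
move=> iA; have E0 := EP_XX_indep iA.
have mX : measurable_fun setT (fun w => X i w * X i w).
  by apply: measurable_funM; exact: measurable_funPT.
have : ae_eq P setT (EFin \o (fun w => X i w * X i w)) (cst 0%E).
  apply/ae_eq_integral_abs => //; first exact/measurable_EFinP.
  rewrite (eq_integral (EFin \o (fun w => X i w * X i w))) => [|w _] /=.
    by rewrite EP_fin ?E0 //; exact: intg_XX.
  by rewrite ger0_norm // -expr2 sqr_ge0.
move=> [N [mN N0 sub]]; have mX0 : measurable [set w | X i w != 0].
  rewrite (_ : [set w | _] = X i @^-1` (~` [set 0])).
    by rewrite -[X in measurable X]setTI; apply: measurable_funPT => //; exact: measurableC.
  by apply/seteqP; split => w /= /eqP.
apply/eqP; rewrite -measure_le0 -N0 le_measure ?inE // => w /= Xw.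
apply: sub => /= /(_ I)[] /eqP; rewrite mulf_eq0 orbb.
by rewrite (negbTE Xw).
Qed.

Lemma measurable_neq0 i : measurable [set w | X i w != 0].
Proof.
rewrite (_ : [set w | _] = X i @^-1` (~` [set 0])).
  by rewrite -[X in measurable X]setTI; apply: measurable_funPT => //; exact: measurableC.
by apply/seteqP; split => w /= /eqP.
Qed.

Lemma EP_null i (f : T -> R) : i \notin A i -> measurable_fun setT f ->
  (forall w, X i w = 0 -> f w = 0) -> EP f = 0.
Proof.
move=> iA mf f0; rewrite /EP /Rintegral (ae_eq_integral (cst 0%E)) //.
- by rewrite integral0.
- exact/measurable_EFinP.
exists [set w | X i w != 0]; split; [exact: measurable_neq0|exact: null_prob|].
move=> w /= H; apply/negP => /eqP Xw; apply: H => _.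
by rewrite f0.
Qed.

Lemma EP_XX_null i j : i \notin A i -> EP (fun w => X i w * X j w) = 0.
Proof.
move=> iA; apply: (EP_null iA); last by move=> w ->; rewrite mul0r.
exact: intg_measurable (intg_XX i j).
Qed.

Lemma variance_sum : ('V_P[sumX X] = (\sum_i \sum_j EP (fun w => X i w * X j w))%:E)%E.
Proof.
have E0 : fine 'E_P[sumX X] = 0.
  rewrite expectationE /sumX EP_sum; last exact: intg_X.
  by rewrite big1 // => i _; exact: EP_X.
have SS w : ((sumX X \- cst 0) * (sumX X \- cst 0)) w =
    \sum_i \sum_j X i w * X j w.
  rewrite /GRing.mul /= subr0 /sumX mulr_suml; apply: eq_bigr => i _.
  by rewrite mulr_sumr.
rewrite /variance covariance.unlock E0; transitivity (\int[P]_w (\sum_i \sum_j X i w * X j w)%:E)%E.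
  by rewrite unlock; apply: eq_integral => w _; congr (_%:E); exact: SS.
rewrite EP_fin; last by do 2!apply: intg_sum => ? _; exact: intg_XX.
congr (_%:E); rewrite EP_sum; last by move=> i; apply: intg_sum => j _; exact: intg_XX.
by apply: eq_bigr => i _; rewrite EP_sum // => j; exact: intg_XX.
Qed.

Lemma sigma_gt0 : 0 < sigma X.
Proof. by rewrite sqrtr_gt0 variance_sum /=; move: Var; rewrite variance_sum lte_fin. Qed.

Lemma sigma_sqr : sigma X ^+ 2 = \sum_i \sum_j EP (fun w => X i w * X j w).
Proof. by rewrite sqr_sqrtr ?variance_sum //= ltW //; move: Var; rewrite variance_sum lte_fin. Qed.

(** Otherwise every X_i vanishes almost surely, against the positive variance. This is the source of
    [k] >= 1. *)
Lemma exists_nonnull : exists i, i \in A i.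
Proof.
apply/existsP; apply: contraT; rewrite negb_exists => /forallP H.
have := exprn_gt0 2 sigma_gt0; rewrite sigma_sqr big1 ?ltxx // => i _.
by rewrite big1 // => j _; exact: EP_XX_null.
Qed.

Let J0 : {set J} := finset.finset (fun i => i \in A i).

Lemma sigma_sqr_local :
  sigma X ^+ 2 = \sum_(i in J0) \sum_(j in A i :&: J0) EP (fun w => X i w * X j w).
Proof.
rewrite sigma_sqr [RHS]big_mkcond; apply: eq_bigr => i _; rewrite finset.inE.
case: ifPn => iA; last by rewrite big1 // => j _; exact: EP_XX_null.
rewrite [RHS]big_mkcond; apply: eq_bigr => j _; rewrite !finset.inE.
have [ji|ji] := boolP (j \in A i); last by rewrite EP_XX_indep.
case: ifPn => // jA; rewrite -(EP_XX_null i jA); congr EP.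
by apply/funext => w; rewrite mulrC.
Qed.

End Covariances.

(** * Local dependence of the discretized family *)

Section Transfer.
Context d (T : measurableType d) (R : realType) (P : probability T R) (J : finType).
Variables (X : J -> {RV P >-> R}) (A B : J -> {set J}) (k : R) (n : nat).
Hypothesis X2 : forall i, (X i : T -> R) \in Lfun P 2%:E.
Hypothesis EX : forall i, ('E_P[X i] = 0)%E.
Hypothesis LD1X : LD1 X A.
Hypothesis LD2X : LD2 X A B.
Hypothesis Var : (0 < 'V_P[sumX X])%E.
Hypothesis deg : (max_degree A B)%:R <= k.
Hypothesis n0 : (0 < n)%N.
Local Notation EP := (EP P).
Local Notation intg := (intg P).
Local Notation s := (sigma X).
Let h : R := n%:R^-1.

Let s0 : 0 < s. Proof. exact: (sigma_gt0 X2 EX Var). Qed.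

Lemma card_BA i : #|[pred j | B i :&: A j != finset.set0]|%:R <= k.
Proof.
apply: le_trans deg; rewrite ler_nat.
exact: leq_trans (leq_maxl _ _) (leq_bigmax i).
Qed.

Lemma card_inB i : #|[pred j | i \in B j]|%:R <= k.
Proof.
apply: le_trans deg; rewrite ler_nat.
exact: leq_trans (leq_maxr _ _) (leq_bigmax i).
Qed.

Lemma kappa_ge1 : 1 <= k.
Proof.
have [i iA] := exists_nonnull X2 EX LD1X Var.
apply: le_trans (card_BA i); rewrite (ler_nat R 1).
apply/fintype.card_gt0P; exists i; rewrite inE; apply/finset.set0Pn; exists i.
by rewrite finset.inE iA andbT; have [/fintype.subsetP sAB _] := LD2X i; exact: sAB.
Qed.

Let k0 : 0 < k. Proof. exact: lt_le_trans kappa_ge1. Qed.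
Let h0 : 0 <= h. Proof. by rewrite invr_ge0. Qed.

Local Notation xi := (truncated X s k).
Local Notation x := (discretized A k (n := n)).
Local Notation code := (code X s k n).
Local Notation law := (law P code).
Local Notation E := (Ex law).
Let J0 : {set J} := finset.finset (fun i => i \in A i).

(* (LD1) does not force [i \in A i]; when it fails, X_i is independent of itself,
   hence a.s. zero, and its discretization is set to 0.  Such an index is put
   in its own neighbourhood, and in no other one. *)
Definition nbhd i := i |: (A i :&: J0).
Definition block_nbhd i := if A i :&: J0 == finset.set0 then finset.set1 i else i |: (B i :&: J0).

Local Notation A' := nbhd.
Local Notation B' := block_nbhd.

Lemma mcode v : measurable (code @^-1` [set v]).
Proof. exact: measurable_code1 s0 kappa_ge1 n0 v. Qed.

Lemma x_null i v : i \notin A i -> x i v = 0.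
Proof. by rewrite /x => /negbTE ->. Qed.

Lemma measurable_xi i : measurable_fun setT (xi i).
Proof.
apply: (measurableT_comp (f := trunc_scaled s k)); last exact: measurable_funPT.
exact: measurable_trunc_scaled.
Qed.

Let law1 : \sum_v law v = 1. Proof. exact: law_sum1 mcode. Qed.

Lemma indep_null i D : i \notin A i -> indep law x (finset.set1 i) D.
Proof.
move=> iA f g df _; have cf v v' : f v = f v'.
  by apply: df => j; rewrite finset.inE => /eqP ->; rewrite !x_null.
rewrite [E g]/Ex mulr_sumr; apply: eq_bigr => v _; rewrite mulrCA; congr (_ * (_ * _)).
by rewrite (eq_Ex _ (fun v' => cf v' v)) Ex_cst.
Qed.

Lemma indep_discretized D1 D2 D1' D2' : indep_families X D1 D2 ->
  D1' :&: J0 \subset D1 -> D2' :&: J0 \subset D2 -> indep law x D1' D2'.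
Proof.
move=> ind sub1 sub2; apply: (indep_law s0 kappa_ge1 n0).
exact: indep_families_sub sub1 sub2 ind.
Qed.

Lemma nbhd_cap i : i \in A i -> A' i = A i :&: J0.
Proof. by move=> iA; apply/finset.setUidPr; rewrite finset.sub1set !finset.inE iA. Qed.

Lemma nbhd_sub i : A' i :&: J0 \subset A i.
Proof.
apply/fintype.subsetP => j; rewrite !finset.inE => /andP[/orP[/eqP ->//|/andP[]//]].
Qed.

Lemma cap_setC_sub (C D : {set J}) : C :&: J0 \subset D -> (~: D) :&: J0 \subset ~: C.
Proof.
move=> /fintype.subsetP CD; apply/fintype.subsetP => j; rewrite !finset.inE => /andP[jD jJ].
by apply: contra jD => jC; apply: CD; rewrite !finset.inE jC.
Qed.

Lemma self_discretized i : indep law x (finset.set1 i) (~: A' i).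
Proof.
have [iA|iA] := boolP (i \in A i); last exact: indep_null.
have ind : indep_families X (finset.set1 i) (~: A i)%SET by exact: (LD1X (i := i)).
apply: (indep_discretized ind); first exact: finset.subsetIl.
by apply: cap_setC_sub; exact: finset.subsetUr.
Qed.

(** The degree must not grow. If [A i] contains no index of [J0], only j = i is counted, as i is
    null and lies in no other neighbourhood. Otherwise every j counted here already satisfies that
    [B i] meets [A j]: an intersection at an index added by hand is traded for one in the original
    sets. *)
Lemma block_discretized i : block law x A' k (A' i) (B' i).
Proof.
have [sAB ind] := LD2X i; rewrite /B'; have [A0|A0] := eqVneq (A i :&: J0) finset.set0.
  have iA : i \notin A i.
    apply/negP => iA; suff : i \in A i :&: J0 by rewrite A0 finset.inE.
    by rewrite !finset.inE iA.
  split.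
  - by rewrite /A' A0 finset.setU0.
  - by rewrite /A' A0 finset.setU0; exact: indep_null.
  apply: le_trans kappa_ge1; rewrite (ler_nat R _ 1) -(card1 i); apply: subset_leq_card.
  apply/fintype.subsetP => j; rewrite !inE => /finset.set0Pn[l]; rewrite !finset.inE.
  by case/andP => /eqP -> /orP[/eqP ->|/andP[_ H]] //; rewrite H in iA.
split.
- by rewrite finset.setUS // finset.setSI.
- apply: (indep_discretized ind); first exact: nbhd_sub.
  by apply: cap_setC_sub; exact: finset.subsetUr.
apply: le_trans (card_BA i); rewrite ler_nat; apply: subset_leq_card.
apply/fintype.subsetP => j; rewrite !inE => /finset.set0Pn[l].
have AB : A i :&: J0 \subset B i :&: A i.
  by rewrite finset.subsetI finset.subsetIl (fintype.subset_trans _ sAB) ?finset.subsetIl.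
rewrite !finset.inE => /andP[/orP[/eqP ->|/andP[lB lJ]]] /orP[/eqP lj|/andP[lA lJ']].
- by rewrite -lj; apply: contraNneq A0 => H; move: AB; rewrite H finset.subset0.
- apply/finset.set0Pn; exists i; rewrite finset.inE lA andbT.
  by apply: (fintype.subsetP sAB).
- by apply/finset.set0Pn; exists l; rewrite finset.inE lB -lj.
by apply/finset.set0Pn; exists l; rewrite finset.inE lB.
Qed.

Lemma card_block_nbhd i : #|[pred j | i \in B' j]|%:R <= k.
Proof.
have [iA|iA] := boolP (i \in A i).
  apply: le_trans (card_inB i); rewrite ler_nat; apply: subset_leq_card.
  have [/fintype.subsetP sAB _] := LD2X i.
  apply/fintype.subsetP => j; rewrite !inE /B'; case: ifPn => A0; rewrite !finset.inE.
    by move=> /eqP <-; exact: sAB.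
  by move=> /orP[/eqP <-|/andP[]//]; exact: sAB.
apply: le_trans kappa_ge1; rewrite (ler_nat R _ 1) -(card1 i); apply: subset_leq_card.
apply/fintype.subsetP => j; rewrite !inE /B'; case: ifPn => jA; rewrite !finset.inE eq_sym //.
by rewrite (negbTE iA) andbF orbF.
Qed.

Lemma y_discretized i v : nbr_sum x A' i v = \sum_(j in A i) x j v.
Proof.
rewrite /nbr_sum [LHS]big_mkcond [RHS]big_mkcond; apply: eq_bigr => j _; rewrite !finset.inE.
have [jA|jA] := boolP (j \in A j); last by rewrite x_null // !if_same.
by rewrite andbT; case: eqVneq => [<-|] //=; rewrite jA.
Qed.

Lemma x_bound i v : `|x i v| <= k^-1.
Proof. by rewrite /x; case: ifP => [/andP[]|_] //; rewrite normr0 invr_ge0 ltW. Qed.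

Let xc i w : i \in A i -> `|x i (code w)| <= `|xi i w| /\ `|xi i w - x i (code w)| <= h.
Proof. move=> iA; exact: (x_code X s0 kappa_ge1 n0 w iA). Qed.

Let xc_le i w : `|x i (code w)| <= `|xi i w|.
Proof.
have [iA|iA] := boolP (i \in A i); first by case: (xc w iA).
by rewrite x_null // normr0.
Qed.

Let xi1 i w : `|xi i w| <= 1. Proof. exact: (trunc_scaled_le1 s0 kappa_ge1). Qed.

Lemma cubes_discretized : \sum_i E (fun v => `|x i v| ^+ 3) <= beta3 X k.
Proof.
rewrite /beta3 mulr_sumr; apply: ler_sum => i _; rewrite expectationE.
have E3 w : (s ^+ 3)^-1 * (`|X i w| ^+ 3 * \1_[set u | `|X i u| <= s / k] w) = `|xi i w| ^+ 3.
  rewrite /xi /trunc_scaled indicE.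
  have -> : (w \in [set u | `|X i u| <= s / k]) = (`|X i w| <= s / k).
    by apply/idP/idP => [/set_mem|H]; [|exact: mem_set].
  rewrite !normrM normfV (gtr0_norm s0) exprMn exprMn exprVn.
  by case: (_ <= _); rewrite /= ?normr1 ?normr0 ?expr1n ?expr0n /=; ring.
have I3 : intg (fun w => `|xi i w| ^+ 3).
  apply: (intg_le _ (g := fun=> 1)) (intg_cst _ _).
    by apply: measurable_funX; apply: measurableT_comp => //; exact: measurable_xi.
  by move=> w; rewrite ger0_norm ?exprn_ge0 // exprn_ile1.
have I3' : intg (fun w => `|X i w| ^+ 3 * \1_[set u | `|X i u| <= s / k] w).
  have := intgZ (s ^+ 3) I3; congr intg; apply/funext => w; rewrite -E3 mulrA mulfV ?mul1r //.
  by rewrite expf_neq0 // gt_eqF.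
rewrite -EPZ // (_ : (fun w => _ * _) = (fun w => `|xi i w| ^+ 3)); last exact/funext.
rewrite -(EP_code P mcode); apply: EP_le => //.
  exact: (intg_code P mcode (fun v => `|x i v| ^+ 3)).
by move=> w; rewrite ler_pXn2r ?nnegrE.
Qed.

Lemma theta_discretized :
  \sum_i \sum_(j in A' i) E (fun v => `|x i v * x j v|) <= theta X A k.
Proof.
rewrite /theta mulr_sumr; apply: ler_sum => i _.
have nn j : 0 <= fine 'E_P[fun w => `|X i w * X j w *
    \1_[set u | `|X i u| <= s / k /\ `|X j u| <= s / k] w|].
  by rewrite expectationE; apply: EP_ge0.
have s20 : 0 <= (s ^+ 2)^-1 by rewrite invr_ge0 sqr_ge0.
have [iA|iA] := boolP (i \in A i); last first.
  rewrite big1 => [|j _]; first by rewrite mulr_ge0 // sumr_ge0.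
  by rewrite (eq_Ex _ (g := fun=> 0)) ?Ex_cst // => v; rewrite x_null // mul0r normr0.
rewrite mulr_sumr nbhd_cap // big_mkcond [leRHS]big_mkcond; apply: ler_sum => j _.
rewrite finset.inE; case: (j \in A i) => //=; case: ifP => _; last by rewrite mulr_ge0.
rewrite expectationE.
have E2 w : (s ^+ 2)^-1 * `|X i w * X j w *
    \1_[set u | `|X i u| <= s / k /\ `|X j u| <= s / k] w| = `|xi i w * xi j w|.
  rewrite /xi /trunc_scaled indicE.
  have -> : (w \in [set u | `|X i u| <= s / k /\ `|X j u| <= s / k]) =
      (`|X i w| <= s / k) && (`|X j w| <= s / k).
    by apply/idP/idP => [/set_mem[-> ->]|/andP[H1 H2]]; [|exact: mem_set].
  rewrite !normrM normfV (gtr0_norm s0) -exprVn.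
  by case: (_ <= _); case: (_ <= _); rewrite /= ?normr1 ?normr0; ring.
have I2 : intg (fun w => `|xi i w * xi j w|).
  apply: (intg_le _ (g := fun=> 1)) (intg_cst _ _).
    by apply: measurableT_comp => //; apply: measurable_funM; exact: measurable_xi.
  by move=> w; rewrite normr_id normrM mulr_ile1.
rewrite -EPZ.
  rewrite (_ : (fun w => _ * _) = (fun w => `|xi i w * xi j w|)); last exact/funext.
  rewrite -(EP_code P mcode); apply: EP_le => //.
    exact: (intg_code P mcode (fun v => `|x i v * x j v|)).
  move=> w; rewrite (normrM (x i _)) (normrM (xi i w)).
  exact: ler_pM (normr_ge0 _) (normr_ge0 _) (xc_le _ _) (xc_le _ _).
have := intgZ (s ^+ 2) I2; congr intg; apply/funext => w; rewrite -E2 mulrA mulfV ?mul1r //.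
by rewrite expf_neq0 // gt_eqF.
Qed.

(** A lost product is at most the square of its larger factor, and that factor exceeds t. Truncating
    pairs therefore costs only the terms of [beta2]. *)
Lemma trunc_prod (a c t : R) : 0 <= t ->
  `|a * (`|a| <= t)%R%:R * (c * (`|c| <= t)%R%:R) - a * c| <=
  `|a| ^+ 2 * (t < `|a|)%R%:R + `|c| ^+ 2 * (t < `|c|)%R%:R.
Proof.
move=> t0; have a0 : 0 <= `|a| by []. have c0 : 0 <= `|c| by [].
case: (lerP `|a| t) => at_; case: (lerP `|c| t) => ct;
  rewrite /= ?mulr1 ?mulr0 ?mul0r ?subrr ?normr0 ?addr0 ?add0r ?sub0r ?normrN ?normrM //.
- by rewrite expr2 ler_wpM2r // (le_trans at_) ?ltW.
- by rewrite expr2 ler_wpM2l // (le_trans ct) ?ltW.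
by have := sqr_ge0 (`|a| - `|c|); nra.
Qed.

(** For t = sigma / k, dividing by t is what puts the factor [k] in front of [beta2] in the bound on
    the means. *)
Lemma trunc_one (a t : R) :
  t * `|a * (`|a| <= t)%R%:R - a| <= `|a| ^+ 2 * (t < `|a|)%R%:R.
Proof.
case: (lerP `|a| t) => at_; rewrite /= ?mulr1 ?mulr0 ?subrr ?normr0 ?mulr0 // sub0r normrN.
by rewrite expr2 ler_wpM2r // ltW.
Qed.

Let big i w : R := `|X i w| ^+ 2 * (s / k < `|X i w|)%R%:R.

Let bigE i : big i = (fun w => `|X i w| ^+ 2 * \1_[set u | s / k < `|X i u|] w).
Proof.
apply/funext => w; rewrite /big indicE; congr (_ * _%:R); congr nat_of_bool.
by apply/idP/idP => [|/set_mem //]; exact: mem_set.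
Qed.

Let intg_big i : intg (big i).
Proof.
apply: (intg_le _ (g := fun w => X i w * X i w)) (intg_XX X2 i i); last first.
  move=> w; rewrite /big -expr2 -normrX normrM normr_id normrX real_normK ?num_real //.
  by rewrite ler_piMr ?sqr_ge0 //; case: (_ < _)%R; rewrite /= ?normr0 ?normr1.
rewrite bigE; apply: measurable_funM.
  by apply: measurable_funX; apply: measurableT_comp => //; exact: measurable_funPT.
apply: measurable_indic.
rewrite (_ : [set u | _] = (fun w => `|X i w|) @^-1` `]s / k, +oo[%classic); last first.
  by apply/seteqP; split => w /=; rewrite in_itv /= andbT.
have mN : measurable_fun setT (fun w => `|X i w|).
  by apply: measurableT_comp => //; exact: measurable_funPT.
by have := mN measurableT `]s / k, +oo[%classic (measurable_itv _); rewrite setTI.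
Qed.

Let beta2E : beta2 X k = (s ^+ 2)^-1 * \sum_i EP (big i).
Proof. by rewrite /beta2; congr (_ * _); apply: eq_bigr => i _; rewrite bigE expectationE. Qed.

Let q i : R := (s ^+ 2)^-1 * EP (big i).
Let q0 i : 0 <= q i.
Proof.
rewrite mulr_ge0 ?invr_ge0 ?sqr_ge0 // EP_ge0 // => w.
by rewrite mulr_ge0 ?exprn_ge0.
Qed.

Let intg_x i : intg (fun w => x i (code w)). Proof. exact: (intg_code P mcode (x i)). Qed.

Lemma means_discretized : \sum_i `|E (x i)| <= k * beta2 X k + #|J|%:R * h.
Proof.
rewrite beta2E mulrA mulr_sumr (_ : #|J|%:R * h = \sum_(i : J) h); last first.
  by rewrite sumr_const -[RHS]mulr_natl.
rewrite -big_split /=; apply: ler_sum => i _; rewrite -mulrA -/(q i).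
have [iA|iA] := boolP (i \in A i); last first.
  rewrite (eq_Ex _ (g := fun=> 0)) ?Ex_cst // => [|v]; last by rewrite x_null.
  by rewrite normr0 addr_ge0 // mulr_ge0 // ltW.
rewrite -(EP_code P mcode).
have -> : EP (fun w => x i (code w)) = EP (fun w => x i (code w) - s^-1 * X i w).
  by rewrite EPB ?EPZ ?EP_X ?mulr0 ?subr0 //; do ?apply: intgZ; exact: intg_X.
have Id : intg (fun w => x i (code w) - s^-1 * X i w).
  by apply: intgB => //; apply: intgZ; exact: intg_X.
apply: le_trans (EP_norm Id) _.
rewrite /q mulrA -EPZ // -[X in _ + X](EP_cst P) -EPD; [|exact: intgZ|exact: intg_cst].
apply: EP_le; [exact: intg_abs|by apply: intgD; [exact: intgZ|exact: intg_cst]|move=> w].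
have [_ h2] := xc w iA.
rewrite (_ : _ - _ = - (xi i w - x i (code w)) + (xi i w - s^-1 * X i w)); last by ring.
apply: le_trans (ler_normD _ _) _; rewrite normrN addrC lerD //.
have -> : xi i w - s^-1 * X i w = s^-1 * (X i w * (`|X i w| <= s / k)%R%:R - X i w).
  by rewrite /xi /trunc_scaled; ring.
rewrite normrM normfV (gtr0_norm s0).
have kk : 0 <= k * (s ^+ 2)^-1 by rewrite mulr_ge0 ?invr_ge0 ?sqr_ge0 // ltW.
apply: le_trans (ler_wpM2l kk (trunc_one (X i w) (s / k))).
rewrite mulrA (_ : k * (s ^+ 2)^-1 * (s / k) = s^-1) //.
by field; rewrite !gt_eqF.
Qed.

Let card_local i : #|[pred j in A i :&: J0]|%:R <= k.
Proof.
apply: le_trans (card_BA i); rewrite ler_nat; apply: subset_leq_card.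
apply/fintype.subsetP => j; rewrite !inE => /andP[jA jJ]; apply/finset.set0Pn; exists j.
have [/fintype.subsetP sAB _] := LD2X i.
by rewrite finset.inE sAB //=; move: jJ; rewrite ?finset.inE.
Qed.

Let card_local_r j : #|[pred i | (i \in J0) && (j \in A i :&: J0)]|%:R <= k.
Proof.
apply: le_trans (card_inB j); rewrite ler_nat; apply: subset_leq_card.
apply/fintype.subsetP => i; rewrite !inE => /andP[_ /andP[jA _]].
by have [/fintype.subsetP sAB _] := LD2X i; exact: sAB.
Qed.

(** 1 is sigma^-2 times the sum of E[X_i X_j] over the same local pairs. Each pair costs q_i + q_j
    for truncation and 2 h for rounding, and every index occurs at most [k] times in either
    position. *)
Lemma EU_discretized :
  `|E (variance_sum_local x A') - 1| <= 2 * (k * beta2 X k) + 2 * h * #|J|%:R ^+ 2.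
Proof.
have s2 : s ^+ 2 != 0 by rewrite expf_neq0 // gt_eqF.
have s20 : 0 <= (s ^+ 2)^-1 by rewrite invr_ge0 sqr_ge0.
have EUE : E (variance_sum_local x A') =
    \sum_(i in J0) \sum_(j in A i :&: J0) E (fun v => x i v * x j v).
  rewrite (eq_Ex _ (g := fun v => \sum_(i in J0) \sum_(j in A i :&: J0) x i v * x j v)).
    by rewrite Ex_sum; apply: eq_bigr => i _; rewrite Ex_sum.
  move=> v; rewrite /variance_sum_local [RHS]big_mkcond; apply: eq_bigr => i _.
  rewrite finset.inE /nbr_sum; case: ifPn => iA; last by rewrite x_null ?mul0r.
  by rewrite nbhd_cap // mulr_sumr.
have one : 1 = \sum_(i in J0) \sum_(j in A i :&: J0) (s ^+ 2)^-1 * EP (fun w => X i w * X j w).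
  rewrite -(mulVf s2) (sigma_sqr_local X2 EX LD1X Var) mulr_sumr; apply: eq_bigr => i _.
  by rewrite mulr_sumr.
have step i j : i \in J0 -> j \in A i :&: J0 ->
    `|E (fun v => x i v * x j v) - (s ^+ 2)^-1 * EP (fun w => X i w * X j w)| <=
    (q i + q j) + 2 * h.
  rewrite !finset.inE => iA /andP[_ jA].
  have IXX := intg_XX X2 i j.
  have Ixx : intg (fun w => x i (code w) * x j (code w)).
    exact: (intg_code P mcode (fun v => x i v * x j v)).
  rewrite -(EP_code P mcode (fun v => x i v * x j v)) -EPZ // -EPB //; last exact: intgZ.
  apply: le_trans (EP_norm (intgB Ixx (intgZ _ IXX))) _.
  rewrite /q -mulrDr -EPD // -EPZ; last exact: intgD.
  rewrite -[X in _ + X](EP_cst P) -EPD; [|by apply: intgZ; exact: intgD|exact: intg_cst].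
  apply: EP_le.
  - by apply: intg_abs; apply: intgB => //; exact: intgZ.
  - by apply: intgD; [apply: intgZ; exact: intgD|exact: intg_cst].
  move=> w; have [a1 a2] := xc w iA; have [c1 c2] := xc w jA.
  have u1 := xi1 i w; have u2 := xi1 j w.
  have e1 : `|x i (code w) * x j (code w) - xi i w * xi j w| <= 2 * h.
    rewrite (_ : _ - _ = - ((xi i w - x i (code w)) * xi j w
      + x i (code w) * (xi j w - x j (code w)))); last by ring.
    rewrite normrN; apply: le_trans (ler_normD _ _) _.
    rewrite (normrM (xi i w - _)) (normrM (x i _)).
    have g1 := ler_pM (normr_ge0 _) (normr_ge0 _) a2 u2.
    have g2 := ler_pM (normr_ge0 _) (normr_ge0 _) (le_trans a1 u1) c2.
    by move: g1 g2; rewrite mulr1 mul1r; lra.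
  have e2 : `|xi i w * xi j w - (s ^+ 2)^-1 * (X i w * X j w)| <=
      (s ^+ 2)^-1 * (big i w + big j w).
    rewrite (_ : _ - _ = (s ^+ 2)^-1 * (X i w * (`|X i w| <= s / k)%R%:R *
      (X j w * (`|X j w| <= s / k)%R%:R) - X i w * X j w)); last first.
      by rewrite /xi /trunc_scaled expr2 invfM; ring.
    rewrite normrM (ger0_norm s20) ler_wpM2l // trunc_prod //.
    by rewrite divr_ge0 // ltW.
  rewrite (_ : _ - _ = (xi i w * xi j w - (s ^+ 2)^-1 * (X i w * X j w)) +
    (x i (code w) * x j (code w) - xi i w * xi j w)); last by ring.
  by apply: le_trans (ler_normD _ _) _; exact: lerD.
rewrite EUE [X in _ - X]one -sumrB; apply: le_trans (ler_norm_sum _ _ _) _.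
apply: (@le_trans _ _ (\sum_(i in J0) \sum_(j in A i :&: J0) (q i + q j + 2 * h))).
  apply: ler_sum => i iJ; rewrite -sumrB; apply: le_trans (ler_norm_sum _ _ _) _.
  by apply: ler_sum => j jA; exact: step.
have sumq : \sum_i q i = beta2 X k by rewrite beta2E mulr_sumr.
have S1 : \sum_(i in J0) \sum_(j in A i :&: J0) q i <= k * beta2 X k.
  rewrite -sumq mulr_sumr big_mkcond; apply: ler_sum => i _.
  case: ifP => _; last by rewrite mulr_ge0 // ltW.
  by rewrite sum_card; exact: (ler_wpM2r (q0 i) (card_local i)).
have S2 : \sum_(i in J0) \sum_(j in A i :&: J0) q j <= k * beta2 X k.
  rewrite (exchange_big_dep xpredT) //= -sumq mulr_sumr; apply: ler_sum => j _.
  by rewrite sum_card; exact: (ler_wpM2r (q0 j) (card_local_r j)).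
have S3 : \sum_(i in J0) \sum_(j in A i :&: J0) (2 * h) <= 2 * h * #|J|%:R ^+ 2.
  rewrite (_ : 2 * h * _ = \sum_(i : J) \sum_(j : J) (2 * h)); last first.
    by rewrite !sumr_const -mulrnA -[RHS]mulr_natl natrM; ring.
  have h20 : 0 <= 2 * h by rewrite mulr_ge0.
  rewrite big_mkcond; apply: ler_sum => i _; case: ifP => _; last exact: sumr_ge0.
  by rewrite big_mkcond; apply: ler_sum => j _; case: ifP.
rewrite (eq_bigr (fun i => \sum_(j in A i :&: J0) q i + \sum_(j in A i :&: J0) q j
   + \sum_(j in A i :&: J0) (2 * h))) => [|i _]; last by rewrite !big_split.
by rewrite !big_split /=; lra.
Qed.

Lemma mem_nbhd i : i \in A' i.
Proof. by rewrite !finset.inE eqxx. Qed.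

Lemma local_dependence_discretized b bet : k ^+ 2 * beta3 X k <= b -> 0 < b ->
  2 * (k * beta2 X k) + 2 * h * #|J|%:R ^+ 2 <= bet -> k * beta2 X k + #|J|%:R * h <= bet ->
  bet <= 16^-1 -> local_dependence law x A' B' k b bet.
Proof.
move=> b3 b0 be be' b16; split => //.
- exact: law_ge0.
- exact: kappa_ge1.
- exact: mem_nbhd.
- exact: self_discretized.
- exact: block_discretized.
- exact: card_block_nbhd.
- exact: x_bound.
- by apply: le_trans b3; rewrite ler_wpM2l ?sqr_ge0 // cubes_discretized.
- exact: le_trans means_discretized be'.
- exact: le_trans EU_discretized be.
Qed.

(** Sums of grid values are integer multiples of h; within [-1, 1], the index is that integer
    shifted by [n]. *)
Lemma x_grid (D : {set J}) v : `|\sum_(j in D) x j v| <= 1 ->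
  exists2 m, (m <= n + n)%N & \sum_(j in D) x j v = tau h n m.
Proof.
have hn : h * n%:R = 1 by rewrite mulVf // pnatr_eq0 -lt0n.
have h00 : 0 < h by rewrite invr_gt0 ltr0n.
have [z ->] : exists z : int, \sum_(j in D) x j v = h * z%:~R.
  apply: (big_ind (fun r => exists z : int, r = h * z%:~R)).
  - by exists 0; rewrite mulr0.
  - by move=> _ _ [z1 ->] [z2 ->]; exists (z1 + z2); rewrite intrD mulrDr.
  move=> j _; rewrite /x; case: ifP => _; last by exists 0; rewrite mulr0.
  by exists ((v j)%:Z - n%:Z); rewrite /tau intrD intrN !pmulrn.
rewrite normrM (gtr0_norm h00) -[leRHS]hn ler_pM2l // -intr_norm pmulrn ler_int => zn.
exists (absz (z + n%:Z)); first by move: zn; lia.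
by rewrite /tau; congr (h * _); rewrite pmulrn gez0_abs;
  [rewrite intrD !pmulrn; ring|move: zn; lia].
Qed.

End Transfer.

(** * Comparison with the discretized statistic *)

Section Perturbation.
Variables (R : realType) (J : finType) (A : J -> {set J}) (u v : J -> R) (h : R).
Hypotheses (h0 : 0 <= h) (J0 : (0 < #|J|)%N).
Hypotheses (u1 : forall i, `|u i| <= 1) (v1 : forall i, `|v i| <= 1).
Hypothesis uv : forall i, `|u i - v i| <= h.
Local Notation N := (#|J|%:R : R).

(** The quantity inside the positive part in V^2, with the means written out. *)
Definition studentizer (a : J -> R) : R :=
  \sum_i a i * (\sum_(j in A i) a j) - (\sum_i a i) * (\sum_i \sum_(j in A i) a j) / N.

Let N1 : 1 <= N. Proof. by rewrite (ler_nat R 1). Qed.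

Let sum_le (Q : pred J) (a : J -> R) (c : R) : 0 <= c -> (forall i, `|a i| <= c) ->
  `|\sum_(i | Q i) a i| <= N * c.
Proof.
move=> c0 ac; apply: le_trans (ler_norm_sum _ _ _) _.
apply: le_trans (ler_sum _ (fun i _ => ac i)) _.
by rewrite sum_card ler_wpM2r // ler_nat max_card.
Qed.

Lemma sum_perturbation (Q : pred J) : `|\sum_(i | Q i) u i - \sum_(i | Q i) v i| <= N * h.
Proof. by rewrite -sumrB; exact: sum_le. Qed.

Lemma quadratic_perturbation :
  `|\sum_i u i * (\sum_(j in A i) u j) - \sum_i v i * (\sum_(j in A i) v j)| <= 2 * N ^+ 2 * h.
Proof.
rewrite -sumrB; apply: (le_trans (sum_le (c := 2 * N * h) _ _ _)) => [| |].
- by rewrite !mulr_ge0.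
- move=> i; rewrite (_ : _ - _ = (u i - v i) * (\sum_(j in A i) u j) +
    v i * (\sum_(j in A i) u j - \sum_(j in A i) v j)); last by ring.
  apply: le_trans (ler_normD _ _) _; rewrite !normrM.
  have g1 := ler_pM (normr_ge0 _) (normr_ge0 _) (uv i) (sum_le (mem (A i)) ler01 u1).
  have g2 := ler_pM (normr_ge0 _) (normr_ge0 _) (v1 i) (sum_perturbation (mem (A i))).
  by move: g1 g2; rewrite mulr1 mul1r /=; lra.
by rewrite le_eqVlt; apply/orP; left; apply/eqP; ring.
Qed.

Lemma product_perturbation :
  `|(\sum_i u i) * (\sum_i \sum_(j in A i) u j) / N -
    (\sum_i v i) * (\sum_i \sum_(j in A i) v j) / N| <= 2 * N ^+ 2 * h.
Proof.
have N0 : 0 < N by exact: lt_le_trans N1.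
rewrite -mulrBl normrM normfV (ger0_norm (ltW N0)) ler_pdivrMr //.
rewrite (_ : _ - _ = (\sum_i u i - \sum_i v i) * (\sum_i \sum_(j in A i) u j) +
    (\sum_i v i) * (\sum_i \sum_(j in A i) u j - \sum_i \sum_(j in A i) v j)); last by ring.
apply: le_trans (ler_normD _ _) _; rewrite !normrM.
have N1' : 0 <= N * 1 by rewrite mulr1 ltW.
have Nh : 0 <= N * h by rewrite mulr_ge0 // ltW.
have g1 := ler_pM (normr_ge0 _) (normr_ge0 _) (sum_perturbation xpredT)
  (sum_le xpredT N1' (fun i => sum_le (mem (A i)) ler01 u1)).
have g2 : `|\sum_i \sum_(j in A i) u j - \sum_i \sum_(j in A i) v j| <= N * (N * h).
  by rewrite -sumrB; apply: sum_le => // i; exact: sum_perturbation.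
have g3 := ler_pM (normr_ge0 _) (normr_ge0 _) (sum_le xpredT ler01 v1) g2.
rewrite (_ : 2 * N ^+ 2 * h * N = N * h * (N * (N * 1)) + N * 1 * (N * (N * h))); last by ring.
exact: lerD g1 g3.
Qed.

Lemma studentizer_perturbation : `|studentizer u - studentizer v| <= 4 * N ^+ 2 * h.
Proof.
apply: le_trans (_ : 2 * N ^+ 2 * h + 2 * N ^+ 2 * h <= _); last by lra.
apply: le_trans (lerD quadratic_perturbation product_perturbation).
rewrite /studentizer; set a := \sum_i u i * _; set c := \sum_i v i * _.
set e := _ / N; set g := (\sum_i v i) * _ / N.
by rewrite (_ : _ - _ = (a - c) - (e - g)) ?ler_normB //; ring.
Qed.

(** Deviations of 1/4, 1/8 and 1/8 keep the statistic within 1/2 of 1. Half of rho pays for the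
    centering; rounding costs 3/2 N h through the sum and at most 6 N^3 h through the statistic, in
    all less than the other half. *)
Lemma studentized_perturbation (Uv rho : R) :
  Uv = \sum_i v i * (\sum_(j in A i) v j) ->
  rho <= 1000^-1 -> 16 * N ^+ 3 * h <= rho ->
  `|Uv - 1| <= 4^-1 ->
  8 * `|studentizer v - Uv| <= 1 ->
  3 * `|\sum_i v i| * `|studentizer v - Uv| <= rho ->
  [/\ 2^-1 <= studentizer u, studentizer u <= 2 &
   `|(\sum_i u i) * rsq (studentizer u) - (\sum_i v i) * rsq Uv| <= rho].
Proof.
move=> UvE rs Nh U1 ST S2T; have SP := studentizer_perturbation.
have N3 : N ^+ 2 * h <= N ^+ 3 * h.
  by rewrite [in leRHS]exprS -[leRHS]mulrA ler_peMl // mulr_ge0 // exprn_ge0.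
have N3' : N * h <= N ^+ 3 * h.
  by rewrite ler_wpM2r // -[leLHS]expr1 ler_weXn2l.
have rho_sum : `|\sum_i v i| <= N by have := sum_le xpredT ler01 v1; rewrite mulr1.
have s1 := sum_perturbation xpredT.
have ST' : `|studentizer v - Uv| <= 8^-1 by lra.
have SP' : `|studentizer u - studentizer v| <= 8^-1 by lra.
split.
- by move: SP' ST' U1; rewrite !ler_norml; lra.
- by move: SP' ST' U1; rewrite !ler_norml; lra.
rewrite (_ : _ - _ = (\sum_i u i - \sum_i v i) * rsq (studentizer u) +
   (\sum_i v i) * (rsq (studentizer u) - rsq Uv)); last by ring.
apply: le_trans (ler_normD _ _) _; rewrite !normrM (ger0_norm (rsq_ge0 _)).
have g1 := ler_pM (normr_ge0 _) (rsq_ge0 _) s1 (rsq_le (studentizer u)).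
have g2 := ler_wpM2l (normr_ge0 (\sum_i v i)) (rsq_lipschitz (studentizer u) Uv).
have g3 : `|studentizer u - Uv| <= 4 * N ^+ 2 * h + `|studentizer v - Uv|.
  rewrite (_ : _ - _ = (studentizer u - studentizer v) + (studentizer v - Uv)); last by ring.
  by apply: le_trans (ler_normD _ _) _; rewrite lerD2r.
have g4 := ler_wpM2l (normr_ge0 (\sum_i v i)) g3.
have g5 : `|\sum_i v i| * (N ^+ 2 * h) <= N * (N ^+ 2 * h).
  by rewrite ler_wpM2r // mulr_ge0 // exprn_ge0.
have g6 : N * (N ^+ 2 * h) = N ^+ 3 * h by rewrite mulrA -exprS.
have g7 : 0 <= N ^+ 3 * h by rewrite mulr_ge0 // exprn_ge0.
by rewrite g6 in g5; lra.
Qed.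

End Perturbation.

Lemma studentizerZ (R : realType) (J : finType) (A : J -> {set J}) (c : R) (a : J -> R) :
  studentizer A (fun i => c * a i) = c ^+ 2 * studentizer A a.
Proof.
rewrite /studentizer -mulr_sumr.
under eq_bigr => i _ do rewrite -mulr_sumr mulrACA.
under [X in _ - _ * X / _]eq_bigr => i _ do rewrite -mulr_sumr.
rewrite -!mulr_sumr; ring.
Qed.

(** * Scale invariance and measurability of W *)

Section Studentized.
Context d (T : measurableType d) (R : realType) (P : probability T R) (J : finType).
Variables (X : J -> {RV P >-> R}) (A : J -> {set J}).
Hypothesis J_gt0 : (0 < #|J|)%N.

Lemma VE w : V X A w = Num.sqrt (Num.max (studentizer A (fun i => X i w)) 0).
Proof.
rewrite /V; congr (Num.sqrt (Num.max _ _)); rewrite sumrB /studentizer; congr (_ - _).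
rewrite sumr_const /Xbar /Ybar -[LHS]mulr_natl.
have N0 : #|J|%:R != 0 :> R by rewrite pnatr_eq0 -lt0n.
rewrite (_ : #|_| = #|J|) //; set a := \sum_i _; set c := \sum_i _.
by rewrite /Y -/c; field.
Qed.

(** W is invariant under scaling, and in this range V is positive and clipping is inactive. *)
Lemma W_rsq s w : 0 < s -> let a i := s^-1 * X i w in
  2^-1 <= studentizer A a -> studentizer A a <= 2 ->
  W X A w = (\sum_i a i) * rsq (studentizer A a).
Proof.
move=> s0 a; rewrite /a studentizerZ exprVn /W VE; set q := studentizer A _ => q1 q2.
have s20 : 0 < s ^- 2 by rewrite invr_gt0 exprn_gt0.
have q0 : 0 < q by rewrite -(pmulr_rgt0 _ s20); lra.
have qE : q = s ^+ 2 * (s ^- 2 * q) by rewrite mulrA divff ?mul1r // gt_eqF // exprn_gt0.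
rewrite max_l ?(ltW q0) // gt_eqF ?sqrtr_gt0 //.
have -> : Num.sqrt q = s * Num.sqrt (s ^- 2 * q).
  by rewrite {1}qE sqrtrM ?sqr_ge0 // sqrtr_sqr (gtr0_norm s0).
have -> : rsq (s ^- 2 * q) = (Num.sqrt (s ^- 2 * q))^-1.
  rewrite /rsq; congr (Num.sqrt _)^-1; rewrite /clip q2.
  by case: (lerP _ 2^-1) => // h; apply/eqP; rewrite eq_le h q1.
rewrite -mulr_sumr /sumX invfM; ring.
Qed.

Lemma measurable_Y i : measurable_fun setT (Y X A i).
Proof.
rewrite /Y (_ : (fun w => _) = fun w => \sum_j (if j \in A i then X j w else 0)).
  by apply: measurable_sum => j; case: (j \in A i) => //; exact: measurable_funPT.
by apply/funext => w; rewrite big_mkcond.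
Qed.

Lemma measurable_V : measurable_fun setT (V X A).
Proof.
apply: (measurableT_comp (f := @Num.sqrt R)).
  by apply: continuous_measurable_fun; exact: sqrt_continuous.
apply: measurable_maxr => //; apply: measurable_sum => i; apply: measurable_funB.
  by apply: measurable_funM; [exact: measurable_funPT|exact: measurable_Y].
apply: measurable_funM; apply: measurable_funM => //; apply: measurable_sum => j.
  exact: measurable_funPT.
exact: measurable_Y.
Qed.

(** Off the zero set of V the inequality is multiplied through by V, so that no quotient has to be
    measured. *)
Lemma measurable_W_le z : measurable [set w | (W X A w <= z)%R].
Proof.
have mW : measurable_fun setT (fun w => (W X A w <= z)%R).
  rewrite (_ : (fun w => _) =
      fun w => if V X A w == 0 then (0 <= z)%R else (sumX X w <= z * V X A w)%R).
    apply: measurable_fun_ifT => //; first exact: measurable_fun_eqr measurable_V _.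
    apply: measurable_fun_ler; last by apply: measurable_funM => //; exact: measurable_V.
    by apply: measurable_sum => j; exact: measurable_funPT.
  apply/funext => w; rewrite /W; case: eqVneq => // V0.
  by rewrite ler_pdivrMr // lt_def V0 sqrtr_ge0.
by have := mW measurableT [set true] I; rewrite setTI preimage_true.
Qed.

End Studentized.

Section Indicator.
Context d (T : measurableType d) (R : realType) (P : probability T R).
Variable Q : T -> bool.
Hypothesis mQ : measurable [set w | Q w].

Let QE : (fun w => (Q w)%:R : R) = \1_[set w | Q w].
Proof.
apply/funext => w; rewrite indicE; congr (nat_of_bool _)%:R.
by apply/idP/idP => [|/set_mem //]; exact: mem_set.
Qed.

Lemma intg_bool : intg P (fun w => (Q w)%:R).
Proof. by rewrite QE; exact: integrable_indic. Qed.

Lemma EP_bool : EP P (fun w => (Q w)%:R) = fine (P [set w | Q w]).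
Proof. by rewrite QE /EP /Rintegral integral_indic // setIT. Qed.

End Indicator.

(** * Return to the original probability space *)

Section Transfer.
Context d (T : measurableType d) (R : realType) (P : probability T R) (J : finType).
Variables (X : J -> {RV P >-> R}) (A B : J -> {set J}) (k : R) (n : nat).
Hypothesis X2 : forall i, (X i : T -> R) \in Lfun P 2%:E.
Hypothesis EX : forall i, ('E_P[X i] = 0)%E.
Hypothesis LD1X : LD1 X A.
Hypothesis LD2X : LD2 X A B.
Hypothesis Var : (0 < 'V_P[sumX X])%E.
Hypothesis deg : (max_degree A B)%:R <= k.
Hypothesis n0 : (0 < n)%N.
Hypothesis J_gt0 : (0 < #|J|)%N.
Local Notation EP := (EP P).
Local Notation intg := (intg P).
Local Notation s := (sigma X).
Local Notation N := (#|J|%:R : R).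
Let h : R := n%:R^-1.
Variable rho : R.
Hypotheses (rho0 : 0 < rho) (rho_small : rho <= 1000^-1) (rho_sqr : rho ^+ 2 = k / N).
Hypothesis h_small : 16 * N ^+ 3 * h <= rho.

Let s0 : 0 < s. Proof. exact: (sigma_gt0 X2 EX Var). Qed.
Let k1 : 1 <= k. Proof. exact: (kappa_ge1 X2 EX LD1X LD2X Var deg). Qed.
Let k0 : 0 < k. Proof. exact: lt_le_trans k1. Qed.
Let h0 : 0 <= h. Proof. by rewrite invr_ge0. Qed.

Local Notation xi := (truncated X s k).
Local Notation x := (discretized A k (n := n)).
Local Notation code := (code X s k n).
Local Notation law := (law P code).
Local Notation E := (Ex law).
Local Notation A' := (nbhd A).
Local Notation B' := (block_nbhd A B).
Local Notation Sx := (total x).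
Local Notation Ux := (variance_sum_local x A').
Local Notation Tx := (nbr_total x A' k).

Definition Wx v := Sx v * rsq (Ux v).
(* [bad v < 1] bounds each of the three terms by 1, and E[bad] is small. *)
Definition bad v := 16 * (Ux v - 1) ^+ 2 + (8 * rho ^+ 2 * (`|Sx v| * `|Tx v|) +
  3 * rho * (Sx v ^+ 2 * `|Tx v|)).

Lemma bad_ge0 v : 0 <= bad v.
Proof.
have r0 := ltW rho0.
have q1 := sqr_ge0 (Ux v - 1).
have q2 := mulr_ge0 (sqr_ge0 rho) (mulr_ge0 (normr_ge0 (Sx v)) (normr_ge0 (Tx v))).
have q3 := mulr_ge0 r0 (mulr_ge0 (sqr_ge0 (Sx v)) (normr_ge0 (Tx v))).
by rewrite /bad; lra.
Qed.

(** On the discretized values the centering in V^2 is exactly rho^2 S T. Bounding the three terms of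
    [bad] by 1 gives the three closeness conditions of [studentized_perturbation]. *)
Lemma W_close w : (forall i, `|X i w| <= s / k) -> (forall i, i \notin A i -> X i w = 0) ->
  bad (code w) < 1 -> `|W X A w - Wx (code w)| <= rho.
Proof.
move=> Xs X0 bw; set v := code w in bw *; have r0 := ltW rho0.
pose u i := s^-1 * X i w.
have uE i : u i = xi i w by rewrite /u /xi /trunc_scaled Xs mulr1 mulrC.
have u1 i : `|u i| <= 1 by rewrite uE; exact: trunc_scaled_le1.
have x1 i : `|x i v| <= 1.
  by apply: le_trans (x_bound X2 EX LD1X LD2X Var deg i v) _; rewrite invf_le1.
have ux i : `|u i - x i v| <= h.
  have [iA|iA] := boolP (i \in A i).
    by rewrite uE; have [] := x_code X s0 k1 n0 w iA.
  by rewrite /u X0 // x_null // mulr0 subr0 normr0.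
have N0 : 0 < N by rewrite ltr0n.
have UE : Ux v = \sum_i x i v * (\sum_(j in A i) x j v).
  by apply: eq_bigr => i _; rewrite y_discretized.
have stE : studentizer A (x^~ v) - Ux v = - (rho ^+ 2 * (Sx v * Tx v)).
  rewrite UE /studentizer addrAC subrr add0r; congr (- _); rewrite rho_sqr /nbr_total.
  rewrite (eq_bigr _ (fun i _ => y_discretized A k i v)) /total.
  by field; rewrite !gt_eqF.
have stN : `|studentizer A (x^~ v) - Ux v| = rho ^+ 2 * (`|Sx v| * `|Tx v|).
  by rewrite stE normrN normrM normrX (ger0_norm r0) normrM.
move: bw; rewrite /bad; set q1 := (Ux v - 1) ^+ 2; set q2 := `|Sx v| * `|Tx v|.
set q3 := _ * `|Tx v| => bw.
have q1p : 0 <= q1 by exact: sqr_ge0.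
have q2p : 0 <= rho ^+ 2 * q2.
  by exact: (mulr_ge0 (sqr_ge0 rho) (mulr_ge0 (normr_ge0 (Sx v)) (normr_ge0 (Tx v)))).
have q3p : 0 <= rho * q3.
  by exact: (mulr_ge0 r0 (mulr_ge0 (sqr_ge0 (Sx v)) (normr_ge0 (Tx v)))).
have q23p := addr_ge0 q2p q3p.
have U1 : `|Ux v - 1| <= 4^-1.
  rewrite -(@ler_pXn2r _ 2) ?nnegrE // real_normK ?num_real //.
  by rewrite -/q1 exprVn; lra.
have H1 : 8 * `|studentizer A (x^~ v) - Ux v| <= 1 by rewrite stN -/q2; lra.
have H2 : 3 * `|\sum_i x i v| * `|studentizer A (x^~ v) - Ux v| <= rho.
  rewrite stN (_ : 3 * _ * _ = rho * (3 * (rho * q3))); first by rewrite ler_piMr //; lra.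
  by rewrite /q3 -(real_normK (num_real (Sx v))) /total; ring.
have [G1 G2 G3] := studentized_perturbation (A := A) h0 J_gt0 u1 x1 ux UE
  rho_small h_small U1 H1 H2.
by rewrite (W_rsq J_gt0 s0 G1 G2).
Qed.

Let big_event i w : bool := s / k < `|X i w|.
Let null_event i w : bool := (i \notin A i) && (X i w != 0).

Let measurable_big i : measurable [set w | big_event i w].
Proof.
have mb : measurable_fun setT (big_event i).
  apply: measurable_fun_ltr => //; apply: measurableT_comp => //; exact: measurable_funPT.
by have := mb measurableT [set true] I; rewrite setTI preimage_true.
Qed.

Let measurable_null i : measurable [set w | null_event i w].
Proof.
rewrite /null_event; case: (i \notin A i) => /=; first exact: measurable_neq0.
by rewrite (_ : [set _ | _] = set0) //; apply/seteqP; split.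
Qed.

(** At least 1 wherever the comparison fails, so that its mean bounds the probability of failure, as
    in Markov's inequality. *)
Definition discrepancy w := \sum_i (big_event i w)%:R + \sum_i (null_event i w)%:R +
  bad (code w).

Lemma discrepancy_ge0 w : 0 <= discrepancy w.
Proof. by apply: addr_ge0 (bad_ge0 _); apply: addr_ge0; exact: sumr_ge0. Qed.

Lemma W_close_or w : `|W X A w - Wx (code w)| <= rho \/ 1 <= discrepancy w.
Proof.
have b0 := bad_ge0 (code w).
have sum1 (e : J -> bool) i : e i -> 1 <= \sum_j (e j)%:R :> R.
  by move=> ei; rewrite (bigD1 i) //= ei lerDl sumr_ge0.
have s_ge0 (e : J -> bool) : 0 <= \sum_j (e j)%:R :> R by rewrite sumr_ge0.
have := s_ge0 (big_event^~ w); have := s_ge0 (null_event^~ w) => g1 g2.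
have [/existsP[i bi]|/existsPn nb] := boolP [exists i, big_event i w].
  by right; rewrite /discrepancy; have := sum1 (big_event^~ w) i bi; lra.
have [/existsP[i bi]|/existsPn nn] := boolP [exists i, null_event i w].
  by right; rewrite /discrepancy; have := sum1 (null_event^~ w) i bi; lra.
have [b1|b1] := ltP (bad (code w)) 1; last by right; rewrite /discrepancy; lra.
left; apply: W_close => // i; first by have := nb i; rewrite -leNgt.
by move=> iA; have := nn i; rewrite /null_event iA /= negbK => /eqP.
Qed.

Let mcode := mcode X2 EX LD1X LD2X Var deg n0.

Lemma intg_discrepancy : intg discrepancy.
Proof.
apply: intgD; last exact: (intg_code P mcode bad).
by apply: intgD; apply: intg_sum => i _; exact: intg_bool.
Qed.

Lemma EP_discrepancy : EP discrepancy = beta0 X k + E bad.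
Proof.
have I1 i : intg (fun w => (big_event i w)%:R) by exact: intg_bool.
have I2 i : intg (fun w => (null_event i w)%:R) by exact: intg_bool.
rewrite /discrepancy EPD; [|by apply: intgD; exact: intg_sum|exact: (intg_code P mcode bad)].
rewrite EPD; [|exact: intg_sum|exact: intg_sum].
rewrite (EP_code P mcode) !EP_sum // [X in _ + X + _]big1 => [|i _].
  rewrite addr0; congr (_ + _); apply: eq_bigr => i _; exact: EP_bool.
rewrite EP_bool //; have [iA|iA] := boolP (i \in A i).
  rewrite (_ : [set _ | _] = set0) ?measure0 //.
  by apply/seteqP; split => w //=; rewrite /null_event iA.
rewrite (_ : [set _ | _] = [set w | X i w != 0]) ?(null_prob X2 EX LD1X) //.
by apply/seteqP; split => w /=; rewrite /null_event iA.
Qed.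

Lemma EPW_le z : fine (P [set w | (W X A w <= z)%R]) <=
  E (fun v => (Wx v <= z + rho)%R%:R) + (beta0 X k + E bad).
Proof.
have mW := measurable_W_le X A z.
rewrite -(EP_bool P mW) -EP_discrepancy -(EP_code P mcode).
have I1 := intg_code P mcode (fun v => (Wx v <= z + rho)%R%:R).
have I2 := intg_discrepancy.
rewrite -EPD //; apply: EP_le; [exact: intg_bool|exact: intgD|move=> w].
have d0 : 0 <= discrepancy w by exact: discrepancy_ge0.
have [cl|d1] := W_close_or w; last first.
  have : (W X A w <= z)%R%:R <= 1 :> R by case: (_ <= z)%R.
  have : 0 <= (Wx (code w) <= z + rho)%R%:R :> R by [].
  lra.
case: (lerP (W X A w) z) => Wz; last by rewrite addr_ge0.
rewrite (_ : (Wx _ <= _)%R = true) ?lerDl //.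
by move: cl; rewrite ler_norml => /andP[c1 c2]; lra.
Qed.

Lemma EPW_ge z : E (fun v => (Wx v <= z - rho)%R%:R) - (beta0 X k + E bad) <=
  fine (P [set w | (W X A w <= z)%R]).
Proof.
have mW := measurable_W_le X A z.
rewrite -(EP_bool P mW) -EP_discrepancy -(EP_code P mcode) lerBlDr.
have I1 := intg_code P mcode (fun v => (Wx v <= z - rho)%R%:R).
have I2 := intg_discrepancy.
have I3 := intg_bool P mW.
rewrite -EPD //; apply: EP_le; [exact: I1|exact: intgD|move=> w].
have d0 : 0 <= discrepancy w by exact: discrepancy_ge0.
have [cl|d1] := W_close_or w; last first.
  have : (Wx (code w) <= z - rho)%R%:R <= 1 :> R by case: (_ <= z - rho)%R.
  have : 0 <= (W X A w <= z)%R%:R :> R by [].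
  lra.
case: (lerP (Wx (code w)) (z - rho)) => Wz; last by rewrite addr_ge0.
rewrite (_ : (W X A w <= z)%R = true) ?lerDl //.
by move: cl; rewrite ler_norml => /andP[c1 c2]; lra.
Qed.

Local Notation th := (theta X A k).
(** Adding rho makes [b] positive even when [beta3] is 0 and at least h; in [bet] it absorbs the
    rounding errors. It is harmless because rho is among the final error terms. *)
Let b := k ^+ 2 * beta3 X k + rho.
Let bet := 2 * (k * beta2 X k) + rho.
Hypotheses (b_small : b <= 336^-1) (bet_small : bet <= 16^-1).

Lemma beta0_ge0 : 0 <= beta0 X k.
Proof. by apply: sumr_ge0 => i _; exact: fine_ge0. Qed.

Lemma beta2_ge0 : 0 <= beta2 X k.
Proof.
rewrite mulr_ge0 ?invr_ge0 ?sqr_ge0 // sumr_ge0 // => i _; rewrite expectationE.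
by apply: EP_ge0 => w; rewrite mulr_ge0 ?exprn_ge0.
Qed.

Lemma beta3_ge0 : 0 <= beta3 X k.
Proof.
rewrite mulr_ge0 ?invr_ge0 ?exprn_ge0 ?(ltW s0) // sumr_ge0 // => i _; rewrite expectationE.
by apply: EP_ge0 => w; rewrite mulr_ge0 ?exprn_ge0.
Qed.

Lemma theta_ge0 : 0 <= th.
Proof.
rewrite mulr_ge0 ?invr_ge0 ?sqr_ge0 // sumr_ge0 // => i _; rewrite sumr_ge0 // => j _.
by rewrite expectationE; exact: EP_ge0.
Qed.

Let N1 : 1 <= N. Proof. by rewrite (ler_nat R 1). Qed.

Let LDx : local_dependence law x A' B' k b bet.
Proof.
have kb2 : 0 <= k * beta2 X k by rewrite mulr_ge0 ?beta2_ge0 // ltW.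
have kb3 : 0 <= k ^+ 2 * beta3 X k by rewrite mulr_ge0 ?beta3_ge0 ?sqr_ge0.
have N2 : N ^+ 2 * h <= N ^+ 3 * h by rewrite ler_wpM2r // ler_weXn2l.
have N3 : N * h <= N ^+ 3 * h by rewrite ler_wpM2r // -[leLHS]expr1 ler_weXn2l.
have N0 : 0 <= N ^+ 2 * h by rewrite mulr_ge0 ?sqr_ge0.
have := h_small; have := rho0 => r0 hs.
apply: (local_dependence_discretized X2 EX LD1X LD2X Var deg n0) => //; rewrite /b /bet -?/h; lra.
Qed.

Let thx := theta_discretized X2 EX LD1X LD2X Var deg n0.

Lemma E_bad : E bad <= 32 * (b + bet) + 200 * (rho * (1 + th)).
Proof.
have th0 := theta_ge0.
rewrite /bad !ExD !ExZ.
have m1 := U_concentration LDx; have m2 := ST_moment LDx thx; have m3 := S2T_moment LDx thx.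
have r0 := ltW rho0.
have g2 := ler_wpM2l (sqr_ge0 rho) m2; have g3 := ler_wpM2l r0 m3.
have g4 : rho ^+ 2 * (1 + th) <= rho * (1 + th).
  have := rho_small => rs; rewrite ler_wpM2r ?expr2 ?ler_piMr //; lra.
have g5 : 0 <= rho * (1 + th) by rewrite mulr_ge0 //; lra.
lra.
Qed.

Lemma berry_esseen_x z : `|E (fun v => (Wx v <= z)%R%:R) - Phi z| <=
  2000 * (1000 * (b * (1 + th))) + 25 * bet.
Proof.
have [f St] := stein_solution_normal z.
have nR : 0 < n%:R :> R by rewrite ltr0n.
apply: (kolmogorov LDx thx (h := h) (n := n) _ _ _ _ _ St).
- by rewrite invr_gt0.
- by rewrite mulVf // gt_eqF.
- have kb3 : 0 <= k ^+ 2 * beta3 X k by rewrite mulr_ge0 ?beta3_ge0 ?sqr_ge0.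
  have N3 : h <= N ^+ 3 * h by rewrite ler_peMl // exprn_ege1.
  have := h_small; have := rho0; have := h0; rewrite /b; lra.
- exact: b_small.
- by move=> j v; apply: x_grid => //; exact: (y_le1 LDx).
Qed.

(** Moving z by rho changes [Phi] by at most rho, the density being at most 1. *)
Lemma berry_esseen z : `|fine (P [set w | (W X A w <= z)%R]) - Phi z| <=
  rho + beta0 X k + (32 * (b + bet) + 200 * (rho * (1 + th))) +
  (2000 * (1000 * (b * (1 + th))) + 25 * bet).
Proof.
have b1 := berry_esseen_x (z + rho); have b2 := berry_esseen_x (z - rho).
have eb := E_bad; have u := EPW_le z; have l := EPW_ge z.
have r0 := ltW rho0.
have p1 : Phi (z + rho) <= Phi z + (z + rho - z) by apply: Phi_lipschitz; lra.
have p2 : Phi z <= Phi (z - rho) + (z - (z - rho)) by apply: Phi_lipschitz; lra.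
move: b1 b2; rewrite !ler_norml => /andP[b11 b12] /andP[b21 b22].
by apply/andP; split; lra.
Qed.

End Transfer.

Theorem theorem2p1 (R : realType) :
  exists C : R, 0 < C /\
  forall (d : measure_display) (T : measurableType d) (P : probability T R)
    (J : finType) (X : J -> {RV P >-> R}) (A B : J -> {set J}) (kappa : R),
    (0 < #|J|)%N ->
    (forall i, (X i : T -> R) \in Lfun P 2%:E) ->
    (forall i, ('E_P[X i] = 0)%E) ->
    LD1 X A ->
    LD2 X A B ->
    (0 < 'V_P[sumX X])%E ->
    (max_degree A B)%:R <= kappa ->
    (ereal_sup (range (fun z : R =>
       `|P [set w | (W X A w <= z)%R]%classic - (Phi z)%:E|)) <=
     (C * ((1 + theta X A kappa) * kappa ^+ 2 * beta3 X kappa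
           + kappa * beta2 X kappa + beta0 X kappa)
      + C * Num.sqrt kappa * (theta X A kappa + 1)
          * (Num.sqrt (#|J|%:R))^-1)%:E)%E.
Proof.
exists (1000 * (1000 * 1000)); split; first lra.
move=> d T P J X A B k J_gt0 X2 EX LD1X LD2X Var deg.
have k1 := kappa_ge1 X2 EX LD1X LD2X Var deg.
have b0 := beta0_ge0 X k; have b2 := beta2_ge0 X k.
have b3 := beta3_ge0 k X2 EX Var; have th0 := theta_ge0 X A k.
set N : R := #|J|%:R; have N0 : 0 < N by rewrite ltr0n.
pose rho := Num.sqrt k / Num.sqrt N.
have rho0 : 0 < rho by rewrite divr_gt0 // sqrtr_gt0 //; lra.
have rho_sqr : rho ^+ 2 = k / N by rewrite exprMn exprVn !sqr_sqrtr //; lra.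
pose th := theta X A k; pose kb2 := k * beta2 X k; pose kb3 := k ^+ 2 * beta3 X k.
have kb20 : 0 <= kb2 by rewrite mulr_ge0 //; lra.
have kb30 : 0 <= kb3 by rewrite mulr_ge0 ?sqr_ge0.
have tkb3 : 0 <= th * kb3 by rewrite mulr_ge0.
have trho : 0 <= th * rho by rewrite mulr_ge0 // ltW.
pose err := (1 + th) * kb3 + kb2 + beta0 X k + rho * (1 + th).
rewrite (_ : _ + _ * _^-1 = 1000 * (1000 * 1000) * err); last first.
  by rewrite /err /rho /kb3 /kb2 -/th; ring.
apply: ub_ereal_sup => _ [z _ <-]; rewrite -(fineK (fin_num_measure P _ (measurable_W_le X A z))).
(* If the error is at least 1/1000, the right side exceeds 1 and the bound is trivial; otherwise the
   smallness hypotheses all hold. *)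
rewrite lee_fin; have [small|large] := ltP err 1000^-1; last first.
  apply: (@le_trans _ _ 1); last by lra.
  have p0 : 0 <= fine (P [set w | (W X A w <= z)%R]) by exact: fine_ge0.
  have p1 : fine (P [set w | (W X A w <= z)%R]) <= 1.
    rewrite -lee_fin fineK ?probability_le1 ?fin_num_measure //; exact: measurable_W_le.
  by have := Phi_ge0 z; have := Phi_le1 z; rewrite ler_norml; lra.
(* The grid is chosen last, fine enough for all rounding errors to stay below rho. *)
pose n := (Num.trunc (16 * N ^+ 3 / rho)).+1.
have hn : 16 * N ^+ 3 * n%:R^-1 <= rho.
  by rewrite ler_pdivrMr ?ltr0n // [leRHS]mulrC -ler_pdivrMr // ltW // truncnS_gt.
have rho_small : rho <= 1000^-1 by move: small; rewrite /err; lra.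
have b_small : k ^+ 2 * beta3 X k + rho <= 336^-1.
  by move: small; rewrite -/kb3 /err; lra.
have bet_small : 2 * (k * beta2 X k) + rho <= 16^-1.
  by move: small; rewrite -/kb2 /err; lra.
have := berry_esseen X2 EX LD1X LD2X Var deg (ltn0Sn _ : (0 < n)%N) J_gt0 rho0 rho_small
  rho_sqr hn b_small bet_small z.
rewrite -/kb2 -/kb3 -/th => H; apply: le_trans H _; rewrite /err; lra.
Qed.
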